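(* Let $1\le s<\infty$ and let $T$ be a linear operator which is bounded on $L^2(X)$. Assume that for all $w\in A_1\cap RH_s$, $T$ is bounded from $wL^\infty$ to $\mathrm{BMO}_{\mathcal{A}}(X,w)$ and $T^*$ is bounded from $wL^\infty$ to $\mathrm{BMO}_{\mathcal{A}^*}(X,w)$. Then $T$ is bounded on $L^p_w(X)$ for all $s<p<\infty$ and all $w\in A_{p/s}$.
   Context: Setting. $(X,d)$ is a metric space with a nonnegative Borel measure $\mu$ that is doubling: there is $C\ge 1$ with $\mu(B(x,2r))\le C\mu(B(x,r))<\infty$ for all $x\in X$, $r>0$, where $B(x,r)=\{y:d(x,y)<r\}$; balls have positive measure. Write $V(E)=\mu(E)$, $V(x,r)=\mu(B(x,r))$; for a ball $B$, $r_B$ is its radius; $\frac1{V(B)}\int_B h\,d\mu$ is written $⨍_B h$ or $\langle h\rangle_B$. Weights. A weight $w$ is a nonnegative locally integrable function on $X$ (not a.e. zero); $w(E)=\int_E w\,d\mu$. For $1<p<\infty$, $w\in A_p$ means $\sup_B \langle w\rangle_B\,\langle w^{-1/(p-1)}\rangle_B^{p-1}<\infty$; $w\in A_1$ means there is $C$ with $\langle w\rangle_B\le C\,w(x)$ for a.e. $x\in B$, for every ball $B$. For $1<q<\infty$, $w\in RH_q$ means there is $C$ with $\langle w^q\rangle_B^{1/q}\le C\langle w\rangle_B$ for every ball $B$; $RH_1$ is the class of all weights (the condition being void for $q=1$), so $A_1\cap RH_1=A_1$. $L^p_w(X)$ has norm $\|f\|_{L^p_w}=(\int_X|f|^pw\,d\mu)^{1/p}$.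 The family $\{\mathcal{A}_t\}_{t>0}$. Each $\mathcal{A}_t$ is an integral operator $\mathcal{A}_tf(x)=\int_X a_t(x,y)f(y)\,d\mu(y)$, with kernel satisfying, for fixed constants $m\ge 2$, $C,c>0$, $$|a_t(x,y)|\le \frac{C}{V(x,t^{1/m})}\exp\Big(-c\,\frac{d(x,y)^{m/(m-1)}}{t^{1/(m-1)}}\Big)\quad\text{for all } t>0,\ x,y\in X,$$ and the operators commute: $\mathcal{A}_s\mathcal{A}_t=\mathcal{A}_t\mathcal{A}_s$ for all $s,t>0$. $\mathcal{A}^*=\{\mathcal{A}_t^*\}_{t>0}$ is the family of adjoints, with kernels $\overline{a_t(y,x)}$. The class $\mathcal{M}$. For $x_0\in X$, $\beta>0$, $f\in L^1_{loc}(X)$ is of type $(x_0,\beta)$ if $\int_X \frac{|f(x)|^2}{(1+d(x_0,x))^{\beta}V(x_0,1+d(x_0,x))}\,d\mu(x)<\infty$. $\mathcal{M}$ is the set of all functions of type $(x_0,\beta)$ for some $x_0\in X$, $0<\beta<\infty$. $\mathrm{BMO}_{\mathcal{A}}(X,w)$ is the set of $f\in\mathcal{M}$ with $$\|f\|_{\mathrm{BMO}_{\mathcal{A}}(X,w)}=\sup_B\frac1{w(B)}\int_B|(I-\mathcal{A}_{t_B})f|\,d\mu<\infty,\qquad t_B=r_B^m,$$ the supremum being over all balls; $\mathrm{BMO}_{\mathcal{A}^*}(X,w)$ is defined in the same way with $\mathcal{A}_t^*$ in place of $\mathcal{A}_t$. An operator $S$ is bounded from $wL^\infty$ to $\mathrm{BMO}_{\mathcal{A}}(X,w)$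 if there is $c$ such that $\|S(fw)\|_{\mathrm{BMO}_{\mathcal{A}}(X,w)}\le c\|f\|_{L^\infty}$ for all $f\in L^\infty(X)$ for which $S(fw)$ is defined, i.e. with $fw\in L^2(X)$ (similarly for $\mathcal{A}^*$). ''$T$ is bounded on $L^p_w(X)$'' means $\|Tf\|_{L^p_w}\le C\|f\|_{L^p_w}$ for all $f\in L^2(X)\cap L^p_w(X)$, with $C$ independent of $f$. *)

(* Defs.v *)
From HB Require Import structures.
From mathcomp Require Import all_boot all_order all_algebra.
From mathcomp Require Import complex.
From mathcomp Require Import all_classical all_reals all_analysis.

Set Implicit Arguments.
Unset Strict Implicit.
Unset Printing Implicit Defensive.

Import Order.TTheory GRing.Theory Num.Theory.
Import numFieldNormedType.Exports.
Import ComplexField.Normc.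

Local Open Scope classical_set_scope.
Local Open Scope ring_scope.

HB.mixin Record isBorelMetric (R : realType) (d : measure_display) X
    & Metric R X & Measurable d X := {
  measurable_borel : @measurable d X = <<s @open X >>
}.

#[short(type="borelMetricType")]
HB.structure Definition BorelMetric (R : realType) (d : measure_display) :=
  { X of Metric R X & Measurable d X & isBorelMetric R d X }.

Section ComplexFunctions.
Context {R : realType} {d : measure_display} {Y : measurableType d}.
Implicit Types f g : Y -> R[i].

Definition cmeasurable f : Prop :=
  measurable_fun [set: Y] (fun y => complex.Re (f y)) /\
  measurable_fun [set: Y] (fun y => complex.Im (f y)).

Variable mu : {measure set Y -> \bar R}.

(* Only meaningful when |f| is integrable: Rintegral is 0 on divergent
   integrals. *)
Definition cintegral f : R[i] :=
  Complex (\int[mu]_y complex.Re (f y)) (\int[mu]_y complex.Im (f y)).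

Definition cLnorm (p : \bar R) f : \bar R :=
  Lnorm mu p (fun y => (normc (f y))%:E).

Definition in_cL (p : \bar R) f : Prop :=
  cmeasurable f /\ (cLnorm p f < +oo)%E.

Definition cinner f g : R[i] := cintegral (fun y => f y * conjc (g y)).

(* Operators on L^2 act on representatives; their values are only constrained
   almost everywhere, and only on L^2 functions. *)
Definition L2_bounded_linear (T : (Y -> R[i]) -> Y -> R[i]) : Prop :=
  [/\ forall f, in_cL 2%:E f -> in_cL 2%:E (T f),
      forall (z : R[i]) f g, in_cL 2%:E f -> in_cL 2%:E g ->
        {ae mu, forall y, T (fun u => z * f u + g u) y = z * T f y + T g y} &
      exists C : R, forall f, in_cL 2%:E f ->
        (cLnorm 2%:E (T f) <= C%:E * cLnorm 2%:E f)%E].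

Definition L2_adjoint (T Tstar : (Y -> R[i]) -> Y -> R[i]) : Prop :=
  (forall g, in_cL 2%:E g -> in_cL 2%:E (Tstar g)) /\
  (forall f g, in_cL 2%:E f -> in_cL 2%:E g ->
     cinner (T f) g = cinner f (Tstar g)).

Definition integral_op (k : Y -> Y -> R[i]) f (x : Y) : R[i] :=
  cintegral (fun y => k x y * f y).

Definition weighted_Lnorm (p : R) (w : Y -> R) f : \bar R :=
  ((\int[mu]_y (normc (f y) `^ p * w y)%:E) `^ p^-1)%E.

Definition in_weighted_L (p : R) (w : Y -> R) f : Prop :=
  cmeasurable f /\ (weighted_Lnorm p w f < +oo)%E.

Definition weighted_L_bounded (p : R) (w : Y -> R)
    (T : (Y -> R[i]) -> Y -> R[i]) : Prop :=
  exists C : R, forall f, in_cL 2%:E f -> in_weighted_L p w f ->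
    (weighted_Lnorm p w (T f) <= C%:E * weighted_Lnorm p w f)%E.

End ComplexFunctions.

Section DoublingSpaces.
Context {R : realType} {d : measure_display} {X : borelMetricType R d}.
Variable mu : {measure set X -> \bar R}.
Implicit Types (x : X) (r s t p q m : R) (w : X -> R) (f : X -> R[i]).

Definition doubling : Prop :=
  (forall x r, 0 < r -> (0 < mu (ball x r))%E) /\
  (exists2 C : R, 1 <= C & forall x r, 0 < r ->
     (mu (ball x (2 * r)) <= C%:E * mu (ball x r) < +oo)%E).

Definition vol x r : R := fine (mu (ball x r)).

Definition avg x r (h : X -> \bar R) : \bar R :=
  ((mu (ball x r))^-1 * \int[mu]_(y in ball x r) h y)%E.

(* Local integrability is integrability on every ball. *)
Definition weight w : Prop :=
  [/\ measurable_fun [set: X] w,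
      forall x, 0 <= w x,
      forall x r, 0 < r -> mu.-integrable (ball x r) (EFin \o w) &
      ~ {ae mu, forall x, w x = 0}].

(* The inverse in w^(-1/(p-1)) is taken in \bar R, so that it is +oo where
   w = 0; the real power 0 `^ (- (p - 1)^-1) would be 0. *)
Definition muckenhoupt_const p w : \bar R :=
  ereal_sup [set e | exists x r, 0 < r /\
    e = (avg x r (EFin \o w) *
         (avg x r (fun y => ((w y `^ (p - 1)^-1)%:E)^-1)) `^ (p - 1))%E].

Definition muckenhoupt p w : Prop :=
  weight w /\ (muckenhoupt_const p w < +oo)%E.

Definition muckenhoupt1 w : Prop :=
  weight w /\
  exists C : R, forall x r, 0 < r ->
    {ae mu, forall y, ball x r y -> (avg x r (EFin \o w) <= (C * w y)%:E)%E}.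

Definition reverse_holder q w : Prop :=
  weight w /\
  (1 < q -> exists C : R, forall x r, 0 < r ->
     ((avg x r (fun y => (w y `^ q)%:E)) `^ q^-1
      <= C%:E * avg x r (EFin \o w))%E).

Definition cL1loc f : Prop :=
  cmeasurable f /\
  forall x r, 0 < r -> (\int[mu]_(y in ball x r) (normc (f y))%:E < +oo)%E.

Definition of_type (x0 : X) (beta : R) f : Prop :=
  cL1loc f /\
  (\int[mu]_x (normc (f x) ^+ 2 /
     ((1 + mdist x0 x) `^ beta * vol x0 (1 + mdist x0 x)))%:E < +oo)%E.

Definition classM f : Prop :=
  exists x0 beta, 0 < beta /\ of_type x0 beta f.

(* a t is the kernel of the operator indexed by t; only t > 0 matters. *)
Definition kernel_family m (a : R -> X -> X -> R[i]) : Prop :=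
  [/\ forall t, 0 < t ->
        cmeasurable (fun xy : (X * X)%type => a t xy.1 xy.2),
      exists C c : R, [/\ 0 < C, 0 < c &
        forall t x y, 0 < t ->
          normc (a t x y) <= C / vol x (t `^ m^-1) *
            expR (- (c * (mdist x y `^ (m / (m - 1)) / t `^ (m - 1)^-1)))] &
      forall s t f, 0 < s -> 0 < t -> in_cL mu 2%:E f ->
        {ae mu, forall x,
          integral_op mu (a s) (integral_op mu (a t) f) x =
          integral_op mu (a t) (integral_op mu (a s) f) x}].

Definition adjoint_kernels (a : R -> X -> X -> R[i]) : R -> X -> X -> R[i] :=
  fun t x y => conjc (a t y x).

Definition bmo_norm m (a : R -> X -> X -> R[i]) w f : \bar R :=
  ereal_sup [set e | exists x r, 0 < r /\
    e = ((\int[mu]_(y in ball x r) (w y)%:E)^-1 *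
         \int[mu]_(y in ball x r)
           (normc (f y - integral_op mu (a (r `^ m)) f y))%:E)%E].

Definition in_bmo m (a : R -> X -> X -> R[i]) w f : Prop :=
  classM f /\ (bmo_norm m a w f < +oo)%E.

Definition bounded_wLinfty_bmo m (a : R -> X -> X -> R[i]) w
    (S : (X -> R[i]) -> X -> R[i]) : Prop :=
  exists c : R, forall f, in_cL mu +oo%E f ->
    let fw := fun x => f x * real_complex R (w x) in
    in_cL mu 2%:E fw ->
    in_bmo m a w (S fw) /\
    (bmo_norm m a w (S fw) <= c%:E * cLnorm mu +oo f)%E.

End DoublingSpaces.

(* Main.v *)
Require Import Defs.
From HB Require Import structures.
From mathcomp Require Import all_boot all_order all_algebra.
From mathcomp Require Import complex finmap ring lra.
From mathcomp Require Import all_classical all_reals all_analysis.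
From mathcomp Require Import measurable_realfun ess_sup_inf.

Set Implicit Arguments.
Unset Strict Implicit.
Unset Printing Implicit Defensive.

Import Order.TTheory GRing.Theory Num.Theory.
Import numFieldNormedType.Exports.

Local Open Scope classical_set_scope.
Local Open Scope ring_scope.

(** If [T] is not bounded on [L^p_w], there are functions [f_k] of norm at most
[t_k] such that the norm of [T f_k] exceeds [16^k t_k]. The function
[H = sum_k 4^-k (|f_k| / t_k)^s] belongs to [L^(p/s)_w] (in the proof, the terms
are bounded from below on a ball, so that [H] is not null). As [w] is in
[A_(p/s)], the maximal operator [M] is bounded on this space
([muckenhoupt_maximal]), and the Rubio de Francia algorithm gives a majorant [v]
of [H] in the same space with [M v <= C v] ([A1_majorant]). Its root
[W = v^(1/s)] is in [A_1] and [RH_s] ([A1_root]), it is in [L^p_w], and it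
dominates [f_k / (4^k t_k)] for all [k] ([sequence_majorant]). The hypothesis for
this single weight bounds the integral of [|(I - A_(t_B)) T f_k|] over a ball
[B] by [c 4^k t_k] times that of [W]. As its constant depends on the weight, a
contradiction with one weight for all [k] is aimed at, rather than a direct
estimate of [T f] with a weight that varies with [f].

By the decay of the kernels, [A_(t_B) g] is bounded on [B] by a multiple of
the values of [M g] in [B] ([integral_op_le_hlmax]). So the bound of the
oscillations implies a good lambda inequality between [M (T f_k)] and
[M (4^k t_k W)] ([good_lambda]), and hence the inequality of Fefferman and Stein
between their norms in [L^p_w] ([fefferman_stein]). Since [M W <= C W], the norm
of [T f_k] is at most a constant times [4^k t_k], which is a contradiction for
large [k] ([dominated_bound], [weighted_bound]).

The good lambda inequality only holds at levels above which [M (T f_k)] is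
not everywhere, and it is summed from a lowest level. If [mu X] is infinite, the
lowest level tends to 0; the weight is first replaced by its minimum with a
multiple of an [A_1] weight in [L^2], so that the level sets have finite weight
with constants that are uniform in the multiple ([fs_infinite]). If [mu X] is
finite, the lowest level is a multiple of the mean of [|T f_k|], and an estimate
of this mean is needed ([fs_finite]). It comes from duality: the integral of
[|T f|] is the pairing of [f] with [Tstar psi], where [psi] is the sign of [T f],
and the same inequality for [Tstar], with the constant weight in the hypothesis
and the dual weight in the conclusion, bounds the functions [Tstar psi] with
[|psi| <= 1] ([integral_le_weighted]).

All comparisons of measures of sets are reduced to comparisons on balls by
one covering principle, [covering_le]. *)

(** * Balls of a metric measure space *)

Section Geometry.
Context {R : realType} {d : measure_display} {X : borelMetricType R d}.
Implicit Types (x y z : X) (r s : R).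

Lemma measurable_open (U : set X) : open U -> measurable U.
Proof. by move=> oU; rewrite measurable_borel; exact: sub_sigma_algebra. Qed.

Lemma mballE x r y : ball x r y = (mdist x y < r) :> Prop.
Proof. by rewrite ballEmdist. Qed.

Lemma ball_incl x y r s : mdist y x + r <= s -> ball x r `<=` ball y s.
Proof.
move=> h z; rewrite !mballE => xz; apply: le_lt_trans (metric_triangle _ x _) _.
by apply: lt_le_trans h; rewrite ltrD2l.
Qed.

Lemma ball_ctr x r : 0 < r -> ball x r x.
Proof. by move=> r0; rewrite mballE mdistxx. Qed.

Lemma open_mball x r : open (ball x r).
Proof.
rewrite openE => y; rewrite mballE => xy.
rewrite /interior -nbhs_ballE; exists (r - mdist x y); first by rewrite /= subr_gt0.
by apply: ball_incl; rewrite addrC subrK.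
Qed.

Lemma measurable_mball x r : measurable (ball x r).
Proof. exact/measurable_open/open_mball. Qed.

Lemma openP_ball (U : set X) x : open U -> U x -> exists2 r, 0 < r & ball x r `<=` U.
Proof.
rewrite openE => oU /oU; rewrite /interior -nbhs_ballE => -[r /= r0 h].
by exists r.
Qed.

End Geometry.
#[global] Hint Extern 0 (measurable (ball _ _)) => solve [apply: measurable_mball] : core.

(** * Coverings in doubling spaces *)

Section Doubling.
Context {R : realType} {d : measure_display} {X : borelMetricType R d}.
Variable mu : {measure set X -> \bar R}.
Hypothesis hmu : doubling mu.
Implicit Types (x y z : X) (r s : R).

Lemma doubling_gt0 x r : 0 < r -> (0 < mu (ball x r))%E.
Proof. by case: hmu => h _; exact: h. Qed.

Lemma doubling_lty x r : (mu (ball x r) < +oo)%E.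
Proof.
have [r0|r0] := ltP 0 r; last first.
  rewrite (_ : ball x r = set0) ?measure0 ?ltry// -subset0 => y.
  by rewrite mballE => /lt_le_trans/(_ r0); rewrite ltNge mdist_ge0.
case: hmu => _ [C C1 /(_ x r r0)/andP[h1 h2]].
apply: le_lt_trans h2; apply: le_trans (_ : (1%:E * mu (ball x r) <= _)%E); first by rewrite mul1e.
by apply: lee_wpmul2r => //; rewrite lee_fin.
Qed.

Lemma doubling_fin x r : mu (ball x r) \is a fin_num.
Proof. by rewrite ge0_fin_numE ?doubling_lty. Qed.

Lemma doubling_pow : exists2 C : R, 1 <= C & forall n x r, 0 < r ->
  (mu (ball x (2 ^+ n * r)) <= (C ^+ n)%:E * mu (ball x r))%E.
Proof.
case: hmu => _ [C C1 h]; exists C => // n x r r0.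
elim: n => [|n IH]; first by rewrite !expr0 mul1r mul1e.
have /andP[+ _] := h x (2 ^+ n * r) (mulr_gt0 (exprn_gt0 _ (ltr0Sn _ 1)) r0).
rewrite mulrA -exprS => /le_trans; apply.
rewrite exprS EFinM -muleA; apply: lee_wpmul2l => //.
by rewrite lee_fin (le_trans ler01).
Qed.

(** The ball on the left lies in a dyadic enlargement of the ball on the right, by
a factor which only depends on [K]. *)
Lemma doubling_engulf K : 0 < K -> exists2 C : R, 1 <= C & forall x y r,
  0 < r -> mdist x y <= K * r -> (mu (ball y (K * r)) <= C%:E * mu (ball x r))%E.
Proof.
move=> K0; have [C C1 h] := doubling_pow.
have [n hn] : exists n, 2 * K <= 2 ^+ n.
  exists (Num.trunc (2 * K)).+1.
  apply/ltW/(lt_le_trans (truncnS_gt (2*K))).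
  by rewrite -natrX ler_nat ltnW// ltn_expl.
exists (C ^+ n) => [|x y r r0 xy]; first exact: exprn_ege1.
apply: le_trans (h n x r r0); apply: le_measure; rewrite ?inE//.
apply: ball_incl; apply: le_trans (_ : 2 * K * r <= _); last by rewrite ler_pM2r.
lra.
Qed.

(** The balls of radius [e / 2] around the points of the set in a given ball are
disjoint and of comparable measure, so there are only finitely many. *)
Lemma separated_countable (A : set X) e : 0 < e ->
  (forall x y, A x -> A y -> x != y -> e <= mdist x y) -> countable A.
Proof.
move=> e0 sepA.
have [->|/set0P[x0 _]] := eqVneq A set0; first exact: countable0.
rewrite (_ : A = \bigcup_n (A `&` ball x0 n.+1%:R)); last first.
  apply/seteqP; split => [x Ax|x [n _ []//]].
  exists (Num.trunc (mdist x0 x)) => //; split => //.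
  by rewrite mballE truncnS_gt.
apply: bigcup_countable => // n _; apply: finite_set_countable.
pose N : R := n.+1%:R; pose S := N + e.
have N0 : 0 < N by rewrite ltr0n.
have [C C1 hC] := doubling_engulf (K := S / (e / 2) + N / (e/2)) (addr_gt0
  (divr_gt0 (addr_gt0 N0 e0) (divr_gt0 e0 (ltr0Sn _ 1))) (divr_gt0 N0 (divr_gt0 e0 (ltr0Sn _ 1)))).
have KE : (S / (e / 2) + N / (e / 2)) * (e / 2) = S + N.
  by rewrite mulrDl !divfK// ?gt_eqF// ?divr_gt0.
apply: contrapT => inf.
have big x : ball x0 N x -> (mu (ball x0 S) <= C%:E * mu (ball x (e/2)))%E.
  rewrite mballE metric_sym => xN.
  apply: le_trans (hC x x0 (e/2) _ _); last 2 first.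
  - by rewrite divr_gt0.
  - rewrite KE; apply: ltW (lt_le_trans xN _); rewrite /S; lra.
  apply: le_measure; rewrite ?inE//.
  by apply: le_ball; rewrite KE; lra.
have muS0 : (0 < mu (ball x0 S))%E by apply: doubling_gt0; exact: addr_gt0.
have [B BA cB] := infinite_set_fset (Num.trunc C).+1 inf.
have tB : trivIset [set` B] (fun x => ball x (e / 2)).
  apply/trivIsetP => x y /= xB yB xy; rewrite -subset0 => z [].
  rewrite !mballE => xz yz.
  have := sepA x y (BA x xB).1 (BA y yB).1 xy; rewrite leNgt => /negP; apply.
  apply: le_lt_trans (metric_triangle x z y) _; rewrite (metric_sym z) [e]splitr.
  exact: ltrD.
have : (#|` B|%:R%:E * mu (ball x0 S) <= C%:E * mu (ball x0 S))%E.
  apply: (@le_trans _ _ (C%:E * \sum_(x <- B) mu (ball x (e/2)))%E).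
    rewrite ge0_sume_distrr// mule_natl.
    have -> : (mu (ball x0 S) *+ #|` B| = \sum_(x <- B) mu (ball x0 S))%E.
      by rewrite big_const_seq count_predT; elim: #|` _| => [|k IH] //; rewrite muleS iterS IH.
    rewrite big_seq [leRHS]big_seq; apply: lee_sum => x xB; apply: big.
    by have [] := BA x xB.
  apply: lee_wpmul2l; first by rewrite lee_fin (le_trans ler01).
  rewrite -measure_fbigsetU//; apply: le_measure; rewrite ?inE//.
    exact: bigsetU_measurable.
  rewrite -bigcup_fset => y [x /= xB].
  have [_ xN] := BA x xB; apply: ball_incl.
  by move: xN; rewrite mballE /S => /ltW; lra.
rewrite lee_pmul2r ?doubling_fin// lee_fin leNgt => /negP; apply.
by apply: lt_le_trans (truncnS_gt C) _; rewrite ler_nat.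
Qed.

(** A maximal separated set, given by Zorn's lemma, is a net. *)
Lemma separated_net e : 0 < e -> exists2 A : set X, countable A &
  forall x, exists2 y, A y & mdist x y < e.
Proof.
move=> e0.
pose P := [set A : set X | forall x y, A x -> A y -> x != y -> e <= mdist x y].
have [A [PA maxA]] : exists A, P A /\ forall B, A `<` B -> ~ P B.
  apply: Zorn_bigcup => F FP totF x y [A FA Ax] [B FB By] xy.
  have [AB|BA] := totF A B FA FB.
  - by apply: (FP B FB) => //; exact: AB.
  - by apply: (FP A FA) => //; exact: BA.
exists A; first exact: separated_countable PA.
move=> x; apply: contrapT => nx.
have far y : A y -> e <= mdist x y.
  by move=> Ay; rewrite leNgt; apply/negP => xy; apply: nx; exists y.
apply: (maxA (A `|` [set x])).
  split; first exact: subsetUl.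
  move=> /(_ x (or_intror erefl)) Ax; have := far x Ax.
  by rewrite mdistxx leNgt e0.
move=> y z [Ay|->] [Az|->] yz; rewrite ?eqxx// in yz *.
- exact: PA.
- by rewrite metric_sym; exact: far.
- exact: far.
Qed.

Lemma doubling_separable : exists2 D : set X, countable D &
  forall x e, 0 < e -> exists2 y, D y & mdist x y < e.
Proof.
have net n : exists A : set X, countable A /\
    forall x, exists2 y, A y & mdist x y < n.+1%:R^-1.
  have n0 : 0 < n.+1%:R^-1 :> R by rewrite invr_gt0.
  by have [A cA hA] := separated_net n0; exists A.
have [A hA] := choice net.
exists (\bigcup_n A n); first by apply: bigcup_countable => // n _; exact: (hA n).1.
move=> x e e0; pose n := Num.trunc e^-1.
have [y Ay xy] := (hA n).2 x; exists y; first by exists n.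
apply: lt_trans xy _; rewrite invf_plt ?posrE//.
exact: truncnS_gt.
Qed.

(** The Lindelof property: every point lies in a member of a countable base inside
its ball, and one of these balls is kept for each member of the base. *)
Lemma countable_subcover (E : set X) (r : X -> R) : (forall x, E x -> 0 < r x) ->
  exists D : set X, [/\ countable D, D `<=` E &
    E `<=` \bigcup_(x in D) ball x (r x)].
Proof.
move=> r0; have [D0 cD0 hD0] := doubling_separable.
pose B (p : X * nat) := ball p.1 p.2.+1%:R^-1.
pose S := [set p | D0 p.1 /\ exists2 x, E x & B p `<=` ball x (r x)].
have [->|/set0P[xE ExE]] := eqVneq E set0.
  by exists set0; split => //; exact: countable0.
have chS (p : X * nat) : exists x, S p -> E x /\ B p `<=` ball x (r x).
  have [[_ [x Ex hx]]|nS] := pselect (S p); first by exists x.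
  by exists xE => /nS.
have [f hf] := choice chS.
exists (f @` S); split.
- apply: sub_countable (card_image_le _ _) _.
  apply: (@sub_countable _ _ _ (D0 `*` [set: nat])); last exact: countableX.
  by apply: subset_card_le => p [Sp _].
- by move=> _ [p Sp <-]; have [] := hf p Sp.
- move=> x Ex; pose n := Num.trunc (2 / r x).
  have nr : 2 / n.+1%:R < r x.
    by rewrite ltr_pdivrMr// mulrC -ltr_pdivrMr ?r0// truncnS_gt.
  have n0 : 0 < n.+1%:R^-1 :> R by rewrite invr_gt0.
  have [y Dy xy] := hD0 x _ n0.
  have Syn : S (y, n).
    split => //; exists x => //; apply: ball_incl.
    by move: nr xy => /=; set t := _^-1; lra.
  exists (f (y, n)); first by exists (y, n).
  by apply: (hf (y, n) Syn).2; rewrite /B mballE metric_sym.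
Qed.

(** The greedy selection behind the finite Vitali lemma: the largest ball
absorbs, after tripling, all balls that meet it, and the remaining ones are
disjoint from it. *)
Lemma finite_covering_le (nu1 nu2 : {measure set X -> \bar R}) (c : R)
    (r : X -> R) (F : set X) (s : seq X) : 0 <= c -> measurable F ->
  (forall x, x \in s -> 0 < r x /\
     (nu1 (ball x (3 * r x)) <= c%:E * nu2 (ball x (r x) `&` F))%E) ->
  (nu1 (\bigcup_(x in [set` s]) ball x (r x)) <=
   c%:E * nu2 ((\bigcup_(x in [set` s]) ball x (r x)) `&` F))%E.
Proof.
move=> c0 mF.
have [n] := ubnP (size s); elim: n s => // n IH s sn hs.
have mU (t : seq X) : measurable (\bigcup_(x in [set` t]) ball x (r x)).
  by apply/measurable_open/bigcup_open => x _; exact: open_mball.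
have [->|] := eqVneq s [::].
  by rewrite set_nil bigcup_set0 measure0 mule_ge0.
case: s sn hs => // y0 s0; set s := y0 :: s0 => sn hs _.
have [x xs maxx] : exists2 x, x \in s & forall y, y \in s -> r y <= r x.
  elim: (s0) y0 @s {sn hs} => [|y1 s1 IHs] y0 /=.
    by exists y0 => [|y]; rewrite inE// => /eqP->.
  have [x xs hx] := IHs y1.
  have [h|h] := leP (r y0) (r x).
    exists x => [|y]; first by rewrite inE xs orbT.
    by rewrite inE => /predU1P[->//|/hx].
  exists y0 => [|y]; first by rewrite inE eqxx.
  rewrite inE => /predU1P[->//|/hx yx]; exact: le_trans yx (ltW h).
pose t := [seq y <- s | `[< ball x (r x) `&` ball y (r y) = set0 >]].
have ts y : y \in t -> y \in s by rewrite mem_filter => /andP[].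
have /IH {}IH : (size t < n)%N.
  rewrite -ltnS; apply: leq_trans sn; rewrite ltnS size_filter.
  rewrite -(count_predC [eta xpredT] s).
  rewrite count_predT -[X in (_ < X + _)%N](count_predC (fun y => `[< ball x (r x) `&` ball y (r y) = set0 >])).
  rewrite -addnA -{1}[count _ s]addn0 ltn_add2l addn_gt0 -has_count; apply/orP; left.
  apply/hasP; exists x => //=; apply/asboolPn; rewrite setIid => h.
  by have := ball_ctr x (hs x xs).1; rewrite h.
have /IH {}IH : forall y, y \in t -> 0 < r y /\
    (nu1 (ball y (3 * r y)) <= c%:E * nu2 (ball y (r y) `&` F))%E.
  by move=> y /ts; exact: hs.
set Ut := \bigcup_(x in [set` t]) _ in IH.
set Us := \bigcup_(x in [set` s]) _.
have mUt : measurable Ut by exact: mU.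
have mUs : measurable Us by exact: mU.
have cov : Us `<=` ball x (3 * r x) `|` Ut.
  move=> z [y /= ys yz].
  have [disj|meet] := pselect (ball x (r x) `&` ball y (r y) = set0).
    by right; exists y => //=; rewrite mem_filter ys andbT; exact/asboolP.
  left; have /set0P[u []] : ball x (r x) `&` ball y (r y) != set0 by exact/eqP.
  move: yz (maxx y ys); rewrite !mballE => yz yx xu yu.
  have := metric_triangle x u z; have := metric_triangle u y z.
  rewrite (metric_sym u y); lra.
apply: (@le_trans _ _ (nu1 (ball x (3 * r x)) + nu1 Ut)%E).
  apply: le_trans (measureU2 nu1 _ _) => //.
  by apply: le_measure; rewrite ?inE//; exact: measurableU.
apply: le_trans (leeD (hs x xs).2 IH) _.
rewrite -ge0_muleDr//; apply: lee_wpmul2l; first by rewrite lee_fin.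
rewrite -measureU.
- apply: le_measure; rewrite ?inE//.
  + by apply: measurableU; exact: measurableI.
  + exact: measurableI.
  + move=> z [[xz Fz]|[[y /= yt yz] Fz]]; split => //; first by exists x.
    by exists y => //=; exact: ts.
- exact: measurableI.
- exact: measurableI.
- rewrite -subset0 => z [[xz _] [[y /=]]].
  rewrite mem_filter => /andP[/asboolP disj _] yz _.
  by have : set0 z; first by rewrite -disj.
Qed.

(** The covering principle: local comparison on balls, with a tripled ball on
the left, implies a global comparison. All covering arguments below (weak type
estimates, differentiation, A_infinity weights, good lambda inequality) are
instances of it. *)
Lemma covering_le (nu1 nu2 : {measure set X -> \bar R}) (c : R)
    (E F : set X) : 0 <= c -> measurable E -> measurable F ->
  (forall x, E x -> exists2 r, 0 < r &
     (nu1 (ball x (3 * r)) <= c%:E * nu2 (ball x r `&` F))%E) ->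
  (nu1 E <= c%:E * nu2 F)%E.
Proof.
move=> c0 mE mF h.
have chE x : exists r, E x -> 0 < r /\
    (nu1 (ball x (3 * r)) <= c%:E * nu2 (ball x r `&` F))%E.
  have [/h[r r0 hr]|nE] := pselect (E x); first by exists r.
  by exists 0 => /nE.
have [r hr] := choice chE.
have [D [cD DE covE]] := countable_subcover (fun x Ex => (hr x Ex).1).
move/pfcard_geP : cD => [D0|[f]].
  by move: covE; rewrite D0 bigcup_set0 subset0 => ->; rewrite measure0 mule_ge0.
have fD n : D (f n) by exact: funS.
pose U n := \bigcup_(x in [set` map f (iota 0 n)]) ball x (r x).
have mU n : measurable (U n).
  by apply/measurable_open/bigcup_open => x _; exact: open_mball.
have ndU : nondecreasing_seq U.
  move=> n1 n2 n12; apply/subsetPset => z [y /= /mapP[k]]; rewrite mem_iota /= add0n.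
  move=> kn -> kz; exists (f k); last exact: kz.
  by apply/mapP; exists k => //; rewrite mem_iota /= add0n (leq_trans kn).
have EU : E `<=` \bigcup_n U n.
  move=> x /covE[y Dy yx]; have [n _ fn] := 'surj_f Dy.
  exists n.+1 => //; exists y; last exact: yx.
  by apply/mapP; exists n; rewrite ?fn// mem_iota /= add0n.
apply: (@le_trans _ _ (nu1 (\bigcup_n U n))).
  by apply: le_measure; rewrite ?inE//; exact: bigcup_measurable.
have /cvg_lim <- // := @nondecreasing_cvg_mu _ _ _ nu1 _ mU (bigcup_measurable (fun k _ => mU k)) ndU.
apply: lime_le.
  by apply: ereal_nondecreasing_is_cvgn => n1 n2 n12; apply: le_measure; rewrite ?inE//; exact/subsetPset/ndU.
apply: nearW => n /=; apply: (@le_trans _ _ (c%:E * nu2 (U n `&` F))%E).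
  apply: finite_covering_le => // x /mapP[k _ ->]; exact/hr/DE/fD.
apply: lee_wpmul2l; first by rewrite lee_fin.
by apply: le_measure; rewrite ?inE//; exact: measurableI.
Qed.

End Doubling.

(** * Nonnegative integrals and measures with a density *)

Section MonotoneConvergence.
Local Open Scope ereal_scope.
Context d (T : measurableType d) (R : realType).
Variable nu : {measure set T -> \bar R}.

(** Monotone convergence as it is used below: a bound for an increasing
sequence passes to whatever its pointwise supremum dominates. *)
Lemma monotone_integral_le (D : set T) (f : T -> \bar R) (g : nat -> T -> \bar R)
    (A : \bar R) : measurable D -> measurable_fun D f ->
  (forall x, D x -> 0 <= f x) ->
  (forall n, measurable_fun D (g n)) -> (forall n x, D x -> 0 <= g n x) ->
  (forall x, D x -> nondecreasing_seq (g ^~ x)) ->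
  (forall x r, D x -> r%:E < f x -> exists n, r%:E < g n x) ->
  (forall n, \int[nu]_(x in D) g n x <= A) ->
  \int[nu]_(x in D) f x <= A.
Proof.
move=> mD mf f0 mg g0 ndg fg gA.
have cg x : D x -> cvgn (g ^~ x).
  by move=> Dx; apply: ereal_nondecreasing_is_cvgn; exact: ndg.
have := monotone_convergence nu mD mg g0 ndg => e.
apply: (@le_trans _ _ (\int[nu]_(x in D) limn (g^~ x))).
  apply: ge0_le_integral => //.
    apply: emeasurable_fun_cvg mg _ => x Dx; exact: cg.
  move=> x Dx; rewrite leNgt; apply/negP => lt.
  have l0 : 0 <= limn (g ^~ x) by apply: lime_ge (cg _ Dx) _; apply: nearW => n; exact: g0.
  have lfin : limn (g ^~ x) \is a fin_num.
    by rewrite ge0_fin_numE//; apply: lt_le_trans lt (leey _).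
  have [n] := fg x (fine (limn (g ^~ x))) Dx ltac:(by rewrite fineK).
  rewrite fineK// ltNge => /negP; apply.
  have /cvg_lim -> // := ereal_nondecreasing_cvgn (ndg x Dx).
  by apply: ereal_sup_ubound; exists n.
rewrite e; apply: lime_le; last exact: nearW.
by apply: ereal_nondecreasing_is_cvgn => m n mn; apply: ge0_le_integral => // [x Dx|x Dx]; [exact: g0|exact: ndg].
Qed.

End MonotoneConvergence.

Section NonnegativeIntegrals.
Local Open Scope ereal_scope.
Context d (T : measurableType d) (R : realType).
Variable nu : {measure set T -> \bar R}.

(** Monotonicity of nonnegative integrals holds for functions that are not
measurable, the integral being a supremum over simple functions. *)
Lemma ge0_integral_mono (D : set T) (f g : T -> \bar R) :
  (forall x, D x -> 0 <= f x) -> (forall x, D x -> f x <= g x) ->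
  \int[nu]_(x in D) f x <= \int[nu]_(x in D) g x.
Proof.
move=> f0 fg; have g0 x : D x -> 0 <= g x.
  by move=> Dx; exact: le_trans (f0 x Dx) (fg x Dx).
rewrite !ge0_integralE//; apply: ge_ereal_sup => _ [h /= hf <-].
apply: ereal_sup_ubound; exists h => // x; apply: le_trans (hf x) _.
rewrite !patchE; case: ifPn => //; rewrite inE; exact: fg.
Qed.

Lemma measurable_funT (f : T -> \bar R) (D : set T) :
  measurable_fun setT f -> measurable_fun D f.
Proof. exact: (@measurable_funS _ _ _ _ setT). Qed.

Lemma measurable_patch (f : T -> \bar R) (D : set T) : measurable D ->
  measurable_fun setT f -> measurable_fun setT (f \_ D).
Proof. by move=> mD mf; apply/(measurable_restrictT _ _).1 => //; exact: measurable_funT. Qed.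

Lemma patch_ge0 (f : T -> \bar R) (D : set T) x :
  (forall x, 0 <= f x) -> 0 <= (f \_ D) x.
Proof. by move=> f0; rewrite patchE; case: ifP. Qed.

End NonnegativeIntegrals.

Section Density.
Local Open Scope ereal_scope.
Context d (T : measurableType d) (R : realType).
Variables (mu : {measure set T -> \bar R}) (w : T -> \bar R).
Hypothesis mw : measurable_fun [set: T] w.
Hypothesis w0 : forall x, 0 <= w x.

Definition density of measurable_fun [set: T] w & (forall x, 0 <= w x) :=
  fun A : set T => \int[mu]_(x in A) w x.

Local Notation nu := (density mw w0).

Let density0 : nu set0 = 0. Proof. exact: integral_set0. Qed.

Let density_ge0 A : 0 <= nu A.
Proof. exact: integral_ge0. Qed.

Let density_sigma_additive : semi_sigma_additive nu.
Proof.
move=> F mF tF mUF; rewrite /density ge0_integral_bigcup//.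
- by apply: is_cvg_ereal_nneg_natsum => n _; exact: density_ge0.
- exact: (@measurable_funS _ _ _ _ setT).
Qed.

HB.instance Definition _ := isMeasure.Build d T R nu
  density0 density_ge0 density_sigma_additive.

Import HBNNSimple.

Lemma integral_density_nnsfun (h : {nnsfun T >-> R}) :
  \int[nu]_x (h x)%:E = \int[mu]_x ((h x)%:E * w x).
Proof.
rewrite integralT_nnsfun sintegralE.
pose a (r : R) x := r%:E * (w \_ (h @^-1` [set r])) x.
have mp r : measurable_fun setT (w \_ (h @^-1` [set r])) by exact: measurable_patch.
have a0 r x : 0 <= a r x.
  rewrite /a patchE; case: ifPn => [|_]; last by rewrite mule0.
  by rewrite inE => /= <-; rewrite mule_ge0// lee_fin.
transitivity (\sum_(r \in range h) \int[mu]_x a r x).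
  apply: eq_fsbigr => _ /[!inE] -[t _ <-].
  rewrite ge0_integralZl_EFin//; last by move=> x _; exact: patch_ge0.
  by rewrite -integral_mkcond.
rewrite -ge0_integral_fsum//; last first.
  by move=> r; apply: measurable_funeM.
apply: eq_integral => x _; rewrite (fsbigD1 (h x))//=; last by exists x.
rewrite fsbig1 ?addr0.
  by rewrite /a patchE mem_set.
by move=> r [_ /= rx]; rewrite /a patchE memNset ?mule0// => /= hx; exact: rx.
Qed.

(** Both integrals are suprema of their values on simple functions. *)
Lemma integral_density (E : set T) (f : T -> \bar R) : measurable E ->
    measurable_fun setT f -> (forall x, 0 <= f x) ->
    (forall x, w x \is a fin_num) ->
  \int[nu]_(x in E) f x = \int[mu]_(x in E) (f x * w x).
Proof.
move=> mE mf f0 wfin; rewrite [LHS]integral_mkcond [RHS]integral_mkcond.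
set g := f \_ E; have mg : measurable_fun setT g by exact: measurable_patch.
have g0 x : 0 <= g x by exact: patch_ge0.
have -> : (fun x => f x * w x) \_ E = (fun x => g x * w x).
  by apply/funext => x; rewrite /g !patchE; case: ifP => // _; rewrite mul0e.
pose h := nnsfun_approx measurableT mg.
have cvh x : (h n x)%:E @[n --> \oo] --> g x by exact: cvg_nnsfun_approx.
have ndh x : nondecreasing_seq (fun n => (h n x)%:E).
  by move=> n1 n2 n12; rewrite lee_fin; exact/lefP/nd_nnsfun_approx.
have lim_lt (u : nat -> \bar R) l r : nondecreasing_seq u -> u @ \oo --> l ->
    r < l -> exists n, r < u n.
  move=> ndu /(cvg_unique _ (ereal_nondecreasing_cvgn ndu)) <-; last exact: ereal_hausdorff.
  by move=> /ereal_sup_gt[_ [n _ <-] lt]; exists n.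
have hg n x : (h n x)%:E <= g x.
  rewrite -(cvg_unique _ (ereal_nondecreasing_cvgn (ndh x)) (cvh x)); last exact: ereal_hausdorff.
  by apply: ereal_sup_ubound; exists n.
have mh n : measurable_fun setT (fun x => (h n x)%:E) by exact/measurable_EFinP.
have h0 n x : 0 <= (h n x)%:E by rewrite lee_fin.
apply/eqP; rewrite eq_le; apply/andP; split.
- apply: (@monotone_integral_le _ _ _ _ _ _ (fun n x => (h n x)%:E)) => //.
  + by move=> x r _; exact: lim_lt.
  + move=> n; rewrite integral_density_nnsfun; apply: ge0_integral_mono => x _.
      by rewrite mule_ge0.
    exact: lee_wpmul2r.
- apply: (@monotone_integral_le _ _ _ _ _ _ (fun n x => (h n x)%:E * w x)) => //.
  + exact: emeasurable_funM.
  + by move=> x _; rewrite mule_ge0.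
  + by move=> n; exact: emeasurable_funM.
  + by move=> n x _; rewrite mule_ge0.
  + by move=> x _ n1 n2 n12; apply: lee_wpmul2r => //; exact: ndh.
  + move=> x r _; apply: lim_lt; last by apply: cvgeZr.
    by move=> n1 n2 n12; apply: lee_wpmul2r => //; exact: ndh.
  + move=> n; rewrite -integral_density_nnsfun; exact: ge0_integral_mono.
Qed.

End Density.

(** * Integrals of powers from geometric sequences of levels *)

Lemma le_poweR (R : realType) (p : R) (x y : \bar R) : (0 <= p)%R ->
  (0 <= x -> x <= y -> x `^ p <= y `^ p)%E.
Proof.
move=> p0 x0 xy; apply: gt0_ler_poweR => //; rewrite in_itv/= leey andbT//.
exact: le_trans xy.
Qed.

Section Layers.
Local Open Scope ereal_scope.
Context (R : realType) (del K p : R).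
Hypotheses (del0 : (0 < del)%R) (K1 : (1 < K)%R) (p0 : (0 < p)%R).

Definition level n : R := (del * K ^+ n)%R.

Lemma level_gt0 n : (0 < level n)%R.
Proof. by rewrite mulr_gt0// exprn_gt0// (lt_trans ltr01). Qed.

Lemma levelS n : level n.+1 = (K * level n)%R.
Proof. by rewrite /level exprS mulrCA. Qed.

Lemma le_level m n : (m <= n)%N -> (level m <= level n)%R.
Proof. by move=> mn; rewrite ler_pM2l// ler_weXn2l// ltW. Qed.

Lemma level_unbounded r : exists n, (r < level n)%R.
Proof.
have K'0 : (0 < K - 1)%R by rewrite subr_gt0.
exists (Num.trunc (r / del / (K - 1))).+1; set n := _.+1.
have h : (r < del * (n%:R * (K - 1)))%R.
  by rewrite mulrC -ltr_pdivrMr// -ltr_pdivrMr// truncnS_gt.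
apply: lt_le_trans h _; rewrite ler_pM2l//.
elim: (n) => [|k IH]; first by rewrite mul0r exprn_ge0// ltW// (lt_trans ltr01).
rewrite exprS -[in leLHS]natr1 mulrDl mul1r.
have : (1 <= K ^+ k)%R by rewrite exprn_ege1// ltW.
move: IH K1; set a := (_ ^+ k)%R; nra.
Qed.

Lemma powK_gt1 : (1 < K `^ p)%R.
Proof.
have : (1 `^ p < K `^ p)%R.
  by apply: gt0_ltr_powR => //; rewrite nnegrE// ltW// (lt_trans ltr01).
by rewrite powR1.
Qed.

Lemma level_powS n : (level n.+1 `^ p = K `^ p * level n `^ p)%R.
Proof. by rewrite levelS powRM// ?ltW// ?level_gt0// (lt_trans ltr01). Qed.

Local Notation layer H k := ((level k `^ p)%:E * ((level k)%:E < H)%E%:R%:E).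

Lemma sum_level N : (\sum_(k < N) level k `^ p <= (K `^ p - 1)^-1 * level N `^ p)%R.
Proof.
have k0 : (0 < K `^ p - 1)%R by rewrite subr_gt0 powK_gt1.
elim: N => [|N IH]; first by rewrite big_ord0 mulr_ge0 ?powR_ge0// invr_ge0 ltW.
rewrite big_ord_recr /= level_powS; apply: le_trans (lerD IH (lexx _)) _.
by rewrite mulrC [leRHS]mulrC ler_pdivlMr// mulrDl divfK ?gt_eqF//; lra.
Qed.

Lemma layer_upper (H : \bar R) N : 0 <= H ->
  \sum_(k < N) layer H k <= (1 + (K `^ p - 1)^-1)%:E * H `^ p.
Proof.
move=> H0; have k0 : (0 < K `^ p - 1)%R by rewrite subr_gt0 powK_gt1.
elim: N => [|N IH].
  by rewrite big_ord0 mule_ge0 ?poweR_ge0// lee_fin addr_ge0// invr_ge0 ltW.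
rewrite big_ord_recr /=; have [h|h] := ltP (level N)%:E H; last by rewrite mule0 adde0.
apply: (@le_trans _ _ ((1 + (K `^ p - 1)^-1) * level N `^ p)%:E); last first.
  rewrite EFinM; apply: lee_wpmul2l; first by rewrite lee_fin addr_ge0// invr_ge0 ltW.
  by rewrite -poweR_EFin; apply: le_poweR; rewrite ?lee_fin ltW// level_gt0.
rewrite mulrDl mul1r EFinD mule1 addeC; apply: leeD => //.
apply: (@le_trans _ _ (\sum_(k < N) level k `^ p)%:E); last by rewrite lee_fin sum_level.
rewrite -sumEFin; apply: lee_sum => k _.
by case: (_ < _)%E; rewrite ?mule1 ?mule0// lee_fin powR_ge0.
Qed.

Lemma layer_lower (G : \bar R) N : del%:E < G ->
  (mine G (level N.+1)%:E) `^ p <= (K `^ p)%:E * \sum_(k < N.+1) layer G k.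
Proof.
move=> dG; have lay0 k : 0 <= layer G k.
  by rewrite mule_ge0// lee_fin ?powR_ge0.
have top k : (level k)%:E < G ->
    (mine G (level k.+1)%:E) `^ p <= (K `^ p)%:E * layer G k.
  move=> h; rewrite h mule1 -EFinM -level_powS -poweR_EFin.
  apply: le_poweR; first exact: ltW.
    by rewrite le_min lee_fin (ltW (level_gt0 _)) andbT (le_trans _ (ltW h))// lee_fin ltW// level_gt0.
  by rewrite ge_min lexx orbT.
elim: N => [|N IH].
  by rewrite big_ord_recr big_ord0 /= add0e; apply: top; rewrite /level expr0 mulr1.
rewrite big_ord_recr /= ge0_muleDr//; last by apply: sume_ge0 => k _; exact: lay0.
have [h|h] := ltP (level N.+1)%:E G.
  apply: le_trans (top _ h) _; rewrite h; apply: leeDr.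
  by rewrite mule_ge0// ?lee_fin ?powR_ge0// sume_ge0// => k _; exact: lay0.
rewrite mule0 mule0 adde0; apply: le_trans IH; rewrite !min_l//.
by apply: le_trans h _; rewrite lee_fin le_level.
Qed.

End Layers.

Section IntegralLayers.
Local Open Scope ereal_scope.
Context d (T : measurableType d) (R : realType).
Variable nu : {measure set T -> \bar R}.
Variables (K p : R).
Hypotheses (K1 : (1 < K)%R) (p0 : (0 < p)%R).

Lemma measurable_gt (G : T -> \bar R) (y : \bar R) : measurable_fun setT G ->
  measurable [set x | y < G x].
Proof. by move=> mG; rewrite -[X in measurable X]setTI; exact: emeasurable_fun_o_infty. Qed.

Lemma integral_layer (G : T -> \bar R) (a b : R) : (0 <= a)%R ->
    measurable_fun setT G ->
  \int[nu]_x (a%:E * (b%:E < G x)%E%:R%:E) = a%:E * nu [set x | b%:E < G x].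
Proof.
move=> a0 mG; have mA := measurable_gt b%:E mG.
under eq_integral => x _.
  rewrite (_ : (b%:E < G x)%E%:R%:E = (\1_[set x : T | (b%:E < G x)%E] x)%:E); last first.
    by rewrite indicE mem_setE.
  over.
rewrite ge0_integralZl_EFin//.
- by rewrite integral_indic// setIT.
- by apply/measurable_EFinP; exact: measurable_indic.
Qed.

Lemma measurable_layer (G : T -> \bar R) (a b : R) : measurable_fun setT G ->
  measurable_fun setT (fun x => a%:E * (b%:E < G x)%E%:R%:E).
Proof.
move=> mG; have mA := measurable_gt b%:E mG.
apply: measurable_funeM; rewrite (_ : (fun _ => _) = EFin \o \1_[set x : T | (b%:E < G x)%E]).
  by apply/measurable_EFinP; exact: measurable_indic.
by apply/funext => x; rewrite /= indicE mem_setE.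
Qed.

(** Chebyshev's inequality at all the levels at once, as the powers of the levels
below a given value have a geometric sum. *)
Lemma sum_layers_le (G : T -> \bar R) del N : (0 < del)%R ->
  measurable_fun setT G -> (forall x, 0 <= G x) ->
  \sum_(k < N) (level del K k `^ p)%:E * nu [set x | (level del K k)%:E < G x]
  <= (1 + (K `^ p - 1)^-1)%:E * \int[nu]_x (G x `^ p).
Proof.
move=> del0 mG G0.
under eq_bigr do rewrite -integral_layer ?powR_ge0//.
rewrite -ge0_integral_sum//; last 2 first.
- by move=> k; exact: measurable_layer.
- by move=> k x _; rewrite mule_ge0// lee_fin powR_ge0.
have k0 : (0 < K `^ p - 1)%R by rewrite subr_gt0 powK_gt1.
have mGp : measurable_fun setT (fun x => G x `^ p).
  exact: (measurableT_comp (measurable_poweR _) mG).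
rewrite -ge0_integralZl_EFin//; last 2 first.
- by move=> x _; exact: poweR_ge0.
- by rewrite addr_ge0// invr_ge0 ltW.
apply: ge0_le_integral => //.
- by move=> x _; apply: sume_ge0 => k _; rewrite mule_ge0// lee_fin powR_ge0.
- by apply: emeasurable_sum => k; exact: measurable_layer.
- exact: measurable_funeM.
- by move=> x _; exact: layer_upper.
Qed.

(** The converse of [sum_layers_le]: a value above the lowest level is at most [K]
times the last level below it. *)
Lemma integral_le_layers (G : T -> \bar R) del A : (0 < del)%R ->
  measurable_fun setT G -> (forall x, 0 <= G x) ->
  (forall N, \sum_(k < N) (level del K k `^ p)%:E *
     nu [set x | (level del K k)%:E < G x] <= A) ->
  \int[nu]_(x in [set x | del%:E < G x]) (G x `^ p) <= (K `^ p)%:E * A.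
Proof.
move=> del0 mG G0 hA; have mD := measurable_gt del%:E mG.
have K0 : (0 < K)%R by exact: lt_trans ltr01 K1.
pose g N x := (mine (G x) (level del K N.+1)%:E) `^ p.
have mg N : measurable_fun setT (g N).
  by apply: (measurableT_comp (measurable_poweR _)); exact: measurable_mine.
have l0 k : (0 <= level del K k)%R by rewrite ltW// level_gt0.
apply: (@monotone_integral_le _ _ _ _ _ _ g) => //.
- apply: (@measurable_funS _ _ _ _ setT) => //.
  exact: (measurableT_comp (measurable_poweR _) mG).
- by move=> x _; exact: poweR_ge0.
- by move=> n; apply: (@measurable_funS _ _ _ _ setT).
- by move=> n x _; exact: poweR_ge0.
- move=> x _ m n mn; apply: le_poweR; first exact: ltW.
    by rewrite le_min G0 lee_fin l0.
  by rewrite le_min !ge_min lexx/= lee_fin le_level// orbT.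
- move=> x r _; rewrite /g; case: (G x) (G0 x) => [y y0|_|//].
    move=> ry; have [n yn] := level_unbounded del0 K1 y; exists n.
    rewrite min_l// lee_fin (le_trans (ltW yn))//; exact: le_level.
  move=> _; pose r1 := Num.max 1%R r.
  have [n yn] := level_unbounded del0 K1 (r1 `^ p^-1)%R; exists n.
  rewrite min_r ?leey// poweR_EFin lte_fin.
  have r11 : (1 <= r1)%R by rewrite le_max lexx.
  apply: (@le_lt_trans _ _ r1); first by rewrite le_max lexx orbT.
  rewrite -[ltLHS]powRr1 ?(le_trans ler01)// -(mulVf (lt0r_neq0 p0)) powRrM.
  apply: gt0_ltr_powR; rewrite ?nnegrE ?powR_ge0//.
  exact: lt_le_trans yn (le_level _ _ _).
move=> N; apply: (@le_trans _ _ ((K `^ p)%:E * \sum_(k < N.+1)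
    (level del K k `^ p)%:E * nu [set x | (level del K k)%:E < G x])); last first.
  by apply: lee_wpmul2l; rewrite ?lee_fin ?powR_ge0.
under eq_bigr do rewrite -integral_layer ?powR_ge0//.
rewrite -ge0_integral_sum//; last 2 first.
- by move=> k; exact: measurable_layer.
- by move=> k x _; rewrite mule_ge0// lee_fin powR_ge0.
rewrite -ge0_integralZl_EFin ?powR_ge0//; last 2 first.
- by move=> x _; apply: sume_ge0 => k _; rewrite mule_ge0// lee_fin powR_ge0.
- by apply: emeasurable_sum => k; exact: measurable_layer.
apply: (@le_trans _ _ (\int[nu]_(x in [set x | del%:E < G x]) ((K `^ p)%:E *
    \sum_(k < N.+1) ((level del K k `^ p)%:E * ((level del K k)%:E < G x)%E%:R%:E)))); last first.
  apply: ge0_subset_integral => //.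
    by apply: measurable_funeM; apply: emeasurable_sum => k; exact: measurable_layer.
  by move=> x _; rewrite mule_ge0 ?lee_fin ?powR_ge0// sume_ge0// => k _; rewrite mule_ge0// lee_fin powR_ge0.
apply: ge0_le_integral => //.
- by move=> x _; exact: poweR_ge0.
- by apply: (@measurable_funS _ _ _ _ setT).
- apply: (@measurable_funS _ _ _ _ setT) => //.
  by apply: measurable_funeM; apply: emeasurable_sum => k; exact: measurable_layer.
- by move=> x dG; exact: layer_lower.
Qed.

(** Letting the lowest level tend to 0. *)
Lemma integral_le_cutoff (G : T -> \bar R) (A : \bar R) :
  measurable_fun setT G -> (forall x, 0 <= G x) ->
  (forall del, (0 < del)%R ->
     \int[nu]_(x in [set x | del%:E < G x]) (G x `^ p) <= A) ->
  \int[nu]_x (G x `^ p) <= A.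
Proof.
move=> mG G0 hA; pose D n := [set x | n.+1%:R^-1%:E < G x].
have mD n : measurable (D n) by exact: measurable_gt.
have mGp E : measurable_fun E (fun x => G x `^ p).
  apply: (@measurable_funS _ _ _ _ setT) => //.
  exact: (measurableT_comp (measurable_poweR _) mG).
apply: (@monotone_integral_le _ _ _ _ _ _ (fun n => (fun x => G x `^ p) \_ (D n))) => //.
- by move=> x _; exact: poweR_ge0.
- by move=> n; apply/(measurable_restrictT _ _).1.
- by move=> n x _; rewrite patchE; case: ifP => // _; exact: poweR_ge0.
- move=> x _ m n mn; rewrite !patchE; case: ifPn => [|_].
    rewrite inE /D /= => h; rewrite mem_set//=; apply: le_lt_trans h.
    by rewrite lee_fin lef_pV2 ?posrE// ler_nat.
  by case: ifP => // _; exact: poweR_ge0.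
- move=> x r _ rG; have [Gx0|Gx0] := eqVneq (G x) 0.
    exists 0%N; rewrite patchE; case: ifPn => // _.
    by move: rG; rewrite Gx0 poweR0r// gt_eqF.
  have {}Gx0 : 0 < G x by rewrite lt_neqAle eq_sym Gx0 G0.
  suff [n hn] : exists n, D n x by exists n; rewrite patchE mem_set.
  rewrite /D /=; case: (G x) Gx0 => [y|_|//].
    rewrite lte_fin => y0; exists (Num.trunc y^-1).
    by rewrite lte_fin invf_plt ?posrE// truncnS_gt.
  by exists 0%N; rewrite ltry.
- move=> n; rewrite -integral_mkcond; apply: hA; by rewrite invr_gt0.
Qed.

End IntegralLayers.

(** * The maximal function *)

Lemma mule_poweRB1 (R : realType) (x : \bar R) (p : R) : (0 <= x)%E -> 1 < p ->
  (x * x `^ (p - 1) = x `^ p)%E.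
Proof.
move=> x0 p1; have p0 : 0 < p by exact: lt_trans p1.
case: x x0 => [x x0|_|//]; first by rewrite !poweR_EFin -EFinM mulr_powRB1.
by rewrite !poweRyr ?mulyy ?gt_eqF// subr_gt0.
Qed.

Section MaximalFunction.
Local Open Scope ereal_scope.
Context {R : realType} {d : measure_display} {X : borelMetricType R d}.
Variable nu : {measure set X -> \bar R}.
Implicit Types (h : X -> \bar R) (x z : X) (r : R).

Definition mean z r h : \bar R :=
  ((fine (nu (ball z r)))^-1)%:E * \int[nu]_(y in ball z r) h y.

(** The uncentred Hardy-Littlewood maximal function, for open balls; it is
lower semicontinuous for every [h]. *)
Definition hlmax h x : \bar R :=
  ereal_sup [set e | exists z r, [/\ (0 < r)%R, ball z r x & e = mean z r h]].

Lemma mean_le_hlmax h z r x : (0 < r)%R -> ball z r x -> mean z r h <= hlmax h x.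
Proof. by move=> r0 zx; apply: ereal_sup_ubound; exists z, r. Qed.

Lemma hlmax_le h x c : (forall z r, (0 < r)%R -> ball z r x -> mean z r h <= c) ->
  hlmax h x <= c.
Proof. by move=> hc; apply: ge_ereal_sup => _ [z [r [r0 zx ->]]]; exact: hc. Qed.

Lemma hlmax_gt h x c : c < hlmax h x ->
  exists z r, [/\ (0 < r)%R, ball z r x & c < mean z r h].
Proof. by move=> /ereal_sup_gt[_ [z [r [r0 zx ->]]] hc]; exists z, r. Qed.

Lemma open_hlmax h c : open [set x | c < hlmax h x].
Proof.
rewrite openE => x /= /hlmax_gt[z [r [r0 zx hc]]].
have [e e0 he] := openP_ball (@open_mball _ _ _ z r) zx.
rewrite /interior -nbhs_ballE; exists e => //= y /he zy.
exact: lt_le_trans hc (mean_le_hlmax _ r0 zy).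
Qed.

Lemma measurable_hlmax h : measurable_fun setT (hlmax h).
Proof.
apply: (measurability _ (ErealGenOInfty.measurableE R)).
move=> _ [_ [c ->] <-]; rewrite setTI; apply: measurable_open.
rewrite (_ : _ @^-1` _ = [set x | c%:E < hlmax h x]); first exact: open_hlmax.
by apply/seteqP; split => x /=; rewrite in_itv/= andbT.
Qed.

Lemma mean_ge0 h z r : (forall x, 0 <= h x) -> 0 <= mean z r h.
Proof. by move=> h0; rewrite mule_ge0 ?integral_ge0// lee_fin invr_ge0 fine_ge0. Qed.

Lemma hlmax_ge0 h x : (forall x, 0 <= h x) -> 0 <= hlmax h x.
Proof.
move=> h0; apply: le_trans (mean_ge0 x 1 h0) (mean_le_hlmax _ ltr01 _).
exact: ball_ctr.
Qed.

Lemma le_hlmax h1 h2 x : (forall x, 0 <= h1 x) -> (forall x, h1 x <= h2 x) ->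
  hlmax h1 x <= hlmax h2 x.
Proof.
move=> h10 h12; apply: hlmax_le => z r r0 zx.
apply: le_trans (mean_le_hlmax _ r0 zx); apply: lee_wpmul2l.
  by rewrite lee_fin invr_ge0 fine_ge0.
exact: ge0_integral_mono.
Qed.

Lemma hlmaxD h1 h2 x : measurable_fun setT h1 -> measurable_fun setT h2 ->
  (forall x, 0 <= h1 x) -> (forall x, 0 <= h2 x) ->
  hlmax (h1 \+ h2) x <= hlmax h1 x + hlmax h2 x.
Proof.
move=> m1 m2 h10 h20; apply: hlmax_le => z r r0 zx.
apply: le_trans (leeD (mean_le_hlmax _ r0 zx) (mean_le_hlmax _ r0 zx)).
rewrite /mean ge0_integralD//; last 2 first.
- exact: measurable_funT.
- exact: measurable_funT.
by rewrite ge0_muleDr// integral_ge0.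
Qed.

Lemma hlmaxZ h x (c : R) : (0 <= c)%R -> measurable_fun setT h ->
  (forall x, 0 <= h x) -> hlmax (fun y => c%:E * h y) x <= c%:E * hlmax h x.
Proof.
move=> c0 mh h0; apply: hlmax_le => z r r0 zx.
rewrite /mean ge0_integralZl_EFin//; last exact: measurable_funT.
by rewrite muleCA; apply: lee_wpmul2l => //; exact: mean_le_hlmax.
Qed.

Lemma hlmax_series (h : nat -> X -> \bar R) x :
  (forall k, measurable_fun setT (h k)) -> (forall k x, 0 <= h k x) ->
  hlmax (fun y => \sum_(k <oo) h k y) x <= \sum_(k <oo) hlmax (h k) x.
Proof.
move=> mh h0; apply: hlmax_le => z r r0 zx.
rewrite /mean integral_nneseries//; last by move=> k; exact: measurable_funT.
rewrite -nneseriesZl//; last by move=> *; apply: integral_ge0 => y _; exact: h0.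
by apply: lee_nneseries => k _ *; [exact: mean_ge0|exact: mean_le_hlmax].
Qed.

Hypothesis hnu : doubling nu.

Lemma mean_cst z r (c : R) : (0 < r)%R -> (0 <= c)%R -> mean z r (cst c%:E) = c%:E.
Proof.
move=> r0 c0; rewrite /mean integral_cst// muleCA.
rewrite -[X in _ * (_ * X)](fineK (doubling_fin hnu z r)) -EFinM mulVf ?mulr1//.
by rewrite gt_eqF// fine_gt0// doubling_gt0// doubling_lty.
Qed.

Lemma hlmax_cst_le x (c : R) : (0 <= c)%R -> hlmax (cst c%:E) x <= c%:E.
Proof. by move=> c0; apply: hlmax_le => z r r0 _; rewrite mean_cst. Qed.

Lemma fine_ball_gt0 z r : (0 < r)%R -> (0 < fine (nu (ball z r)))%R.
Proof. by move=> r0; rewrite fine_gt0// doubling_gt0// doubling_lty. Qed.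

Lemma avg_mean x r h : (0 < r)%R -> avg nu x r h = mean x r h.
Proof.
move=> r0; rewrite /avg /mean; congr (_ * _).
rewrite -[X in X^-1](fineK (doubling_fin hnu x r)) inver gt_eqF//.
exact: fine_ball_gt0.
Qed.

Lemma mean_lt z r h (c : \bar R) : (0 < r)%R ->
  (c < mean z r h) = (nu (ball z r) * c < \int[nu]_(y in ball z r) h y).
Proof.
move=> r0; rewrite /mean lte_pdivlMl ?fine_ball_gt0//.
by rewrite fineK// doubling_fin.
Qed.

Lemma mean_le z r h (c : \bar R) : (0 < r)%R ->
  (mean z r h <= c) = (\int[nu]_(y in ball z r) h y <= nu (ball z r) * c).
Proof.
move=> r0; rewrite /mean lee_pdivrMl ?fine_ball_gt0//.
by rewrite fineK// doubling_fin.
Qed.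

Lemma integral_ball_le h z r x : (0 < r)%R -> ball z r x ->
  \int[nu]_(y in ball z r) h y <= nu (ball z r) * hlmax h x.
Proof. by move=> r0 zx; rewrite -mean_le//; exact: mean_le_hlmax. Qed.

(** The weak type (1,1) inequality, by the covering principle. *)
Lemma weak_type : exists2 C : R, (1 <= C)%R & forall h (lam : R),
  measurable_fun setT h -> (forall x, 0 <= h x) -> (0 < lam)%R ->
  lam%:E * nu [set x | lam%:E < hlmax h x] <= C%:E * \int[nu]_x h x.
Proof.
have [C C1 hC] := doubling_engulf hnu (ltr0Sn R 5).
exists C => // h lam mh h0 lam0.
have C0 : (0 < C)%R by exact: lt_le_trans C1.
rewrite -lee_pdivlMl// muleA -EFinM -[X in _ <= _ * X]/(density nu mh h0 setT).
apply: (covering_le hnu) => //.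
- by rewrite mulr_ge0 ?invr_ge0 ?ltW.
- by apply: measurable_open; exact: open_hlmax.
move=> x /= /hlmax_gt[z [r [r0 zx]]]; rewrite mean_lt// => hlt.
exists (2 * r)%R; first by rewrite mulr_gt0.
rewrite (_ : 3 * (2 * r) = 6 * r)%R; last by ring.
rewrite EFinM -muleA lee_pdivlMl//.
have xz6 : (mdist z x <= 6 * r)%R by move: zx; rewrite mballE; lra.
apply: le_trans (lee_wpmul2l _ (hC z x r r0 xz6)) _; first by rewrite lee_fin ltW.
rewrite muleCA; apply: lee_wpmul2l; first by rewrite lee_fin ltW.
rewrite muleC; apply: le_trans (ltW hlt) _; rewrite setIT.
apply: ge0_subset_integral => //; first exact: measurable_funT.
by apply: ball_incl; move: zx; rewrite mballE metric_sym; lra.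
Qed.

(** Marcinkiewicz interpolation between the weak type (1,1) bound and the
trivial bound at infinity, carried out on the dyadic levels. *)
Lemma strong_type (p : R) : (1 < p)%R -> exists2 C : R, (0 < C)%R & forall h,
  measurable_fun setT h -> (forall x, 0 <= h x) ->
  \int[nu]_x (hlmax h x `^ p) <= C%:E * \int[nu]_x (h x `^ p).
Proof.
move=> p1; have [C C1 hC] := weak_type.
have p0 : (0 < p)%R by exact: lt_trans p1.
have q0 : (0 < p - 1)%R by rewrite subr_gt0.
have K1 : (1 < 2 :> R)%R by rewrite ltr1n.
have C0 : (0 < C)%R by exact: lt_le_trans C1.
pose c : R := (1 + (2 `^ (p - 1) - 1)^-1)%R.
have c0 : (0 < c)%R.
  by rewrite addr_gt0// invr_gt0 subr_gt0 powK_gt1.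
pose D := (2 * C * 2 `^ (p - 1) * c)%R.
have D0 : (0 < D)%R by rewrite !mulr_gt0 ?powR_gt0.
exists (2 `^ p * D)%R; first by rewrite mulr_gt0 ?powR_gt0.
move=> h mh h0; have mM := measurable_hlmax h.
have mhp r : measurable_fun setT (fun x => h x `^ r).
  exact: (measurableT_comp (measurable_poweR _) mh).
apply: (@integral_le_cutoff _ _ _ _ p) => // [x|del del0]; first exact: hlmax_ge0.
rewrite EFinM -muleA; apply: integral_le_layers => // [x|N]; first exact: hlmax_ge0.
set l := level del 2; pose l2 := level (del / 2) 2.
have del20 : (0 < del / 2)%R by rewrite divr_gt0.
have ll2 k : l k = (2 * l2 k)%R by rewrite /l /l2 /level; field.
have l20 k : (0 < l2 k)%R by exact: level_gt0.
have l0 k : (0 < l k)%R by exact: level_gt0.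
pose H k := h \_ [set x | (l2 k)%:E < h x].
have mA k : measurable [set x | (l2 k)%:E < h x] by exact: measurable_gt.
have mH k : measurable_fun setT (H k) by exact: measurable_patch.
have H0 k x : 0 <= H k x by exact: patch_ge0.
(* The values of [h] below half a level raise its maximal function to at most
half that level, so only the values above are subject to the weak type bound. *)
have step k : nu [set x | (l k)%:E < hlmax h x] <=
    (C / l2 k)%:E * \int[nu]_x H k x.
  apply: (@le_trans _ _ (nu [set x | (l2 k)%:E < hlmax (H k) x])).
    apply: le_measure; rewrite ?inE; [exact/measurable_open/open_hlmax..|].
    move=> x /= lx; rewrite ltNge; apply/negP => Hx; move: lx; apply/negP; rewrite -leNgt.
    apply: (@le_trans _ _ (hlmax (H k) x + hlmax (cst (l2 k)%:E) x)).
      apply: le_trans (hlmaxD _ _ _ _ _) => //; last by move=> y; rewrite lee_fin ltW.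
      apply: le_hlmax => // y; rewrite /= /H patchE; case: ifPn => [_|].
        by rewrite leeDl// lee_fin ltW.
      by rewrite notin_setE /= => /negP; rewrite -leNgt add0e.
    apply: le_trans (leeD Hx (hlmax_cst_le _ (ltW (l20 k)))) _.
    by rewrite -EFinD lee_fin ll2; lra.
  have -> : (C / l2 k)%:E = (l2 k)^-1%:E * C%:E by rewrite -EFinM mulrC.
  by rewrite -muleA lee_pdivlMl//; exact: hC.
apply: (@le_trans _ _ (\sum_(k < N) (2 * C * 2 `^ (p - 1))%:E *
    \int[nu]_x (h x * ((l2 k `^ (p - 1))%:E * ((l2 k)%:E < h x)%E%:R%:E)))).
  apply: lee_sum => k _.
  apply: le_trans (lee_wpmul2l _ (step k)) _; first by rewrite lee_fin powR_ge0.
  rewrite muleA -EFinM.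
  have -> : (l k `^ p * (C / l2 k) = 2 * C * 2 `^ (p - 1) * l2 k `^ (p - 1))%R.
    rewrite ll2 powRM ?ltW// -!(@mulr_powRB1 _ _ p) ?ltW//.
    by field; rewrite gt_eqF.
  rewrite [in leLHS]EFinM -muleA; apply: lee_wpmul2l.
    by rewrite lee_fin !mulr_ge0 ?powR_ge0 ?ltW.
  rewrite -ge0_integralZl_EFin ?powR_ge0//.
  apply: ge0_integral_mono => x _; first by rewrite mule_ge0 ?lee_fin ?powR_ge0.
  rewrite /H patchE; case: ifPn; rewrite ?inE ?notin_setE /=.
    by move=> ->; rewrite mule1 muleC.
  by move=> _; rewrite mule0 mule_ge0// mule_ge0// lee_fin ?powR_ge0.
have mterm (k : 'I_N) : measurable_fun setT (fun x =>
    h x * ((l2 k `^ (p - 1))%:E * ((l2 k)%:E < h x)%E%:R%:E)).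
  by apply: emeasurable_funM => //; exact: measurable_layer.
have term0 (k : 'I_N) x : 0 <= h x * ((l2 k `^ (p - 1))%:E * ((l2 k)%:E < h x)%E%:R%:E).
  by rewrite mule_ge0// mule_ge0// lee_fin powR_ge0.
have DD : (0 <= 2 * C * 2 `^ (p - 1))%R by rewrite !mulr_ge0 ?powR_ge0// ltW.
rewrite -ge0_sume_distrr; last by move=> k _; exact: integral_ge0.
rewrite /D [in leRHS]EFinM -muleA; apply: lee_wpmul2l; first by rewrite lee_fin.
rewrite -ge0_integral_sum// -ge0_integralZl_EFin ?(ltW c0)//; last first.
  by move=> x _; exact: poweR_ge0.
apply: ge0_integral_mono => x _; first exact: sume_ge0.
rewrite -ge0_sume_distrr; last by move=> k _; rewrite mule_ge0// lee_fin powR_ge0.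
rewrite -mule_poweRB1// muleCA; apply: lee_wpmul2l => //.
exact: layer_upper.
Qed.

End MaximalFunction.

(** * The A_infinity condition *)

Section Whitney.
Context {R : realType} {d : measure_display} {X : borelMetricType R d}.

(** The radius is the largest dyadic multiple of an initial one for which the ball
stays inside the set. *)
Lemma whitney_radius (U : set X) y : open U -> U y -> U != setT ->
  exists r, [/\ 0 < r, ball y r `<=` U & exists2 z, ~ U z & mdist y z < 2 * r].
Proof.
move=> oU Uy UT; have [r0 r00 hr0] := openP_ball oU Uy.
have [z nUz] : exists z, ~ U z.
  by apply/existsNP => h; move/eqP: UT; apply; apply/seteqP; split.
have exn : exists n, `[< ~ (ball y (2 ^+ n * r0) `<=` U) >].
  have [n hn] := level_unbounded r00 (ltr1n R 2) (mdist y z).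
  exists n; apply/asboolP => h; apply/nUz/h; rewrite mballE.
  by rewrite mulrC.
have [n /asboolP hn minn] := ex_minnP exn.
case: n hn minn => [|n] hn minn; first by case: hn; rewrite expr0 mul1r.
have r20 : 0 < 2 ^+ n * r0 by rewrite mulr_gt0// exprn_gt0.
exists (2 ^+ n * r0); split => //.
  by apply: contrapT => h; have := minn n (introT (asboolP _) h); rewrite ltnn.
move: hn => /existsNP[u /not_implyP[yu nu]]; exists u => //.
by move: yu; rewrite mballE mulrA -exprS.
Qed.

End Whitney.

Section AInfinity.
Local Open Scope ereal_scope.
Context {R : realType} {d : measure_display} {X : borelMetricType R d}.
Variable mu : {measure set X -> \bar R}.
Hypothesis hmu : doubling mu.

(** The A_infinity condition, in the form that is easy to check and stable under
minima: a proportion [theta] of a ball has at least the proportion [c theta] of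
its weight. The function [c] is a parameter because all constants below must
be uniform over families of measures. *)
Definition ainfty (c : R -> R) (nu : {measure set X -> \bar R}) : Prop :=
  [/\ forall theta, (0 < theta)%R -> (0 < c theta)%R,
      forall x r, nu (ball x r) < +oo &
      forall theta x r E, (0 < theta)%R -> (0 < r)%R -> measurable E ->
        E `<=` ball x r -> theta%:E * mu (ball x r) <= mu E ->
        (c theta)%:E * nu (ball x r) <= nu E].

Lemma ainfty_engulf (c : R -> R) (K : R) : (0 < K)%R ->
    (forall theta, (0 < theta)%R -> (0 < c theta)%R) ->
  exists2 C : R, (1 <= C)%R & forall nu, ainfty c nu -> forall x y r, (0 < r)%R ->
    (mdist x y <= K * r)%R -> nu (ball y (K * r)) <= C%:E * nu (ball x r).
Proof.
move=> K0 c0; have [C C1 hC] := doubling_engulf hmu (addr_gt0 K0 ltr01).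
have C0 : (0 < C)%R by exact: lt_le_trans C1.
have cC : (0 < c C^-1)%R by rewrite c0// invr_gt0.
exists (Num.max 1 (c C^-1)^-1)%R; first by rewrite le_max lexx.
move=> nu [_ _ h] x y r r0 xy.
have xy' : (mdist x y <= (K + 1) * r)%R by rewrite mulrDl mul1r; lra.
apply: (@le_trans _ _ ((c C^-1)^-1%:E * nu (ball x r))); last first.
  by apply: lee_wpmul2r => //; rewrite lee_fin le_max lexx orbT.
rewrite lee_pdivlMl//; apply: (@le_trans _ _ ((c C^-1)%:E * nu (ball y ((K + 1) * r)))).
  apply: lee_wpmul2l; first by rewrite lee_fin ltW.
  by apply: le_measure; rewrite ?inE//; apply: le_ball; rewrite ler_wpM2r ?ltW//; lra.
apply: h => //; first by rewrite invr_gt0.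
- by rewrite mulr_gt0// addr_gt0.
- by apply: ball_incl; rewrite metric_sym mulrDl mul1r lerD2r.
- by rewrite lee_pdivrMl//; exact: hC.
Qed.

Lemma fin_measure_sub (nu : {measure set X -> \bar R}) (E F : set X) :
  measurable E -> measurable F -> E `<=` F -> nu F < +oo -> nu E \is a fin_num.
Proof.
move=> mE mF EF Fy; rewrite ge0_fin_numE//.
by apply: le_lt_trans Fy; apply: le_measure; rewrite ?inE.
Qed.

Lemma integral_indic_ball (E : set X) x r : measurable E ->
  \int[mu]_(y in ball x r) (\1_E y)%:E = mu (E `&` ball x r).
Proof. by move=> mE; rewrite integral_indic. Qed.

(** A small open set [E] is enlarged to the set where the maximal function of
its indicator is not small. A Whitney ball of the enlargement is half outside
of [E], so [E] carries at most a fixed proportion of the weight. *)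
Lemma ainfty_enlarge (c : R -> R) :
    (forall theta, (0 < theta)%R -> (0 < c theta)%R) ->
  exists kap A1 : R, [/\ (0 <= kap)%R, (kap < 1)%R, (1 <= A1)%R &
    forall del, (0 < del)%R -> exists2 eps, (0 < eps)%R &
    forall nu, ainfty c nu -> forall x r R0 E, (0 < r)%R -> (r <= R0)%R ->
      (R0 <= 2 * r)%R -> open E -> E `<=` ball x R0 ->
      mu E <= eps%:E * mu (ball x r) ->
      exists E', [/\ open E', E' `<=` ball x (R0 + del * r),
        mu E' <= A1%:E * mu E & nu E <= kap%:E * nu E']].
Proof.
move=> c0.
have [C2 C21 hC2] := doubling_engulf hmu (ltr0Sn R 1).
have [Cw Cw1 hCw] := weak_type hmu.
have [C3 C31 hC3] := ainfty_engulf (ltr0Sn R 2) c0.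
have half0 : (0 < 2^-1 :> R)%R by rewrite invr_gt0.
have ch0 := c0 _ half0.
have C20 : (0 < C2)%R by exact: lt_le_trans C21.
have Cw0 : (0 < Cw)%R by exact: lt_le_trans Cw1.
pose A := (C3 / c 2^-1 + 1)%R.
have C3c : (0 < C3 / c 2^-1)%R by rewrite divr_gt0// (lt_le_trans ltr01).
have A1 : (1 < A)%R by rewrite /A; lra.
have A0 : (0 < A)%R by exact: lt_trans A1.
(* With this threshold, at most half of a Whitney ball of the enlargement is in
[E], as its double contains a point outside of the enlargement. *)
pose t := ((2 * C2)^-1)%R.
have t0 : (0 < t)%R by rewrite invr_gt0 mulr_gt0.
have t1 : (t < 1)%R by rewrite invf_lt1 ?mulr_gt0//; lra.
exists (1 - A^-1)%R, (2 * C2 * Cw)%R; split.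
- by rewrite subr_ge0 invf_le1// ltW.
- by rewrite ltrBlDr ltrDl invr_gt0.
- by rewrite -[leLHS]mulr1 ler_pM//; lra.
move=> del del0.
have K0 : (0 < 1 + 4 / del)%R by rewrite addr_gt0// divr_gt0.
have [Cd Cd1 hCd] := doubling_engulf hmu K0.
have Cd0 : (0 < Cd)%R by exact: lt_le_trans Cd1.
pose D := (2 * C2 * Cw * Cd)%R.
have D0 : (0 < D)%R by rewrite !mulr_gt0.
exists ((2 * D)^-1)%R; first by rewrite invr_gt0 mulr_gt0.
move=> nu hnu x r R0 E r0 rR R2 oE ER muE.
have mE := measurable_open oE.
pose f := EFin \o (\1_E : X -> R).
have mf : measurable_fun setT f by apply/measurable_EFinP; exact: measurable_indic.
have f0 y : 0 <= f y by rewrite lee_fin.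
pose E' := [set y | t%:E < hlmax mu f y].
have oE' : open E' by exact: open_hlmax.
have mE' := measurable_open oE'.
have EE' : E `<=` E'.
  move=> y /(openP_ball oE)[e e0 he]; apply: lt_le_trans (mean_le_hlmax _ _ e0 (ball_ctr _ e0)).
  rewrite mean_lt// integral_indic_ball// setIidr// -[ltRHS]mule1.
  by rewrite lte_pmul2l ?doubling_fin ?doubling_gt0 ?lte_fin.
have muE' : mu E' <= (2 * C2 * Cw)%:E * mu E.
  have := hCw f t mf f0 t0; rewrite integral_indic// setIT.
  by rewrite -lee_pdivlMl// muleA -EFinM /t invrK.
have B0 := doubling_gt0 hmu x r0.
have Bfin := doubling_fin hmu x r.
have small (C : R) : (0 < C)%R -> (C <= D)%R -> ~ (mu (ball x r) <= C%:E * mu E).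
  move=> C0 CD h; have : mu (ball x r) <= C%:E * ((2 * D)^-1%:E * mu (ball x r)).
    by apply: le_trans h _; apply: lee_wpmul2l => //; rewrite lee_fin ltW.
  rewrite muleA -EFinM -[leLHS]mul1e lee_pmul2r// lee_fin leNgt => /negP; apply.
  by rewrite -/(_ / _)%R ltr_pdivrMr ?mulr_gt0//; lra.
have E'ball : E' `<=` ball x (R0 + del * r).
  move=> y /hlmax_gt[z [r' [r'0 zy]]]; rewrite mean_lt// integral_indic_ball// => h.
  have [e [Ee ze]] : E `&` ball z r' !=set0.
    apply/set0P/eqP => h0; move: h; rewrite h0 measure0 ltNge => /negP; apply.
    by rewrite mule_ge0// lee_fin ltW.
  have xe := ER _ Ee.
  have [rr'|rr'] := ltP (2 * r')%R (del * r)%R.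
    move: xe ze zy; rewrite !mballE => xe ze zy.
    have := metric_triangle x e y; have := metric_triangle e z y.
    by rewrite (metric_sym e z); lra.
  exfalso; apply: (small (Cd * (2 * C2))%R); first by rewrite !mulr_gt0.
    have : (C2 * Cd * 1 <= C2 * Cd * Cw)%R by rewrite ler_pM2l// mulr_gt0.
    by rewrite /D; lra.
  have r2 : (r <= 2 / del * r')%R.
    by rewrite mulrAC ler_pdivlMr// mulrC.
  have zx : (mdist z x <= (1 + 4 / del) * r')%R.
    move: xe ze; rewrite !mballE => xe ze.
    have := metric_triangle z e x; rewrite (metric_sym e x) => h1.
    have : (4 / del * r' = 2 * (2 / del * r'))%R by ring.
    rewrite mulrDl mul1r; lra.
  apply: (@le_trans _ _ (mu (ball x ((1 + 4 / del) * r')))).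
    apply: le_measure; rewrite ?inE//; apply: le_ball.
    have e4 : (4 / del * r' = 2 * (2 / del * r'))%R by ring.
    have h1 : (0 <= 2 / del * r')%R by exact: le_trans (ltW r0) r2.
    by rewrite mulrDl mul1r e4; lra.
  apply: le_trans (hCd z x r' r'0 zx) _; rewrite EFinM -muleA.
  apply: lee_wpmul2l; first by rewrite lee_fin ltW.
  rewrite -lee_pdivrMl ?mulr_gt0// muleC; apply: le_trans (ltW h) _.
  by apply: le_measure; rewrite ?inE//; exact: measurableI.
have E'T : E' != setT.
  apply/eqP => E'T; apply: (small (2 * C2 * Cw)%R); first by rewrite !mulr_gt0.
    by rewrite /D ler_peMr// !mulr_ge0// ltW.
  by apply: le_trans muE'; apply: le_measure; rewrite ?inE// E'T.
exists E'; split => //.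
have [_ nuy hc] := hnu.
have mD : measurable (E' `\` E) by exact: measurableD.
have cov : nu E' <= A%:E * nu (E' `\` E).
  apply: (covering_le hmu) => //; first exact: ltW.
  move=> y /(fun h => whitney_radius oE' h E'T)[rho [rho0 sub [z nz yz]]].
  exists rho => //; apply: le_trans (hC3 nu hnu y y rho rho0 _) _.
    by rewrite mdistxx mulr_ge0// ltW.
  have Ez : mu (E `&` ball y rho) <= 2^-1%:E * mu (ball y rho).
    have : hlmax mu f z <= t%:E by rewrite leNgt; apply/negP.
    have yz' : ball y (2 * rho) z by rewrite mballE.
    have rho20 : (0 < 2 * rho)%R by rewrite mulr_gt0.
    move=> /(le_trans (mean_le_hlmax _ _ rho20 yz')); rewrite mean_le//.
    rewrite integral_indic_ball// => h.
    apply: (@le_trans _ _ (mu (E `&` ball y (2 * rho)))).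
      apply: le_measure; rewrite ?inE//; [exact: measurableI|exact: measurableI|].
      by apply: setIS; apply: le_ball; lra.
    apply: le_trans h _; rewrite muleC.
    have yy : (mdist y y <= 2 * rho)%R by rewrite mdistxx ltW.
    apply: le_trans (lee_wpmul2l _ (hC2 y y rho rho0 yy)) _; first by rewrite lee_fin ltW.
    rewrite muleA -EFinM /t invfM -mulrA mulVf ?mulr1// gt_eqF//.
  have half : 2^-1%:E * mu (ball y rho) <= mu (ball y rho `\` E).
    have mI : measurable (E `&` ball y rho) by exact: measurableI.
    have mDD : measurable (ball y rho `\` E) by exact: measurableD.
    have e : mu (ball y rho) = mu (E `&` ball y rho) + mu (ball y rho `\` E).
      by rewrite setIC -measureU// ?setUIDK//; [exact: measurableI|rewrite -subset0 => u [[_ Eu] [_ nE]]; exact: nE].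
    have bfin := doubling_fin hmu y rho.
    have Ifin : mu (E `&` ball y rho) \is a fin_num.
      by apply: (fin_measure_sub _ _ _ (doubling_lty hmu y rho)) => //; exact: subIsetr.
    move: e Ez; rewrite -(fineK bfin) -(fineK Ifin).
    case: (mu (ball y rho `\` E)) => [b| |//]; last by rewrite leey.
    by rewrite -EFinD -!EFinM !lee_fin => -[->]; lra.
  have := hc _ _ _ _ half0 rho0 (measurableD (measurable_mball y rho) mE) (@subDsetl _ _ _) half.
  rewrite setIDA setIidl//.
  rewrite -lee_pdivlMl// => hh.
  apply: (@le_trans _ _ (C3%:E * ((c 2^-1)^-1%:E * nu (ball y rho `\` E)))).
    by apply: lee_wpmul2l => //; rewrite lee_fin (le_trans ler01).
  rewrite muleA -EFinM; apply: lee_wpmul2r => //; rewrite lee_fin /A; lra.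
have E'fin : nu E' \is a fin_num by exact: fin_measure_sub (nuy x (R0 + del * r)%R).
have Efin : nu E \is a fin_num.
  by apply: (fin_measure_sub mE mE' EE'); rewrite -ge0_fin_numE.
have Dfin : nu (E' `\` E) \is a fin_num.
  by apply: (fin_measure_sub mD mE' (@subDsetl _ _ _)); rewrite -ge0_fin_numE.
have e : nu E' = nu E + nu (E' `\` E).
  by rewrite -measureU ?setDUK// setDIK.
move: e cov; rewrite -(fineK E'fin) -(fineK Efin) -(fineK Dfin) -EFinD -!EFinM !lee_fin.
move=> -[->]; set a := fine _; set b := fine _ => h.
have : ((a + b) / A <= b)%R by rewrite ler_pdivrMr// mulrC.
rewrite mulrBl mul1r [(A^-1 * _)%R]mulrC; lra.
Qed.

End AInfinity.

Section AInfinitySmall.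
Local Open Scope ereal_scope.
Context {R : realType} {d : measure_display} {X : borelMetricType R d}.
Variable mu : {measure set X -> \bar R}.
Hypothesis hmu : doubling mu.

(** Iterating the enlargement makes the proportion of the weight arbitrarily
small; the balls are enlarged by a factor at most 2 altogether. *)
Lemma ainfty_small (c : R -> R) (eta : R) : (0 < eta)%R ->
    (forall theta, (0 < theta)%R -> (0 < c theta)%R) ->
  exists2 eps, (0 < eps)%R & forall nu, ainfty mu c nu -> forall x r E,
    (0 < r)%R -> open E -> E `<=` ball x r -> mu E <= eps%:E * mu (ball x r) ->
    nu E <= eta%:E * nu (ball x (2 * r)).
Proof.
move=> eta0 c0; have [kap [A1 [kap0 kap1 A11 step]]] := ainfty_enlarge hmu c0.
have iter k del : (0 < del)%R -> exists2 eps, (0 < eps)%R &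
    forall nu, ainfty mu c nu -> forall x r R0 E, (0 < r)%R -> (r <= R0)%R ->
      (R0 + k%:R * del * r <= 2 * r)%R -> open E -> E `<=` ball x R0 ->
      mu E <= eps%:E * mu (ball x r) ->
      nu E <= (kap ^+ k)%:E * nu (ball x (2 * r)).
  move=> del0; elim: k => [|k [eps1 eps10 IH]].
    exists 1%R => // nu _ x r R0 E r0 rR; rewrite !mul0r addr0 expr0 mul1e => R2 oE ER _.
    rewrite ?mul1e; apply: le_measure; rewrite ?inE//; first exact: measurable_open.
    by apply: subset_trans ER _; exact: le_ball.
  have [eps2 eps20 hstep] := step del del0.
  have A10 : (0 < A1)%R by exact: lt_le_trans A11.
  exists (Num.min eps2 (eps1 / A1))%R; first by rewrite lt_min eps20 divr_gt0.
  move=> nu hnu x r R0 E r0 rR R2 oE ER muE.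
  have kd : (0 <= k%:R * del * r)%R by rewrite !mulr_ge0// ltW.
  have dr : (0 < del * r)%R by rewrite mulr_gt0.
  have e1 : (k.+1%:R * del * r = k%:R * del * r + del * r)%R by rewrite -natr1; ring.
  have [E' [oE' E'R muE' nuE]] : exists E', [/\ open E', E' `<=` ball x (R0 + del * r),
        mu E' <= A1%:E * mu E & nu E <= kap%:E * nu E'].
    apply: hstep => //; first lra.
    by apply: le_trans muE _; apply: lee_wpmul2r => //; rewrite lee_fin ge_min lexx.
  apply: le_trans nuE _; rewrite exprS EFinM -muleA; apply: lee_wpmul2l => //.
  apply: (IH nu hnu x r (R0 + del * r)%R) => //; [lra|lra|].
  apply: le_trans muE' _; rewrite -lee_pdivlMl//; apply: le_trans muE _.
  rewrite muleA -EFinM mulrC; apply: lee_wpmul2r => //.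
  by rewrite lee_fin ge_min lexx orbT.
have [k hk] : exists k, (kap ^+ k <= eta)%R.
  have knorm : (`|kap| < 1)%R by rewrite ger0_norm.
  have /cvgrPdist_lt/(_ eta eta0)[k _ /(_ k (leqnn k))] := cvg_expr knorm.
  rewrite /= sub0r normrN ger0_norm ?exprn_ge0// => /ltW h; by exists k.
have d0 : (0 < k.+1%:R^-1 :> R)%R by rewrite invr_gt0.
have [eps eps0 h] := iter k _ d0; exists eps => // nu hnu x r E r0 oE ER muE.
apply: le_trans (h nu hnu x r r E r0 (lexx _) _ oE ER muE) _.
  rewrite [leRHS]mulr_natl mulr2n lerD2l ler_piMl ?ltW// ltr_pdivrMr// mul1r ltr_nat//.
by apply: lee_wpmul2r => //; rewrite lee_fin.
Qed.

End AInfinitySmall.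

(** * The Fefferman-Stein inequality *)

Section GoodLambda.
Local Open Scope ereal_scope.
Context {R : realType} {d : measure_display} {X : borelMetricType R d}.
Variable mu : {measure set X -> \bar R}.
Hypothesis hmu : doubling mu.

(** On each ball, the part of [g] above a multiple of its maximal function at
some point of the ball is controlled by [V]. For [g = |f|] this follows from a
bound of the oscillations [f - A_t f] by [V], since [A_t f] is controlled by
the maximal function. *)
Definition sharp_dominated (C0 : R) (g V : X -> \bar R) : Prop :=
  forall x r z (c : R), (0 < r)%R -> ball x r z -> hlmax mu g z <= c%:E ->
    \int[mu]_(y in ball x r) (maxe 0 (g y - (C0 * c)%:E)) <= \int[mu]_(y in ball x r) V y.

(** Around a point of [U], where the maximal function of [g] exceeds [lam], there
is a Whitney ball, and a nearby point at which it does not. If the maximal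
function of [V] is small somewhere near the ball, [sharp_dominated] and the weak
type inequality show that the set where that of [g] exceeds [K * lam] has a
small proportion of the measure of the ball, and so of its weight. *)
Lemma good_lambda (c : R -> R) (C0 : R) : (1 <= C0)%R ->
    (forall theta, (0 < theta)%R -> (0 < c theta)%R) ->
  exists2 K, (1 < K)%R & forall eta, (0 < eta)%R -> exists2 gam, (0 < gam)%R &
  forall nu, ainfty mu c nu -> forall g V : X -> \bar R,
    measurable_fun setT g -> (forall x, 0 <= g x) -> (forall x, 0 <= V x) ->
    sharp_dominated C0 g V -> forall lam, (0 < lam)%R ->
    [set x | lam%:E < hlmax mu g x] != setT ->
    nu [set x | (K * lam)%:E < hlmax mu g x] <=
      eta%:E * nu [set x | lam%:E < hlmax mu g x] +
      nu [set x | (gam * lam)%:E < hlmax mu V x].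
Proof.
move=> C01 c0.
have [C6 C61 hC6] := doubling_engulf hmu (ltr0Sn R 5).
have [Cw Cw1 hCw] := weak_type hmu.
have [C10 C101 hC10] := ainfty_engulf hmu (ltr0Sn R 9) c0.
have C100 : (0 < C10)%R by exact: lt_le_trans C101.
have Cw0 : (0 < Cw)%R by exact: lt_le_trans Cw1.
have C60 : (0 < C6)%R by exact: lt_le_trans C61.
pose K := (C0 + C6)%R; exists K; first by rewrite /K; lra.
move=> eta eta0.
have eta1 : (0 < eta / C10)%R by rewrite divr_gt0.
have [eps eps0 small] := ainfty_small hmu eta1 c0.
exists (eps / Cw)%R; first by rewrite divr_gt0.
move=> nu hnu g V mg g0 V0 sharp lam lam0.
set U := [set x | lam%:E < hlmax mu g x] => UT.
pose G := [set x | (K * lam)%:E < hlmax mu g x].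
pose W := [set x | (eps / Cw * lam)%:E < hlmax mu V x].
have oU : open U by exact: open_hlmax.
have mU := measurable_open oU.
have mG : measurable G by apply/measurable_open/open_hlmax.
have mW : measurable W by apply/measurable_open/open_hlmax.
pose F := G `\` W; have mF : measurable F by exact: measurableD.
have FU : F `<=` U.
  move=> x [+ _]; apply: le_lt_trans; rewrite lee_fin ler_peMl// ?ltW// /K; lra.
suff nuF : nu F <= eta%:E * nu U.
  apply: (@le_trans _ _ (nu F + nu W)); last exact: leeD2r.
  apply: le_trans (measureU2 nu mF mW); apply: le_measure; rewrite ?inE//.
    exact: measurableU.
  by move=> x Gx; have [Wx|Wx] := pselect (W x); [right|left].
have -> : nu F = mrestr nu mF U by rewrite /mrestr setIC setIidl.
have {2}-> : U = U `&` setT by rewrite setIT.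
apply: (covering_le hmu) => //; [exact: ltW|by rewrite setIT|].
move=> x /(fun h => whitney_radius oU h UT)[r [r0 xU [z nUz xz]]].
have rK k : (0 < k.+1%:R * r)%R by rewrite mulr_gt0.
exists r => //; rewrite setIA setIT setIidl//.
change (nu (ball x (3 * r) `&` F) <= eta%:E * nu (ball x r)).
have [h0|/set0P[y0 [xy0 [Gy0 nWy0]]]] := eqVneq (ball x (3 * r) `&` F) set0.
  by rewrite h0 measure0 mule_ge0// lee_fin ltW.
have Mz : hlmax mu g z <= lam%:E by rewrite leNgt; apply/negP.
have MV : hlmax mu V y0 <= (eps / Cw * lam)%:E by rewrite leNgt; apply/negP.
have xy05 : ball x (5 * r) y0 by apply: le_ball xy0; rewrite ler_pM2r//; lra.
have xz5 : ball x (5 * r) z by rewrite mballE; lra.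
pose u := (fun y => maxe 0 (g y - (C0 * lam)%:E)) \_ (ball x (5 * r)).
have mu0 : measurable_fun setT u.
  apply: measurable_patch => //; apply: measurable_maxe => //.
  exact: emeasurable_funB.
have u0 y : 0 <= u y by rewrite /u patchE; case: ifP => // _; rewrite le_max lexx.
pose O := [set y | lam%:E < hlmax mu u y].
have oO : open O by exact: open_hlmax.
have mO := measurable_open oO.
have muO : mu O <= eps%:E * mu (ball x (5 * r)).
  rewrite -(@lee_pmul2l _ lam%:E)//.
  apply: le_trans (hCw u lam mu0 u0 lam0) _.
  rewrite -integral_mkcond.
  apply: (@le_trans _ _ (Cw%:E * (mu (ball x (5 * r)) * (eps / Cw * lam)%:E))).
    apply: lee_wpmul2l; first by rewrite lee_fin ltW.
    have hs := sharp x _ z lam (rK 4%N) xz5 Mz.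
    apply: le_trans hs _.
    apply: le_trans (integral_ball_le hmu V (rK 4%N) xy05) _.
    exact: lee_wpmul2l.
  rewrite -(fineK (doubling_fin hmu _ _)) -!EFinM lee_fin.
  by rewrite le_eqVlt; apply/orP; left; apply/eqP; field; rewrite gt_eqF.
(* A ball through [y] on which the mean of [g] is large has a radius less than
[r], since its enlargement would contain [z] otherwise; so it lies in
[ball x (5 * r)], where [g] is at most [u + C0 * lam]. *)
have FO : ball x (3 * r) `&` F `<=` O `&` ball x (3 * r).
  move=> y [xy [Gy _]]; split => //.
  have [z1 [rho [rho0 zy]]] := hlmax_gt Gy; rewrite mean_lt// => hlt.
  have [rrho|rrho] := leP r rho.
    exfalso; move: hlt; apply/negP; rewrite -leNgt.
    have rho60 : (0 < 6 * rho)%R by rewrite mulr_gt0.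
    have z1z : ball z1 (6 * rho) z.
      rewrite mballE; move: xy zy; rewrite !mballE => xy zy.
      have := metric_triangle z1 y z; have := metric_triangle y x z.
      by rewrite (metric_sym y x); lra.
    apply: (@le_trans _ _ (\int[mu]_(y in ball z1 (6 * rho)) g y)).
      apply: ge0_subset_integral => //; first exact: measurable_funT.
      by apply: le_ball; lra.
    apply: le_trans (integral_ball_le hmu g rho60 z1z) _.
    apply: (@le_trans _ _ (mu (ball z1 (6 * rho)) * lam%:E)); first exact: lee_wpmul2l.
    have z1z1 : (mdist z1 z1 <= 6 * rho)%R by rewrite mdistxx ltW.
    apply: le_trans (lee_wpmul2r _ (hC6 z1 z1 rho rho0 z1z1)) _; first by rewrite lee_fin ltW.
    rewrite muleAC muleC; apply: lee_wpmul2l => //.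
    by rewrite -EFinM lee_fin ler_wpM2r// ?ltW// /K; lra.
  have z1B : ball z1 rho `<=` ball x (5 * r).
    apply: ball_incl; move: xy zy; rewrite !mballE => xy zy.
    have := metric_triangle x y z1; rewrite (metric_sym y z1); lra.
  apply: lt_le_trans (mean_le_hlmax _ _ rho0 zy); rewrite mean_lt//.
  have mfin := doubling_fin hmu z1 rho.
  have gle : \int[mu]_(y in ball z1 rho) g y <=
      \int[mu]_(y in ball z1 rho) u y + mu (ball z1 rho) * (C0 * lam)%:E.
    rewrite muleC -integral_cst// -ge0_integralD//; last 2 first.
    - exact: measurable_funT.
    - by move=> t _; rewrite lee_fin mulr_ge0// ltW// (lt_le_trans ltr01).
    apply: ge0_integral_mono => // t z1t.
    rewrite /u patchE mem_set; last exact: z1B.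
    apply: (@le_trans _ _ ((g t - (C0 * lam)%:E) + (C0 * lam)%:E)); first by rewrite subeK.
    by apply: leeD2r; rewrite le_max lexx orbT.
  have := lt_le_trans hlt gle; rewrite -(fineK mfin).
  case: (\int[mu]_(y in ball z1 rho) u y) => [b| |]; rewrite ?ltry//.
  - rewrite -!EFinM -EFinD !lte_fin /K => h.
    have : (0 <= fine (mu (ball z1 rho)) * ((C6 - 1) * lam))%R.
      by rewrite !mulr_ge0 ?fine_ge0// ?subr_ge0// ltW.
    lra.
have O3 : O `&` ball x (3 * r) `<=` ball x (5 * r).
  by apply: subset_trans (@subIsetr _ _ _) _; apply: le_ball; rewrite ler_pM2r//; lra.
have oO3 : open (O `&` ball x (3 * r)) by apply: openI => //; exact: open_mball.
apply: (@le_trans _ _ (nu (O `&` ball x (3 * r)))).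
  apply: le_measure; rewrite ?inE//; [exact: measurableI|exact: measurableI].
apply: (@le_trans _ _ ((eta / C10)%:E * nu (ball x (2 * (5 * r))))).
  apply: small => //.
  apply: le_trans muO; apply: le_measure; rewrite ?inE//; exact: measurableI.
rewrite (_ : 2 * (5 * r) = 10 * r)%R; last by ring.
have xx : (mdist x x <= 10 * r)%R by rewrite mdistxx mulr_ge0// ltW.
apply: le_trans (lee_wpmul2l _ (hC10 nu hnu x x r r0 xx)) _; first by rewrite lee_fin ltW.
by rewrite muleA -EFinM divfK// gt_eqF.
Qed.

(** The weighted Fefferman-Stein inequality above the level [del]. The bound
for the sum over the levels is proved by induction on the number of levels; in
this way, no quantity that may be infinite is subtracted. *)
Theorem fefferman_stein (c : R -> R) (C0 p : R) : (1 <= C0)%R -> (0 < p)%R ->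
    (forall theta, (0 < theta)%R -> (0 < c theta)%R) ->
  exists2 C, (0 < C)%R & forall nu, ainfty mu c nu -> forall g V : X -> \bar R,
    measurable_fun setT g -> (forall x, 0 <= g x) -> (forall x, 0 <= V x) ->
    sharp_dominated C0 g V -> forall del, (0 < del)%R ->
    (forall lam, (del <= lam)%R -> [set x | lam%:E < hlmax mu g x] != setT) ->
    \int[nu]_(x in [set x | del%:E < hlmax mu g x]) (hlmax mu g x `^ p) <=
      C%:E * ((del `^ p)%:E * nu [set x | del%:E < hlmax mu g x] +
              \int[nu]_x (hlmax mu V x `^ p)).
Proof.
move=> C01 p0 c0; have [K K1 hK] := good_lambda C01 c0.
have K0 : (0 < K)%R by exact: lt_trans K1.
have Kp0 : (0 < K `^ p)%R by exact: powR_gt0.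
(* For this [eta], the contribution of each level to the sum below is at most half
of that of the previous level, up to the contribution of [V]. *)
have eta0 : (0 < (2 * K `^ p)^-1)%R by rewrite invr_gt0 mulr_gt0.
have [gam gam0 good] := hK _ eta0.
have gp0 : (0 < gam `^ p)%R by exact: powR_gt0.
have K'1 := powK_gt1 K1 p0.
pose D := (K `^ p / gam `^ p * (1 + (K `^ p - 1)^-1))%R.
have D0 : (0 < D)%R by rewrite mulr_gt0 ?divr_gt0// addr_gt0// invr_gt0 subr_gt0.
pose D1 := (1 + D)%R; have D10 : (0 < D1)%R by rewrite addr_gt0.
exists (K `^ p * (2 * D1))%R; first by rewrite !mulr_gt0.
move=> nu hnu g V mg g0 V0 sharp del del0 proper.
set T0 := nu [set x | del%:E < hlmax mu g x]; set J := \int[nu]_x _.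
have J0 : 0 <= J by apply: integral_ge0 => x _; exact: poweR_ge0.
have T00 : 0 <= T0 by exact: measure_ge0.
rewrite EFinM -muleA; apply: integral_le_layers => //.
- exact: measurable_hlmax.
- by move=> x; exact: hlmax_ge0.
pose l := level del K.
have l0 k : (0 < l k)%R by exact: level_gt0.
pose T k := nu [set x | (l k)%:E < hlmax mu g x].
pose U k := nu [set x | (level (gam * del) K k)%:E < hlmax mu V x].
pose Q := (del `^ p)%:E * T0 + D%:E * J.
have Q0 : 0 <= Q by rewrite adde_ge0// mule_ge0// ?lee_fin ?powR_ge0// ltW.
have TU k : T k.+1 <= ((2 * K `^ p)^-1)%:E * T k + U k.
  have := good nu hnu g V mg g0 V0 sharp (l k) (l0 k).
  rewrite /T /U /l levelS (_ : level (gam * del) K k = gam * level del K k)%R; last first.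
    by rewrite /level mulrA.
  by apply; apply: proper; rewrite -[leLHS]mulr1 -(expr0 K); exact: le_level.
have sumU N : (K `^ p)%:E * \sum_(k < N) (l k `^ p)%:E * U k <= D%:E * J.
  have gd0 : (0 < gam * del)%R by rewrite mulr_gt0.
  have h := @sum_layers_le _ _ _ nu K p K1 p0 (hlmax mu V) (gam * del)%R N gd0
    (measurable_hlmax mu V) (fun x => hlmax_ge0 mu x V0).
  have -> : \sum_(k < N) (l k `^ p)%:E * U k =
      \sum_(k < N) (gam `^ p)^-1%:E * ((level (gam * del) K k `^ p)%:E * U k).
    apply: eq_bigr => k _; rewrite muleA -EFinM; congr (_%:E * _).
    rewrite (_ : level (gam * del) K k = gam * l k)%R; last by rewrite /l /level mulrA.
    rewrite [((gam * _) `^ p)%R]powRM ?ltW//.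
    by rewrite mulrA mulVf ?mul1r// gt_eqF.
  rewrite -ge0_sume_distrr; last by move=> k _; rewrite mule_ge0// lee_fin powR_ge0.
  rewrite muleA -EFinM.
  apply: le_trans (lee_wpmul2l _ h) _; first by rewrite lee_fin divr_ge0// ltW.
  by rewrite muleA -EFinM.
have S N : \sum_(k < N) (l k `^ p)%:E * T k <= 2%:E * Q.
  elim: N => [|N IH]; first by rewrite big_ord0 mule_ge0.
  rewrite big_ord_recl /l /level expr0 mulr1 -/l.
  have -> : T 0%N = T0 by rewrite /T /T0 /l /level expr0 mulr1.
  apply: (@le_trans _ _ ((del `^ p)%:E * T0 + \sum_(k < N)
     (2^-1%:E * ((l k `^ p)%:E * T k) + (K `^ p)%:E * ((l k `^ p)%:E * U k)))).
    apply: leeD2l; apply: lee_sum => k _.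
    apply: le_trans (lee_wpmul2l _ (TU k)) _; first by rewrite lee_fin powR_ge0.
    rewrite ge0_muleDr ?mule_ge0// ?lee_fin ?invr_ge0 ?mulr_ge0 ?powR_ge0//.
    have e : ((del * K ^+ (bump 0 k)) `^ p = K `^ p * l k `^ p)%R.
      by rewrite /bump /= add1n -level_powS.
    rewrite e; apply: leeD; last by rewrite muleA -EFinM.
    rewrite !muleA -!EFinM; apply: lee_wpmul2r => //; rewrite lee_fin.
    by rewrite le_eqVlt; apply/orP; left; apply/eqP; field; rewrite gt_eqF.
  rewrite big_split /= -!ge0_sume_distrr; last 2 first.
  - by move=> k _; rewrite mule_ge0// lee_fin powR_ge0.
  - by move=> k _; rewrite mule_ge0// lee_fin powR_ge0.
  apply: (@le_trans _ _ ((del `^ p)%:E * T0 + (2^-1%:E * (2%:E * Q) + D%:E * J))).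
    apply: leeD2l; apply: leeD; last exact: sumU.
    by apply: lee_wpmul2l => //; rewrite lee_fin invr_ge0.
  rewrite muleA -EFinM mulVf// mul1e addeCA -/Q.
  by rewrite (_ : 2%:E = 1%:E + 1%:E) ?ge0_muleDl ?mul1e// -EFinD.
move=> N; apply: le_trans (S N) _; clearbody J T0; rewrite EFinM -muleA.
apply: lee_wpmul2l => //; rewrite /Q ge0_muleDr ?mule_ge0 ?lee_fin ?powR_ge0//.
apply: leeD; last by apply: lee_wpmul2r => //; rewrite lee_fin /D1; lra.
rewrite -[leLHS]mul1e; apply: lee_wpmul2r; last by rewrite lee_fin /D1; lra.
by rewrite mule_ge0// lee_fin powR_ge0.
Qed.

End GoodLambda.

(** * The Rubio de Francia algorithm *)

Section RubioDeFrancia.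
Local Open Scope ereal_scope.

Lemma le_term_nneseries (R : realType) (f : nat -> \bar R) n :
  (forall k, 0 <= f k) -> f n <= \sum_(k <oo) f k.
Proof.
move=> f0; rewrite (nneseriesD1 (n := n))// leeDl//.
by apply: nneseries_ge0 => k _ _; exact: f0.
Qed.

Lemma nneseries_tail_le (R : realType) (f : nat -> \bar R) :
  (forall k, 0 <= f k) -> \sum_(k <oo) f k.+1 <= \sum_(k <oo) f k.
Proof.
move=> f0; have := nneseries_addn 1 f0; under eq_eseriesr do rewrite addn1.
move=> ->; rewrite [leRHS]nneseries_recl// leeDr//.
Qed.

Lemma measurable_nneseries d (T : measurableType d) (R : realType)
    (h : nat -> T -> \bar R) : (forall k x, 0 <= h k x) ->
  (forall k, measurable_fun setT (h k)) ->
  measurable_fun setT (fun x => \sum_(k <oo) h k x).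
Proof.
by move=> h0 mh; apply: (ge0_emeasurable_sum (P := xpredT)) => k *; [exact: h0|exact: mh].
Qed.

Lemma series_half_le (R : realType) (a : nat -> \bar R) (s : \bar R) :
  (forall k, 0 <= a k) -> (forall k, a k <= s) ->
  \sum_(k <oo) (2^-1 ^+ k)%:E * a k <= 2%:E * s.
Proof.
move=> a0 as_; have s0 : 0 <= s by exact: le_trans (a0 0%N) (as_ 0%N).
apply: lime_le; first by apply: is_cvg_nneseries => k _ _; rewrite mule_ge0// lee_fin exprn_ge0// invr_ge0.
apply: nearW => n.
apply: (@le_trans _ _ (\sum_(0 <= k < n) (2^-1 ^+ k)%:E * s)).
  by apply: lee_sum => k _; apply: lee_wpmul2l => //; rewrite lee_fin exprn_ge0// invr_ge0.
rewrite -ge0_sume_distrl; last by move=> k _; rewrite lee_fin exprn_ge0// invr_ge0.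
apply: lee_wpmul2r => //; rewrite sumEFin lee_fin.
suff -> : (\sum_(0 <= k < n) 2^-1 ^+ k = 2 - 2 * 2^-1 ^+ n :> R)%R.
  by rewrite lerBlDr lerDl mulr_ge0// exprn_ge0// invr_ge0.
elim: n => [|n IH]; first by rewrite big_geq// expr0 mulr1 subrr.
by rewrite big_nat_recr//= IH exprS; field.
Qed.

(** Each term is at most the [p]-th root of the sum on the right-hand side. *)
Lemma series_half_pow_le (R : realType) (p : R) (a : nat -> \bar R) :
  (0 < p)%R -> (forall k, 0 <= a k) ->
  (\sum_(k <oo) (2^-1 ^+ k)%:E * a k) `^ p <= (2 `^ p)%:E * \sum_(k <oo) (a k `^ p).
Proof.
move=> p0 a0; set S := \sum_(k <oo) (a k `^ p).
have S0 : 0 <= S by apply: nneseries_ge0 => k _ _; exact: poweR_ge0.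
have aS k : a k <= S `^ p^-1.
  have -> : a k = (a k `^ p) `^ p^-1 by rewrite -poweRrM divff ?gt_eqF// poweRe1.
  apply: le_poweR; [by rewrite invr_ge0 ltW|exact: poweR_ge0|].
  by apply: (le_term_nneseries (f := fun k => a k `^ p)) => j; exact: poweR_ge0.
have h := series_half_le a0 aS.
apply: (@le_trans _ _ ((2%:E * S `^ p^-1) `^ p)).
  apply: le_poweR => //; first exact: ltW.
  by apply: nneseries_ge0 => k _ _; rewrite mule_ge0// lee_fin exprn_ge0// invr_ge0.
by rewrite poweRM ?poweR_ge0// -poweRrM mulVf ?gt_eqF// poweRe1// poweR_EFin.
Qed.

Context {R : realType} {d : measure_display} {X : borelMetricType R d}.
Variables mu nu : {measure set X -> \bar R}.

Lemma integral_series_half_pow (p : R) (a : nat -> X -> \bar R) :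
  (0 < p)%R -> (forall k, measurable_fun setT (a k)) -> (forall k x, 0 <= a k x) ->
  \int[nu]_x ((\sum_(k <oo) (2^-1 ^+ k)%:E * a k x) `^ p) <=
  (2 `^ p)%:E * \sum_(k <oo) \int[nu]_x (a k x `^ p).
Proof.
move=> p0 ma a0.
have map k : measurable_fun setT (fun x => a k x `^ p).
  exact: (measurableT_comp (measurable_poweR _) (ma k)).
rewrite -integral_nneseries//; last by move=> *; exact: poweR_ge0.
rewrite -ge0_integralZl_EFin ?powR_ge0//; last 2 first.
- by move=> x _; apply: nneseries_ge0 => *; exact: poweR_ge0.
- by apply: measurable_nneseries => // *; exact: poweR_ge0.
apply: ge0_integral_mono => x _; [exact: poweR_ge0|exact: series_half_pow_le].
Qed.

Definition iter_hlmax (H : X -> \bar R) k := iter k (hlmax mu) H.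

(** The majorant is a sum of the iterates of the maximal operator with geometric
weights: the operator only shifts the terms, up to a factor. *)
Lemma rubio_de_francia (p N : R) (H : X -> \bar R) : (0 < p)%R -> (0 < N)%R ->
    (forall h, measurable_fun setT h -> (forall x, 0 <= h x) ->
      \int[nu]_x (hlmax mu h x `^ p) <= N%:E * \int[nu]_x (h x `^ p)) ->
    measurable_fun setT H -> (forall x, 0 <= H x) ->
    \int[nu]_x (H x `^ p) < +oo ->
  exists W : X -> \bar R, exists2 C : R, (0 < C)%R &
    [/\ measurable_fun setT W, forall x, H x <= W x,
        forall x, hlmax mu W x <= C%:E * W x & \int[nu]_x (W x `^ p) < +oo].
Proof.
move=> p0 N0 hM mH H0 Hfin.
(* With this factor, the integral of the [p]-th power is at least halved at each
iteration. *)
pose e := ((2 * N)^-1 `^ p^-1)%R.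
have e0 : (0 < e)%R by rewrite powR_gt0// invr_gt0 mulr_gt0.
have ep : (e `^ p = (2 * N)^-1)%R.
  by rewrite -powRrM mulVf ?gt_eqF// powRr1// invr_ge0 mulr_ge0// ltW.
have ek0 k : (0 <= e ^+ k)%R by rewrite exprn_ge0// ltW.
have hk0 k : (0 <= 2^-1 ^+ k :> R)%R by rewrite exprn_ge0// invr_ge0.
have I0 k x : 0 <= iter_hlmax H k x.
  by elim: k x => [//|k IH] x; exact: hlmax_ge0.
have mI k : measurable_fun setT (iter_hlmax H k).
  by case: k => [//|k]; exact: measurable_hlmax.
have Ik k : \int[nu]_x (iter_hlmax H k x `^ p) <= (N ^+ k)%:E * \int[nu]_x (H x `^ p).
  elim: k => [|k IH]; first by rewrite expr0 mul1e.
  apply: le_trans (hM _ (mI k) (I0 k)) _; rewrite exprS EFinM -muleA.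
  by apply: lee_wpmul2l => //; rewrite lee_fin ltW.
pose a k x := (e ^+ k)%:E * iter_hlmax H k x.
have a0 k x : 0 <= a k x by rewrite mule_ge0// lee_fin.
have ma k : measurable_fun setT (a k) by exact: measurable_funeM.
pose W x := \sum_(k <oo) (2^-1 ^+ k)%:E * a k x.
have t0 k x : 0 <= (2^-1 ^+ k)%:E * a k x by rewrite mule_ge0// lee_fin.
have mW : measurable_fun setT W.
  by apply: measurable_nneseries => // k; exact: measurable_funeM.
exists W, (2 / e)%R; first by rewrite divr_gt0.
split => //.
- move=> x; have := le_term_nneseries (f := fun k => (2^-1 ^+ k)%:E * a k x) 0%N (t0 ^~ x).
  by rewrite expr0 mul1e /a expr0 mul1e.
- move=> x; have mt k : measurable_fun setT (fun y => (2^-1 ^+ k)%:E * a k y) by exact: measurable_funeM.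
  apply: le_trans (hlmax_series mu x mt t0) _.
  rewrite /W -nneseriesZl//.
  apply: (@le_trans _ _ (\sum_(k <oo) (2 / e)%:E * ((2^-1 ^+ k.+1)%:E * a k.+1 x))).
    apply: lee_nneseries => [k _ _|k _]; first by apply: hlmax_ge0.
    apply: le_trans (hlmaxZ _ _ _ _ _) _ => //.
    rewrite [X in _ <= X]muleA -EFinM.
    apply: (@le_trans _ _ ((2^-1 ^+ k)%:E * ((e ^+ k)%:E * iter_hlmax H k.+1 x))).
      by apply: lee_wpmul2l; [rewrite lee_fin|exact: hlmaxZ].
    rewrite /a !muleA -!EFinM le_eqVlt; apply/orP; left; apply/eqP; congr (_%:E * _).
    by rewrite !exprS; field; rewrite gt_eqF.
  rewrite nneseriesZl// nneseriesZl//; apply: lee_wpmul2l.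
    by rewrite lee_fin divr_ge0// ltW.
  by apply: (nneseries_tail_le (f := fun k => (2^-1 ^+ k)%:E * a k x)) => k; exact: t0.
- apply: le_lt_trans (integral_series_half_pow p0 ma a0) _.
  have term k : \int[nu]_x (a k x `^ p) <= (2^-1 ^+ k)%:E * \int[nu]_x (H x `^ p).
    have e1 : \int[nu]_x (a k x `^ p) = ((e ^+ k) `^ p)%:E * \int[nu]_x (iter_hlmax H k x `^ p).
      rewrite -ge0_integralZl_EFin ?powR_ge0//.
      - by apply: eq_integral => x _; rewrite /a poweRM ?lee_fin.
      - by move=> x _; exact: poweR_ge0.
      - exact: (measurableT_comp (measurable_poweR _) (mI k)).
    rewrite e1; apply: le_trans (lee_wpmul2l _ (Ik k)) _; first by rewrite lee_fin powR_ge0.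
    rewrite muleA -EFinM; apply: lee_wpmul2r; first by apply: integral_ge0 => x _; exact: poweR_ge0.
    rewrite lee_fin -powR_mulrn ?(ltW e0)// powRAC ep powR_mulrn ?invr_ge0 ?mulr_ge0 ?(ltW N0)//.
    by rewrite -exprMn invfM -mulrA mulVf ?mulr1// gt_eqF.
  apply: (@le_lt_trans _ _ ((2 `^ p)%:E * (2%:E * \int[nu]_x (H x `^ p)))).
    apply: lee_wpmul2l; first by rewrite lee_fin powR_ge0.
    apply: le_trans (series_half_le (a := fun=> \int[nu]_x (H x `^ p)) _ _) => //.
    + apply: lee_nneseries => [k _ _|k _]; last exact: term.
      by apply: integral_ge0 => x _; exact: poweR_ge0.
    + by move=> _; apply: integral_ge0 => x _; exact: poweR_ge0.
  have If : \int[nu]_x (H x `^ p) \is a fin_num.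
    by rewrite ge0_fin_numE//; apply: integral_ge0 => x _; exact: poweR_ge0.
  by rewrite -(fineK If) -!EFinM ltry.
Qed.

End RubioDeFrancia.

(** * Weights that satisfy the A_infinity condition *)

Lemma EFin_ge0 (R : realType) (T : Type) (w : T -> R) : (forall x, 0 <= w x) ->
  forall x, (0 <= (EFin \o w) x)%E.
Proof. by move=> w0 x; rewrite lee_fin. Qed.

Section WeightedMeasure.
Local Open Scope ereal_scope.
Context d (T : measurableType d) (R : realType).
Variables (mu : {measure set T -> \bar R}).

Definition wmeasure (w : T -> R) (mw : measurable_fun [set: T] w)
    (w0 : forall x, (0 <= w x)%R) : {measure set T -> \bar R} :=
  density mu ((measurable_EFinP _ _).2 mw) (EFin_ge0 w0).

Lemma wmeasureE (w : T -> R) (mw : measurable_fun [set: T] w)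
    (w0 : forall x, (0 <= w x)%R) A : wmeasure mw w0 A = \int[mu]_(x in A) (w x)%:E.
Proof. by []. Qed.

Lemma integral_wmeasure (w : T -> R) (mw : measurable_fun [set: T] w)
    (w0 : forall x, (0 <= w x)%R) (E : set T) (f : T -> \bar R) : measurable E ->
    measurable_fun setT f -> (forall x, 0 <= f x) ->
  \int[wmeasure mw w0]_(x in E) f x = \int[mu]_(x in E) (f x * (w x)%:E).
Proof. by move=> mE mf f0; rewrite integral_density//; exact: measurable_funT. Qed.

End WeightedMeasure.

Section AInfinityWeights.
Local Open Scope ereal_scope.
Context {R : realType} {d : measure_display} {X : borelMetricType R d}.
Variable mu : {measure set X -> \bar R}.
Hypothesis hmu : doubling mu.

Lemma ainfty_doubling (c : R -> R) nu : ainfty mu c nu ->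
  (forall x r, (0 < r)%R -> 0 < nu (ball x r)) -> doubling nu.
Proof.
move=> hnu nu0; split=> //; have [c0 nuy _] := hnu.
have [C C1 hC] := ainfty_engulf hmu (ltr0Sn R 1) c0.
exists C => // x r r0; rewrite hC//; last by rewrite mdistxx mulr_ge0// ltW.
have Nf : nu (ball x r) \is a fin_num by rewrite ge0_fin_numE.
by rewrite -(fineK Nf) -EFinM ltry.
Qed.

(** Two functions in duality: [1 <= u1 / tau + u2 * tau ^ a] for all [tau],
optimised in [tau] on a subset of a ball, replaces Hoelder's inequality. *)
Lemma ainfty_dual (u1 u2 : X -> R) (a K : R) (mu1 : measurable_fun setT u1)
    (mu2 : measurable_fun setT u2) (u10 : forall x, (0 <= u1 x)%R)
    (u20 : forall x, (0 <= u2 x)%R) : (0 < a)%R -> (0 < K)%R ->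
  (forall tau x, (0 < tau)%R -> (1 <= u1 x / tau + u2 x * tau `^ a)%R) ->
  (forall x r, (0 < r)%R -> exists U1 U2 : R,
    [/\ \int[mu]_(y in ball x r) (u1 y)%:E = U1%:E,
        \int[mu]_(y in ball x r) (u2 y)%:E = U2%:E &
        (U1 * U2 `^ a^-1 <= K * fine (mu (ball x r)) `^ (1 + a^-1))%R]) ->
  ainfty mu (fun theta => (theta / 2) `^ (1 + a^-1) / K)%R (wmeasure mu mu1 u10).
Proof.
move=> a0 K0 pt HK; have ai0 : (0 < a^-1)%R by rewrite invr_gt0.
split.
- by move=> t t0; rewrite divr_gt0// powR_gt0// divr_gt0.
- move=> x r; have [r0|r0] := ltP 0%R r.
    by have [U1 [U2 [e _ _]]] := HK x r r0; rewrite wmeasureE e ltry.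
  rewrite (_ : ball x r = set0) ?measure0 ?ltry// -subset0 => y.
  by rewrite mballE => /lt_le_trans/(_ r0); rewrite ltNge mdist_ge0.
move=> t x r E t0 r0 mE Esub tE.
have [U1 [U2 [e1 e2 hU]]] := HK x r r0.
set V := fine (mu (ball x r)) in hU.
have V0 : (0 < V)%R by exact: fine_ball_gt0.
have Vfin := doubling_fin hmu x r.
have U10 : (0 <= U1)%R by rewrite -lee_fin -e1 integral_ge0// => y _; rewrite lee_fin.
have U20 : (0 <= U2)%R by rewrite -lee_fin -e2 integral_ge0// => y _; rewrite lee_fin.
have mu1E D : measurable_fun D (fun y => (u1 y)%:E).
  by apply: measurable_funT; exact/measurable_EFinP.
have mu2E D : measurable_fun D (fun y => (u2 y)%:E).
  by apply: measurable_funT; exact/measurable_EFinP.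
have key F tau : (0 < tau)%R -> measurable F -> F `<=` ball x r ->
    mu F <= (tau^-1)%:E * \int[mu]_(y in F) (u1 y)%:E + (tau `^ a * U2)%:E.
  move=> tau0 mF FB.
  apply: (@le_trans _ _ (\int[mu]_(y in F) ((tau^-1)%:E * (u1 y)%:E + (tau `^ a)%:E * (u2 y)%:E))).
    rewrite -[leLHS]mul1e -integral_cst//; apply: ge0_integral_mono => // y _.
    by rewrite -!EFinM -EFinD lee_fin mulrC [(tau `^ a * _)%R]mulrC; exact: pt.
  rewrite ge0_integralD//; last 4 first.
  - by move=> y _; rewrite mule_ge0// lee_fin// invr_ge0 ltW.
  - exact: measurable_funeM.
  - by move=> y _; rewrite mule_ge0// lee_fin// powR_ge0.
  - exact: measurable_funeM.
  rewrite !ge0_integralZl_EFin ?powR_ge0 ?invr_ge0 ?(ltW tau0)//; last 2 first.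
  - by move=> y _; rewrite lee_fin.
  - by move=> y _; rewrite lee_fin.
  apply: leeD => //; rewrite EFinM; apply: lee_wpmul2l; first by rewrite lee_fin powR_ge0.
  by rewrite -e2; apply: ge0_subset_integral => // y _; rewrite lee_fin.
have U2gt : (0 < U2)%R.
  rewrite lt_neqAle eq_sym U20 andbT; apply/eqP => U2e.
  have tau0 : (0 < 2 * (U1 + 1) / V)%R by rewrite divr_gt0// mulr_gt0//; lra.
  have := key _ _ tau0 (measurable_mball x r) (@subset_refl _ _).
  rewrite e1 U2e mulr0 adde0 -(fineK Vfin) -EFinM lee_fin -/V leNgt => /negP; apply.
  by rewrite invf_div mulrAC ltr_pdivrMr ?mulr_gt0//; [nra|lra].
(* This value of [tau ^ a] makes the second term of [key] half of the left-hand
side. *)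
pose th := (t * V / (2 * U2))%R.
have th0 : (0 < th)%R by rewrite divr_gt0// mulr_gt0.
pose tau := (th `^ a^-1)%R.
have tau0 : (0 < tau)%R by exact: powR_gt0.
have taua : (tau `^ a = th)%R by rewrite /tau -powRrM mulVf ?gt_eqF// powRr1// ltW.
have := key _ _ tau0 mE Esub; rewrite taua wmeasureE.
have If : \int[mu]_(y in E) (u1 y)%:E \is a fin_num.
  rewrite ge0_fin_numE; last by apply: integral_ge0 => y _; rewrite lee_fin.
  apply: (@le_lt_trans _ _ U1%:E); last exact: ltry.
  by rewrite -e1; apply: ge0_subset_integral => // y _; rewrite lee_fin.
rewrite -(fineK If) wmeasureE e1; set I := fine _ => h.
have {}h := le_trans tE h; move: h.
rewrite -(fineK Vfin) -/V -!EFinM -EFinD !lee_fin => h.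
have thU : (th * U2 = t * V / 2)%R by rewrite /th; field; rewrite gt_eqF.
rewrite thU in h.
have h2 : (tau * (t * V / 2) <= I)%R.
  have : (t * V / 2 <= tau^-1 * I)%R by lra.
  by rewrite ler_pdivlMl.
rewrite -(fineK If) -/I lee_fin; apply: le_trans h2.
have Ua0 : (0 < U2 `^ a^-1)%R by exact: powR_gt0.
have -> : (tau * (t * V / 2) = (t / 2) `^ (1 + a^-1) * V `^ (1 + a^-1) / U2 `^ a^-1)%R.
  rewrite /tau /th (_ : t * V / (2 * U2) = (t / 2) * V * U2^-1)%R; last first.
    by field; rewrite gt_eqF.
  have t20 : (0 < t / 2)%R by rewrite divr_gt0.
  rewrite !powRM ?mulr_ge0 ?invr_ge0 ?(ltW t0) ?(ltW V0) ?(ltW t20) ?(ltW U2gt)//.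
  have pD (y : R) : (0 < y)%R -> (y `^ (1 + a^-1) = y * y `^ a^-1)%R.
    move=> y0; rewrite powRD ?powRr1 ?(ltW y0)//; by apply/implyP => _; rewrite gt_eqF.
  rewrite !pD//.
  have -> : (U2^-1 `^ a^-1 = (U2 `^ a^-1)^-1)%R.
    by rewrite -(powR_inv1 (ltW U2gt)) -powRrM mulN1r powRN.
  by ring.
rewrite ler_pdivlMr// -!mulrA ler_wpM2l ?powR_ge0//.
by rewrite ler_pdivrMl// mulrC.
Qed.

Lemma ae_gt0_point (P : X -> Prop) : {ae mu, forall x, P x} ->
  forall x r, (0 < r)%R -> exists z, ball x r z /\ P z.
Proof.
move=> [N [mN N0 hN]] x r r0; apply: contrapT => h.
have : mu (ball x r) <= mu N.
  by apply: le_measure; rewrite ?inE// => z xz; apply: hN => hz; apply: h; exists z.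
by rewrite N0 leNgt doubling_gt0.
Qed.

Lemma A1_integral_lty (w : X -> R) (C : R) x r : (0 < r)%R ->
  {ae mu, forall x, hlmax mu (EFin \o w) x <= (C * w x)%:E} ->
  \int[mu]_(y in ball x r) (w y)%:E < +oo.
Proof.
move=> r0 hw; have [z [xz hz]] := ae_gt0_point hw x r0.
apply: le_lt_trans (integral_ball_le hmu _ r0 xz) _.
apply: (@le_lt_trans _ _ (mu (ball x r) * (C * w z)%:E)); first exact: lee_wpmul2l.
by rewrite -(fineK (doubling_fin hmu x r)) -EFinM ltry.
Qed.

(** The mean over a ball is at most a multiple of the values almost everywhere on
the ball, which is integrated over the subset. *)
Lemma ainfty_A1 (w : X -> R) (C : R) (mw : measurable_fun setT w)
    (w0 : forall x, (0 <= w x)%R) : (0 < C)%R ->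
  {ae mu, forall x, hlmax mu (EFin \o w) x <= (C * w x)%:E} ->
  ainfty mu (fun theta => theta / C)%R (wmeasure mu mw w0).
Proof.
move=> C0 hw; have w0' x : 0 <= (EFin \o w) x by rewrite lee_fin.
have mw' D : measurable_fun D (EFin \o w) by apply: measurable_funT; exact/measurable_EFinP.
split.
- by move=> t t0; rewrite divr_gt0.
- move=> x r; have [r0|r0] := ltP 0%R r; first by rewrite wmeasureE (A1_integral_lty _ r0 hw).
  rewrite (_ : ball x r = set0) ?measure0 ?ltry// -subset0 => y.
  by rewrite mballE => /lt_le_trans/(_ r0); rewrite ltNge mdist_ge0.
move=> t x r E t0 r0 mE EB tE; rewrite !wmeasureE mulrC EFinM -muleA lee_pdivrMl//.
rewrite -[leRHS]ge0_integralZl_EFin ?(ltW C0)//; last by move=> y _; exact: (w0' y).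
set W := \int[mu]_(y in ball x r) _.
have W0 : 0 <= W by apply: integral_ge0 => y _; exact: w0'.
have m0 : 0 <= mean mu x r (EFin \o w) by exact: mean_ge0.
apply: (@le_trans _ _ (\int[mu]_(y in E) cst (mean mu x r (EFin \o w)) y)).
  have Vfin := doubling_fin hmu x r; have V0 := fine_ball_gt0 hmu x r0.
  rewrite integral_cst// (_ : _ * mu E = ((fine (mu (ball x r)))^-1%:E * mu E) * W); last first.
    by rewrite /mean muleAC.
  apply: lee_wpmul2r => //; rewrite lee_pdivlMl// fineK// muleC//.
apply: ae_ge0_le_integral => //.
- by move=> y _; rewrite mule_ge0// lee_fin// ltW.
- exact: measurable_funeM.
- apply: filterS hw => y hy Ey; rewrite /= -EFinM; apply: le_trans hy.
  exact: mean_le_hlmax (EB _ Ey).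
Qed.

(** On half of the subset, in measure, the minimum is the first weight or it is the
second. The bound does not change if a weight is multiplied by a constant, which
gives uniformity over the minima with the multiples of a fixed weight. *)
Lemma ainfty_min (c1 c2 : R -> R) (w1 w2 : X -> R) (m1 : measurable_fun setT w1)
    (m2 : measurable_fun setT w2) (w10 : forall x, (0 <= w1 x)%R)
    (w20 : forall x, (0 <= w2 x)%R)
    (m12 : measurable_fun setT (fun x => Num.min (w1 x) (w2 x)))
    (w120 : forall x, (0 <= Num.min (w1 x) (w2 x))%R) :
  ainfty mu c1 (wmeasure mu m1 w10) -> ainfty mu c2 (wmeasure mu m2 w20) ->
  ainfty mu (fun theta => Num.min (c1 (theta / 2)) (c2 (theta / 2)))%R
    (wmeasure mu m12 w120).
Proof.
move=> [c10 f1 h1] [c20 f2 h2].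
have mE1 D : measurable_fun D (fun y => (w1 y)%:E) by apply: measurable_funT; exact/measurable_EFinP.
have mE2 D : measurable_fun D (fun y => (w2 y)%:E) by apply: measurable_funT; exact/measurable_EFinP.
have mE12 D : measurable_fun D (fun y => (Num.min (w1 y) (w2 y))%:E) by apply: measurable_funT; exact/measurable_EFinP.
have le1 D : measurable D -> wmeasure mu m12 w120 D <= wmeasure mu m1 w10 D.
  move=> mD; rewrite !wmeasureE; apply: ge0_integral_mono => y _; rewrite lee_fin//.
  by rewrite ge_min lexx.
have le2 D : measurable D -> wmeasure mu m12 w120 D <= wmeasure mu m2 w20 D.
  move=> mD; rewrite !wmeasureE; apply: ge0_integral_mono => y _; rewrite lee_fin//.
  by rewrite ge_min lexx orbT.
split.
- by move=> t t0; rewrite lt_min c10 ?c20// divr_gt0.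
- by move=> x r; exact: le_lt_trans (le1 _ _) (f1 x r).
move=> t x r E t0 r0 mE EB tE.
pose A := [set y | (w1 y <= w2 y)%R].
have mA : measurable A.
  rewrite (_ : A = (fun y => w1 y <= w2 y)%R @^-1` [set true]); last first.
    by apply/seteqP; split => y /=.
  by rewrite -[X in measurable X]setTI; exact: (measurable_fun_ler m1 m2).
have mEA : measurable (E `&` A) by exact: measurableI.
have mEDA : measurable (E `\` A) by exact: measurableD.
have t20 : (0 < t / 2)%R by rewrite divr_gt0.
have split2 : (t / 2)%:E * mu (ball x r) <= mu (E `&` A) \/
    (t / 2)%:E * mu (ball x r) <= mu (E `\` A).
  have e : mu E = mu (E `&` A) + mu (E `\` A).
    by rewrite -measureU ?setUIDK// -subset0 => u [[_ Au] [_ nA]].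
  have Vfin := doubling_fin hmu x r.
  have [h|h] := leP ((t / 2)%:E * mu (ball x r)) (mu (E `&` A)); [by left|right].
  rewrite leNgt; apply/negP => h'; move: tE; rewrite e leNgt => /negP; apply.
  apply: lt_le_trans (lteD h h') _.
  by rewrite -(fineK Vfin) -!EFinM -EFinD lee_fin; lra.
case: split2 => h.
- apply: (@le_trans _ _ ((c1 (t / 2))%:E * wmeasure mu m1 w10 (ball x r))).
    apply: lee_pmul => //; [|by rewrite lee_fin ge_min lexx|exact: le1].
    by rewrite lee_fin le_min !ltW ?c10 ?c20.
  apply: le_trans (h1 _ _ _ _ t20 r0 mEA _ h) _; first by move=> y [/EB].
  rewrite !wmeasureE; apply: (@le_trans _ _ (\int[mu]_(y in E `&` A) (Num.min (w1 y) (w2 y))%:E)).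
    by apply: ge0_integral_mono => y; [rewrite lee_fin|move=> [_ /= Ay]; rewrite lee_fin min_l].
  by apply: ge0_subset_integral => // y _; rewrite lee_fin.
- apply: (@le_trans _ _ ((c2 (t / 2))%:E * wmeasure mu m2 w20 (ball x r))).
    apply: lee_pmul => //; [|by rewrite lee_fin ge_min lexx orbT|exact: le2].
    by rewrite lee_fin le_min !ltW ?c10 ?c20.
  apply: le_trans (h2 _ _ _ _ t20 r0 mEDA _ h) _; first by move=> y [/EB].
  rewrite !wmeasureE; apply: (@le_trans _ _ (\int[mu]_(y in E `\` A) (Num.min (w1 y) (w2 y))%:E)).
    apply: ge0_integral_mono => y; [by rewrite lee_fin|move=> [_ /= /negP]].
    by rewrite -ltNge => /ltW wy; rewrite lee_fin min_r.
  by apply: ge0_subset_integral => // y _; rewrite lee_fin.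
Qed.

End AInfinityWeights.

(** * Muckenhoupt weights *)

(** An affine majorant of a concave power, of the right size at [b]; it is
integrated where Jensen's inequality would be applied. *)
Lemma powR_le_affine (R : realType) (t b th : R) : 0 <= t -> 0 < b -> 0 <= th <= 1 ->
  t `^ th <= b `^ th + b `^ (th - 1) * t.
Proof.
move=> t0 b0 /andP[th0 th1]; have [tb|bt] := leP t b.
  by apply: ler_wpDr; [rewrite mulr_ge0 ?powR_ge0|rewrite ge0_ler_powR// nnegrE ltW].
have t1 : 0 < t by exact: lt_trans bt.
apply: ler_wpDl; first exact: powR_ge0.
have -> : t `^ th = t `^ (th - 1) * t.
  by rewrite -[X in _ = _ * X](powRr1 t0) -powRD ?subrK// (gt_eqF t1) implybT.
rewrite ler_wpM2r// -[th - 1]opprB !powRN lef_pV2 ?posrE ?powR_gt0//.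
by rewrite ge0_ler_powR ?subr_ge0// ?nnegrE ?ltW.
Qed.

Lemma measurable_powR_fun (R : realType) d (T : measurableType d)
    (w : T -> R) (r : R) : measurable_fun setT w ->
  measurable_fun setT (fun x => w x `^ r).
Proof. move=> mw; exact: (measurableT_comp (measurable_powR r) mw). Qed.

Section Muckenhoupt.
Local Open Scope ereal_scope.
Context {R : realType} {d : measure_display} {X : borelMetricType R d}.
Variable mu : {measure set X -> \bar R}.
Hypothesis hmu : doubling mu.

(** The A_q condition for an everywhere positive weight, with its dual weight;
the averages are replaced by the integrals. *)
Definition Aq_weight (q K : R) (w : X -> R) : Prop :=
  [/\ measurable_fun setT w, forall x, (0 < w x)%R &
   forall x r, (0 < r)%R -> exists W S : R,
    [/\ \int[mu]_(y in ball x r) (w y)%:E = W%:E,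
        \int[mu]_(y in ball x r) (w y `^ (- (q - 1)^-1))%:E = S%:E &
        (W * S `^ (q - 1) <= K * fine (mu (ball x r)) `^ q)%R]].

Lemma wmeasure_gt0 (w : X -> R) (mw : measurable_fun setT w)
    (w0 : forall x, (0 <= w x)%R) A : measurable A -> 0 < mu A ->
  (forall x, (0 < w x)%R) -> 0 < wmeasure mu mw w0 A.
Proof.
move=> mA A0 wpos; rewrite lt_neqAle measure_ge0 andbT; apply/eqP => e.
have mwA : measurable_fun A (EFin \o w) by apply: measurable_funT; exact/measurable_EFinP.
have : \int[mu]_(x in A) `|(EFin \o w) x| = 0.
  rewrite [RHS]e wmeasureE; apply: eq_integral => x _ /=.
  by rewrite ger0_norm.
move/(ae_eq_integral_abs mu mA mwA) => [N [mN N0 hN]].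
have : mu A <= mu N.
  apply: le_measure; rewrite ?inE// => x Ax; apply: hN => /(_ Ax) /= [] wx.
  by have := wpos x; rewrite wx ltxx.
by rewrite N0 leNgt A0.
Qed.

Section OneWeight.
Variables (q K : R) (w : X -> R).
Hypotheses (q1 : (1 < q)%R) (K0 : (0 < K)%R) (hw : Aq_weight q K w).

Let sg x := (w x `^ (- (q - 1)^-1))%R.

Hypotheses (mw : measurable_fun setT w) (w0 : forall x, (0 <= w x)%R).
Hypotheses (msg : measurable_fun setT sg) (sg0 : forall x, (0 <= sg x)%R).

Let wp x : (0 < w x)%R. Proof. by case: hw. Qed.
Let sgp x : (0 < sg x)%R. Proof. exact: powR_gt0. Qed.
Let q0 : (0 < q - 1)%R. Proof. by rewrite subr_gt0. Qed.

Let dual_pair a (u1 u2 : R) : (0 < a)%R -> (0 < u1)%R -> (u2 = u1 `^ (- a))%R ->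
  forall tau, (0 < tau)%R -> (1 <= u1 / tau + u2 * tau `^ a)%R.
Proof.
move=> a0 u10 -> tau tau0; have [h|h] := leP tau u1.
  apply: ler_wpDr; first by rewrite mulr_ge0 ?powR_ge0.
  by rewrite ler_pdivlMr// mul1r.
apply: ler_wpDl; first by rewrite divr_ge0 ?ltW.
by rewrite powRN ler_pdivlMl ?powR_gt0// mulr1 ge0_ler_powR ?nnegrE ?ltW.
Qed.

Lemma Aq_ainfty : ainfty mu (fun theta => (theta / 2) `^ (1 + (q - 1)^-1^-1) / K)%R
  (wmeasure mu mw w0).
Proof.
apply: (ainfty_dual hmu mw msg w0 sg0 (a := (q - 1)^-1)) => //; first by rewrite invr_gt0.
- by move=> tau x tau0; apply: dual_pair => //; rewrite invr_gt0.
- move=> x r r0; have [_ _ /(_ x r r0)[W [S [e1 e2 h]]]] := hw.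
  by exists W, S; split=> //; rewrite invrK (_ : 1 + (q - 1) = q)%R; last by ring.
Qed.

Lemma Aq_ainfty_dual : ainfty mu (fun theta => (theta / 2) `^ (1 + (q - 1)^-1) / K `^ (q - 1)^-1)%R
  (wmeasure mu msg sg0).
Proof.
apply: (ainfty_dual hmu msg mw sg0 w0 (a := (q - 1)%R)) => //; first exact: powR_gt0.
- move=> tau x tau0; apply: dual_pair => //.
  by rewrite /sg -powRrM mulrNN mulVf ?gt_eqF// powRr1.
- move=> x r r0; have [_ _ /(_ x r r0)[W [S [e1 e2 h]]]] := hw.
  exists S, W; split=> //.
  have V0 := fine_ball_gt0 hmu x r0.
  have W0 : (0 <= W)%R by rewrite -lee_fin -e1 integral_ge0// => y _; rewrite lee_fin.
  have S0 : (0 <= S)%R by rewrite -lee_fin -e2 integral_ge0// => y _; rewrite lee_fin powR_ge0.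
  have : ((W * S `^ (q - 1)) `^ (q - 1)^-1 <= (K * fine (mu (ball x r)) `^ q) `^ (q - 1)^-1)%R.
    by rewrite ge0_ler_powR ?nnegrE ?invr_ge0 ?mulr_ge0 ?powR_ge0 ?(ltW q0) ?(ltW K0).
  rewrite !powRM ?powR_ge0 ?(ltW K0)// -!powRrM mulfV ?gt_eqF// powRr1// mulrC.
  rewrite (_ : q * (q - 1)^-1 = 1 + (q - 1)^-1)%R//.
  by field; rewrite gt_eqF.
Qed.

Let dw : doubling (wmeasure mu mw w0).
Proof.
apply: (ainfty_doubling hmu Aq_ainfty) => x r r0.
by apply: wmeasure_gt0 => //; exact: doubling_gt0.
Qed.

Let ds : doubling (wmeasure mu msg sg0).
Proof.
apply: (ainfty_doubling hmu Aq_ainfty_dual) => x r r0.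
by apply: wmeasure_gt0 => //; exact: doubling_gt0.
Qed.

Let poweR_le_inv (x y : \bar R) : 0 <= x -> 0 <= y -> x `^ (q - 1) <= y ->
  x <= y `^ (q - 1)^-1.
Proof.
move=> x0 y0 xy; have -> : x = (x `^ (q - 1)) `^ (q - 1)^-1.
  by rewrite -poweRrM divff ?gt_eqF// poweRe1.
by apply: le_poweR => //; [rewrite invr_ge0 ltW|exact: poweR_ge0].
Qed.

(** Lerner's pointwise bound: the average over a ball is compared with the
maximal function for the dual weight, and the A_q condition turns an average
with respect to [mu] into one with respect to [w]. *)
Let lerner (h : X -> \bar R) x : measurable_fun setT h -> (forall x, 0 <= h x) ->
  hlmax mu h x `^ (q - 1) <= K%:E * hlmax (wmeasure mu mw w0) (fun y =>
    hlmax (wmeasure mu msg sg0) (fun z => h z * (sg z)^-1%:E) y `^ (q - 1) * (w y)^-1%:E) x.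
Proof.
move=> mh h0; set Y := _ * _.
have mVsg : measurable_fun setT (fun z => (sg z)^-1%:E).
  apply/measurable_EFinP; rewrite (_ : (fun _ => _) = (fun z => w z `^ ((q - 1)^-1))%R).
    exact: measurable_powR_fun.
  by apply/funext => z; rewrite /sg powRN invrK.
have mVw : measurable_fun setT (fun z => (w z)^-1%:E).
  apply/measurable_EFinP; rewrite (_ : (fun _ => _) = (fun z => w z `^ (-1))%R).
    exact: measurable_powR_fun.
  by apply/funext => z; rewrite powR_inv1.
pose hs z := h z * (sg z)^-1%:E.
have hs0 z : 0 <= hs z by rewrite mule_ge0// lee_fin invr_ge0.
have mhs : measurable_fun setT hs by exact: emeasurable_funM.
have mZ : measurable_fun setT (fun y => hlmax (wmeasure mu msg sg0) hs y `^ (q - 1)).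
  exact: (measurableT_comp (measurable_poweR _) (measurable_hlmax _ _)).
have Z0 y : 0 <= hlmax (wmeasure mu msg sg0) hs y `^ (q - 1) by exact: poweR_ge0.
pose Zw y := hlmax (wmeasure mu msg sg0) hs y `^ (q - 1) * (w y)^-1%:E.
have Zw0 y : 0 <= Zw y by rewrite mule_ge0// lee_fin invr_ge0.
have mZw : measurable_fun setT Zw by exact: emeasurable_funM.
have Y0 : 0 <= Y by rewrite mule_ge0 ?hlmax_ge0// lee_fin ltW.
have Minv : hlmax mu h x <= Y `^ (q - 1)^-1.
  apply: hlmax_le => z r r0 zx; apply: poweR_le_inv => //; first exact: mean_ge0.
  have [_ _ /(_ z r r0)[W [S [e1 e2 hWS]]]] := hw.
  have V0 := fine_ball_gt0 hmu z r0; have Vfin := doubling_fin hmu z r.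
  set V := fine (mu (ball z r)) in hWS V0.
  have B0 : 0 < mu (ball z r) by exact: doubling_gt0.
  have S0 : (0 < S)%R by rewrite -lte_fin -e2; exact: (wmeasure_gt0 msg sg0 (measurable_mball z r) B0 sgp).
  have W0 : (0 < W)%R by rewrite -lte_fin -e1; exact: (wmeasure_gt0 mw w0 (measurable_mball z r) B0 wp).
  have SE : wmeasure mu msg sg0 (ball z r) = S%:E by [].
  have WE : wmeasure mu mw w0 (ball z r) = W%:E by [].
  have eh : mean mu z r h = (S / V)%:E * mean (wmeasure mu msg sg0) z r hs.
    rewrite /mean SE /= muleA -EFinM mulrAC divff ?gt_eqF// mul1r.
    congr (_ * _); rewrite integral_wmeasure//; apply: eq_integral => y _.
    by rewrite /hs -muleA -EFinM mulVf ?mule1// gt_eqF.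
  have le1 y : ball z r y -> mean mu z r h `^ (q - 1) <=
      ((S / V) `^ (q - 1))%:E * hlmax (wmeasure mu msg sg0) hs y `^ (q - 1).
    move=> zy; rewrite eh poweRM ?mean_ge0 ?lee_fin ?divr_ge0 ?(ltW S0) ?(ltW V0)//.
    rewrite poweR_EFin; apply: lee_wpmul2l; first by rewrite lee_fin powR_ge0.
    by apply: le_poweR; [exact: ltW|exact: mean_ge0|exact: mean_le_hlmax].
  have le2 : mean mu z r h `^ (q - 1) * V%:E <= ((S / V) `^ (q - 1))%:E *
      \int[mu]_(y in ball z r) (Zw y * (w y)%:E).
    rewrite -ge0_integralZl_EFin ?powR_ge0//; last 2 first.
    - by move=> y _; rewrite mule_ge0// lee_fin.
    - by apply: measurable_funT; apply: emeasurable_funM => //; exact/measurable_EFinP.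
    rewrite fineK// -integral_cst//; apply: ge0_integral_mono => y zy; first exact: poweR_ge0.
    by rewrite /Zw -muleA -EFinM mulVf ?gt_eqF// mule1; exact: le1.
  rewrite -integral_wmeasure// in le2.
  have {}le2 := le_trans le2 (lee_wpmul2l _ (integral_ball_le dw Zw r0 zx)).
  have {}le2 := le2 ltac:(by rewrite lee_fin powR_ge0).
  rewrite -(@lee_pmul2r _ V%:E) ?lte_fin//; apply: le_trans le2 _.
  rewrite WE muleA -EFinM /Y -/Zw [in leRHS]muleAC -EFinM; apply: lee_wpmul2r; first exact: hlmax_ge0.
  rewrite lee_fin powRM ?invr_ge0 ?(ltW S0) ?(ltW V0)//.
  have -> : (V^-1 `^ (q - 1) = V * (V `^ q)^-1)%R.
    rewrite -(powR_inv1 (ltW V0)) -powRrM mulN1r opprB powRB ?powRr1 ?(ltW V0)//.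
    by apply/implyP => _; rewrite gt_eqF.
  have Vq : (0 < V `^ q)%R by exact: powR_gt0.
  have : (W * S `^ (q - 1) / V `^ q <= K)%R by rewrite ler_pdivrMr.
  move=> h1; have := ler_wpM2r (ltW V0) h1.
  by move=> h2; apply: le_trans h2; rewrite le_eqVlt; apply/orP; left; apply/eqP; ring.
apply: (@le_trans _ _ ((Y `^ (q - 1)^-1) `^ (q - 1))).
  by apply: le_poweR; [exact: ltW|exact: hlmax_ge0|].
by rewrite -poweRrM mulVf ?gt_eqF// poweRe1.
Qed.

(** Muckenhoupt's theorem: Lerner's bound reduces it to the strong type inequalities
for the two doubling measures given by the weight and its dual. *)
Theorem muckenhoupt_maximal : exists2 C : R, (0 < C)%R & forall h,
  measurable_fun setT h -> (forall x, 0 <= h x) ->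
  \int[wmeasure mu mw w0]_x (hlmax mu h x `^ q) <=
  C%:E * \int[wmeasure mu mw w0]_x (h x `^ q).
Proof.
pose q' := (q / (q - 1))%R.
have q'1 : (1 < q')%R by rewrite ltr_pdivlMr// mul1r; lra.
have q'0 : (0 < q')%R by exact: lt_trans q'1.
have qq' : ((q - 1) * q' = q)%R by rewrite /q' mulrCA mulfV ?mulr1// gt_eqF.
have [Cw Cw0 hCw] := strong_type dw q'1.
have [Cs Cs0 hCs] := strong_type ds q1.
exists (K `^ q' * Cw * Cs)%R; first by rewrite !mulr_gt0// powR_gt0.
move=> h mh h0.
pose hs z := h z * (sg z)^-1%:E.
have mVsg : measurable_fun setT (fun z => (sg z)^-1%:E).
  apply/measurable_EFinP; rewrite (_ : (fun _ => _) = (fun z => w z `^ ((q - 1)^-1))%R).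
    exact: measurable_powR_fun.
  by apply/funext => z; rewrite /sg powRN invrK.
have mVw : measurable_fun setT (fun z => (w z)^-1%:E).
  apply/measurable_EFinP; rewrite (_ : (fun _ => _) = (fun z => w z `^ (-1))%R).
    exact: measurable_powR_fun.
  by apply/funext => z; rewrite powR_inv1.
have hs0 z : 0 <= hs z by rewrite mule_ge0// lee_fin invr_ge0.
have mhs : measurable_fun setT hs by exact: emeasurable_funM.
pose Ms := hlmax (wmeasure mu msg sg0) hs.
have Ms0 y : 0 <= Ms y by exact: hlmax_ge0.
have mMs r : measurable_fun setT (fun y => Ms y `^ r).
  exact: (measurableT_comp (measurable_poweR _) (measurable_hlmax _ _)).
pose Zw y := Ms y `^ (q - 1) * (w y)^-1%:E.
have Zw0 y : 0 <= Zw y by rewrite mule_ge0 ?poweR_ge0// lee_fin invr_ge0.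
have mZw : measurable_fun setT Zw by exact: emeasurable_funM.
have mp (f : X -> \bar R) r : measurable_fun setT f -> measurable_fun setT (fun y => f y `^ r).
  exact: (measurableT_comp (measurable_poweR _)).
apply: (@le_trans _ _ ((K `^ q')%:E * \int[wmeasure mu mw w0]_x (hlmax (wmeasure mu mw w0) Zw x `^ q'))).
  rewrite -ge0_integralZl_EFin ?powR_ge0//; last 2 first.
  - by move=> x _; exact: poweR_ge0.
  - exact/mp/measurable_hlmax.
  apply: ge0_integral_mono => x _; first exact: poweR_ge0.
  rewrite -[in leLHS]qq' poweRrM -poweR_EFin -poweRM ?hlmax_ge0 ?lee_fin ?(ltW K0)//.
  by apply: le_poweR; [exact: ltW|exact: poweR_ge0|exact: lerner].
rewrite -!mulrA EFinM -muleA; apply: lee_wpmul2l => //; first by rewrite lee_fin powR_ge0.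
rewrite EFinM -muleA.
apply: le_trans (hCw Zw mZw Zw0) _; apply: lee_wpmul2l; first by rewrite lee_fin ltW.
have e1 : \int[wmeasure mu mw w0]_x (Zw x `^ q') = \int[wmeasure mu msg sg0]_x (Ms x `^ q).
  rewrite (integral_wmeasure mu mw w0 measurableT (mp _ q' mZw)); last by move=> x; exact: poweR_ge0.
  rewrite (integral_wmeasure mu msg sg0 measurableT (mMs q)); last by move=> x; exact: poweR_ge0.
  apply: eq_integral => x _; rewrite /Zw poweRM ?poweR_ge0 ?lee_fin ?invr_ge0//.
  rewrite -poweRrM qq' -muleA; congr (_ * _); rewrite poweR_EFin -EFinM; congr (_%:E).
  rewrite -[X in (_ * X)%R](powRr1 (w0 x)) -(powR_inv1 (w0 x)) -powRrM mulN1r -powRD; last first.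
    by apply/implyP => _; rewrite gt_eqF.
  by rewrite /sg; congr (_ `^ _)%R; rewrite /q'; field; rewrite gt_eqF.
rewrite e1; apply: le_trans (hCs hs mhs hs0) _; apply: lee_wpmul2l; first by rewrite lee_fin ltW.
rewrite (integral_wmeasure mu mw w0 measurableT (mp _ q mh)); last by move=> x; exact: poweR_ge0.
rewrite (integral_wmeasure mu msg sg0 measurableT (mp _ q mhs)); last by move=> x; exact: poweR_ge0.
apply: ge0_integral_mono => x _; first by rewrite mule_ge0 ?poweR_ge0// lee_fin.
rewrite /hs poweRM ?lee_fin ?invr_ge0// -muleA; apply: lee_wpmul2l; first exact: poweR_ge0.
rewrite poweR_EFin -EFinM lee_fin le_eqVlt; apply/orP; left; apply/eqP.
rewrite -[X in (_ * X)%R](powRr1 (sg0 x)) -(powR_inv1 (sg0 x)) -powRrM mulN1r -powRD; last first.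
  by apply/implyP => _; rewrite gt_eqF.
rewrite /sg -powRrM -[RHS](powRr1 (w0 x)); congr (_ `^ _)%R.
by field; rewrite gt_eqF.
Qed.

End OneWeight.

(** The classes increase with the exponent: the new dual weight is a power,
between 0 and 1, of the former. *)
Lemma Aq_weight_mono (q p K : R) (w : X -> R) : (1 < q)%R -> (q <= p)%R -> (0 < K)%R ->
  Aq_weight q K w -> Aq_weight p (2 `^ (p - 1) * K) w.
Proof.
move=> q1 qp K0 [mw wp hw]; split => // x r r0.
have q0 : (0 < q - 1)%R by rewrite subr_gt0.
have p0 : (0 < p - 1)%R by rewrite subr_gt0 (lt_le_trans q1).
have [W [S [e1 e2 h]]] := hw x r r0.
have V0 := fine_ball_gt0 hmu x r0; have Vfin := doubling_fin hmu x r.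
set V := fine (mu (ball x r)) in h V0.
have B0 : 0 < mu (ball x r) by exact: doubling_gt0.
have W0 : (0 <= W)%R by rewrite -lee_fin -e1 integral_ge0// => y _; rewrite lee_fin ltW.
have mq t : measurable_fun setT (fun y => w y `^ t)%R by exact: measurable_powR_fun.
have S0 : (0 < S)%R.
  rewrite -lte_fin -e2; apply: (wmeasure_gt0 (mq _) (fun y => powR_ge0 _ _)) => // y.
  exact: powR_gt0.
pose th := ((q - 1) / (p - 1))%R; pose b := (S / V)%R.
have b0 : (0 < b)%R by rewrite divr_gt0.
have th1 : (0 <= th <= 1)%R.
  by rewrite divr_ge0 ?(ltW q0) ?(ltW p0)//= ler_pdivrMr// mul1r lerD2r.
have bth : (0 <= b `^ th)%R by exact: powR_ge0.
have bd : \int[mu]_(y in ball x r) (w y `^ (- (p - 1)^-1))%:E <= (2 * (b `^ th * V))%:E.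
  apply: (@le_trans _ _ (\int[mu]_(y in ball x r)
     ((b `^ th)%:E + (b `^ (th - 1))%:E * (w y `^ (- (q - 1)^-1))%:E))).
    apply: ge0_integral_mono => y _; first by rewrite lee_fin powR_ge0.
    rewrite -EFinM -EFinD lee_fin.
    have -> : (w y `^ (- (p - 1)^-1) = (w y `^ (- (q - 1)^-1)) `^ th)%R.
      by rewrite -powRrM; congr (_ `^ _)%R; rewrite /th; field; rewrite !gt_eqF.
    by apply: powR_le_affine => //; exact: powR_ge0.
  rewrite ge0_integralD//; last 2 first.
  - by move=> y _; rewrite mule_ge0 ?lee_fin ?powR_ge0.
  - apply: measurable_funeM; apply: measurable_funT; exact/measurable_EFinP.
  rewrite integral_cst// ge0_integralZl_EFin ?powR_ge0//; last 2 first.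
  - by move=> y _; rewrite lee_fin powR_ge0.
  - apply: measurable_funT; exact/measurable_EFinP.
  rewrite e2 -(fineK Vfin) -/V -!EFinM -EFinD lee_fin.
  have -> : (b `^ (th - 1) * S = b `^ th * V)%R.
    rewrite (_ : S = b * V)%R; last by rewrite /b divfK// gt_eqF.
    rewrite mulrA -[X in (_ * X * _)%R](powRr1 (ltW b0)) -powRD ?subrK//.
    by apply/implyP => _; rewrite gt_eqF.
  lra.
have If : \int[mu]_(y in ball x r) (w y `^ (- (p - 1)^-1))%:E \is a fin_num.
  rewrite ge0_fin_numE; first exact: le_lt_trans bd (ltry _).
  by apply: integral_ge0 => y _; rewrite lee_fin powR_ge0.
exists W, (fine (\int[mu]_(y in ball x r) (w y `^ (- (p - 1)^-1))%:E)); rewrite fineK//; split => //.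
move: bd; rewrite -(fineK If) lee_fin /=; set I := fine _ => bd.
have I0 : (0 <= I)%R by rewrite fine_ge0// integral_ge0// => y _; rewrite lee_fin powR_ge0.
apply: (@le_trans _ _ (W * (2 * (b `^ th * V)) `^ (p - 1))%R).
  by apply: ler_wpM2l => //; rewrite ge0_ler_powR ?nnegrE ?(ltW p0)// !mulr_ge0// ltW.
have -> : ((2 * (b `^ th * V)) `^ (p - 1) = 2 `^ (p - 1) * (b `^ (q - 1) * V `^ (p - 1)))%R.
  have V0' := ltW V0.
  rewrite powRM ?mulr_ge0//; congr (_ * _)%R; rewrite powRM// -powRrM.
  by rewrite (_ : th * (p - 1) = q - 1)%R// /th divfK// gt_eqF.
rewrite /b powRM ?invr_ge0 ?(ltW V0) ?(ltW S0)//.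
have -> : (W * (2 `^ (p - 1) * (S `^ (q - 1) * V^-1 `^ (q - 1) * V `^ (p - 1))) =
   2 `^ (p - 1) * ((W * S `^ (q - 1)) * (V^-1 `^ (q - 1) * V `^ (p - 1))))%R by ring.
rewrite -[leRHS]mulrA; apply: ler_wpM2l; first exact: powR_ge0.
apply: (@le_trans _ _ (K * V `^ q * (V^-1 `^ (q - 1) * V `^ (p - 1)))%R).
  by apply: ler_wpM2r => //; rewrite mulr_ge0 ?powR_ge0.
rewrite -[leLHS]mulrA; apply: ler_wpM2l; first exact: ltW.
have VD (u v : R) : (V `^ (u + v) = V `^ u * V `^ v)%R.
  by rewrite powRD//; apply/implyP => _; rewrite gt_eqF.
rewrite -(powR_inv1 (ltW V0)) -powRrM mulN1r -!VD le_eqVlt; apply/orP; left; apply/eqP.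
by congr (_ `^ _)%R; ring.
Qed.

(** A weight of class A_q vanishes only on a null set, since its integral over
a large ball is positive while the dual average is finite; it may be replaced
by an everywhere positive one. *)
Lemma muckenhoupt_Aq_weight (q : R) (w : X -> R) : (1 < q)%R -> muckenhoupt mu q w ->
  exists2 w' : X -> R, {ae mu, forall x, w' x = w x} &
    exists2 K, (0 < K)%R & Aq_weight q K w'.
Proof.
move=> q1 [[mw w0 wint wnz] hM].
have q0 : (0 < q - 1)%R by rewrite subr_gt0.
have qi0 : (0 < (q - 1)^-1)%R by rewrite invr_gt0.
pose iv y := ((w y `^ (q - 1)^-1)%:E)^-1.
have iv0 y : 0 <= iv y by rewrite inve_ge0 lee_fin powR_ge0.
have miv : measurable_fun setT iv.
  rewrite (_ : iv = fun y => if w y == 0%R then +oo else (w y `^ (- (q - 1)^-1))%:E); last first.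
    apply/funext => y; rewrite /iv inver powR_eq0 (gt_eqF qi0) /= andbT.
    by case: ifPn => // _; rewrite powRN.
  apply: measurable_fun_ifT => //.
    rewrite (_ : (fun x => _) = (fun x => w x == cst 0%R x)) //.
    exact: measurable_fun_eqr.
  by apply/measurable_EFinP; exact: measurable_powR_fun.
have mwE D : measurable_fun D (EFin \o w) by apply: measurable_funT; exact/measurable_EFinP.
have [M M0 hMM] : exists2 M, (0 < M)%R & forall x r, (0 < r)%R ->
    avg mu x r (EFin \o w) * avg mu x r iv `^ (q - 1) <= M%:E.
  have [c cM] : exists c, muckenhoupt_const mu q w <= c%:E.
    move: hM; case: (muckenhoupt_const mu q w) => [c _|//|_]; first by exists c.
    by exists 0%R; rewrite leNye.
  exists (Num.max 1 c)%R; first by rewrite lt_max ltr01.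
  move=> x r r0; apply: (@le_trans _ _ c%:E); last by rewrite lee_fin le_max lexx orbT.
  by apply: le_trans cM; apply: ereal_sup_ubound; exists x, r.
have wpos_fin x r : (0 < r)%R -> 0 < \int[mu]_(y in ball x r) (w y)%:E ->
    \int[mu]_(y in ball x r) iv y < +oo.
  move=> r0 Wpos; have V0 := fine_ball_gt0 hmu x r0.
  rewrite ltNge; apply/negP; rewrite leye_eq => /eqP ie.
  have := hMM x r r0; rewrite !avg_mean// /mean ie gt0_muley ?lte_fin ?invr_gt0//.
  rewrite poweRyr ?gt_eqF// gt0_muley//.
  by rewrite mule_gt0// lte_fin invr_gt0.
have [x0 _] : exists x0 : X, True.
  apply: contrapT => h; apply: wnz; exists set0; split => // x _.
  by exfalso; apply: h; exists x.
pose N := [set x | w x = 0%R].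
have mN : measurable N.
  rewrite (_ : N = w @^-1` [set 0%R]); last by [].
  by rewrite -[X in measurable X]setTI; exact: mw.
have Nball x r : (0 < r)%R -> \int[mu]_(y in ball x r) iv y < +oo -> mu (ball x r `&` N) = 0.
  move=> r0 ify; apply/eqP; rewrite eq_le measure_ge0 andbT leNgt; apply/negP => Np.
  move: ify; rewrite ltNge leye_eq => /negP; apply; rewrite -leye_eq.
  apply: (@le_trans _ _ (\int[mu]_(y in ball x r `&` N) cst +oo y)).
    by rewrite integral_cst//=; [rewrite gt0_mulye|exact: measurableI].
  apply: (@le_trans _ _ (\int[mu]_(y in ball x r `&` N) iv y)).
    apply: ge0_integral_mono => y [_ /= wy]; rewrite ?leey// /iv wy powR0 ?gt_eqF//.
    by rewrite inve0.
  apply: ge0_subset_integral => //; first exact: measurableI.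
  exact: measurable_funT.
have [n0 Wn0] : exists n0 : nat, 0 < \int[mu]_(y in ball x0 n0.+1%:R) (w y)%:E.
  apply: contrapT => h; apply: wnz.
  have zn n : \int[mu]_(y in ball x0 n.+1%:R) (w y)%:E = 0.
    apply/eqP; rewrite eq_le; apply/andP; split.
      by rewrite leNgt; apply/negP => hn; apply: h; exists n.
    by apply: integral_ge0 => y _; rewrite lee_fin.
  pose P n := [set y | ball x0 n.+1%:R y /\ w y != 0%R].
  have nP n : mu.-negligible (P n).
    have : \int[mu]_(y in ball x0 n.+1%:R) `|(EFin \o w) y| = 0.
      rewrite -[RHS](zn n); apply: eq_integral => y _ /=; by rewrite ger0_norm.
    move/(ae_eq_integral_abs mu (measurable_mball _ _) (mwE _)).
    apply: negligibleS => y [xy wy] /= h1; move: wy; apply/negP/negPn.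
    by have [] := h1 xy => ->.
  have := negligible_bigcup nP; apply: negligibleS => y /= wy.
  exists (Num.trunc (mdist x0 y)) => //; split; last exact/eqP.
  by rewrite mballE truncnS_gt.
have muN : mu N = 0.
  have cov : N `<=` \bigcup_n (ball x0 (n + n0).+1%:R `&` N).
    move=> y Ny; exists (Num.trunc (mdist x0 y)) => //; split => //.
    by rewrite mballE; apply: lt_le_trans (truncnS_gt _) _; rewrite ler_nat ltnS leq_addr.
  have nB n : mu.-negligible (ball x0 (n + n0).+1%:R `&` N).
    exists (ball x0 (n + n0).+1%:R `&` N); split => //; first exact: measurableI.
    apply: Nball; rewrite ?ltr0n//; apply: wpos_fin; rewrite ?ltr0n//.
    apply: lt_le_trans Wn0 _; apply: ge0_subset_integral => //.
    - by move=> y _; rewrite lee_fin.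
    - by apply: le_ball; rewrite ler_nat ltnS leq_addl.
  by apply/measure_negligible => //; apply: negligibleS cov (negligible_bigcup nB).
pose w' x := if w x == 0%R then 1%R else w x.
have w'p x : (0 < w' x)%R.
  by rewrite /w'; case: ifPn => // h; rewrite lt_neqAle eq_sym h w0.
have w'N x : ~ N x -> w' x = w x by rewrite /w'; case: eqP.
have mw' : measurable_fun setT w'.
  apply: measurable_fun_ifT => //.
  rewrite (_ : (fun x => _) = (fun x => w x == cst 0%R x)) //.
  exact: measurable_fun_eqr.
have ae' : {ae mu, forall x, w' x = w x}.
  by exists N; split => // x /= h; apply: contrapT => /w'N.
exists w' => //; exists M => //; split => // x r r0.
have B0 : 0 < mu (ball x r) by exact: doubling_gt0.
have V0 := fine_ball_gt0 hmu x r0.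
have eW : \int[mu]_(y in ball x r) (w' y)%:E = \int[mu]_(y in ball x r) (w y)%:E.
  apply: ge0_ae_eq_integral => //.
  - by apply: measurable_funT; exact/measurable_EFinP.
  - by move=> y _; rewrite lee_fin ltW.
  - by move=> y _; rewrite lee_fin.
  - by apply: filterS ae' => y e _; rewrite e.
have eS : \int[mu]_(y in ball x r) (w' y `^ (- (q - 1)^-1))%:E = \int[mu]_(y in ball x r) iv y.
  apply: ge0_ae_eq_integral => //.
  - by apply: measurable_funT; apply/measurable_EFinP; exact: measurable_powR_fun.
  - exact: measurable_funT.
  - by move=> y _; rewrite lee_fin powR_ge0.
  - apply: filterS ae' => y e _; rewrite /iv -e inver gt_eqF ?powR_gt0//.
    by rewrite powRN.
have Wp : 0 < \int[mu]_(y in ball x r) (w y)%:E.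
  by rewrite -eW; exact: (wmeasure_gt0 mw' (fun y => ltW (w'p y)) (measurable_mball x r) B0 w'p).
have Wf : \int[mu]_(y in ball x r) (w y)%:E \is a fin_num.
  rewrite ge0_fin_numE; last exact: ltW.
  have /integrableP[_] := wint x r r0; congr (_ < _).
  by apply: eq_integral => y _ /=; rewrite ger0_norm.
have Sf : \int[mu]_(y in ball x r) iv y \is a fin_num.
  rewrite ge0_fin_numE; last exact: integral_ge0.
  exact: wpos_fin.
exists (fine (\int[mu]_(y in ball x r) (w y)%:E)), (fine (\int[mu]_(y in ball x r) iv y)).
rewrite eW eS !fineK//; split => //.
have := hMM x r r0; rewrite !avg_mean// /mean -(fineK Wf) -(fineK Sf).
have S0 : (0 <= fine (\int[mu]_(y in ball x r) iv y))%R by rewrite fine_ge0// integral_ge0.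
set W := fine (\int[mu]_(y in ball x r) (w y)%:E); set S := fine _ in S0 *; set V := fine _ in V0 *.
rewrite -(EFinM V^-1 S) poweR_EFin -!EFinM lee_fin /= powRM ?invr_ge0 ?(ltW V0)//.
have -> : (V^-1 `^ (q - 1) = V / V `^ q)%R.
  rewrite -(powR_inv1 (ltW V0)) -powRrM mulN1r opprB powRB ?powRr1 ?(ltW V0)//.
  by apply/implyP => _; rewrite gt_eqF.
have Vq : (0 < V `^ q)%R by exact: powR_gt0.
rewrite (_ : V^-1 * W * (V / V `^ q * S `^ (q - 1)) = W * S `^ (q - 1) / V `^ q)%R; last first.
  by field; rewrite !gt_eqF.
by rewrite ler_pdivrMr.
Qed.

End Muckenhoupt.

(** * Borel regularity and differentiation *)

Section Regularity.
Local Open Scope ereal_scope.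
Context {R : realType} {d : measure_display} {X : borelMetricType R d}.

Lemma vanishing_measure (m : {measure set X -> \bar R}) (D : nat -> set X) (e : R) :
  (forall n, measurable (D n)) -> m (D 0%N) < +oo ->
  (forall n, D n.+1 `<=` D n) -> \bigcap_n D n = set0 -> (0 < e)%R ->
  exists n, m (D n) < e%:E.
Proof.
move=> mD D0 decD capD e0.
have ni : nonincreasing_seq D by apply/nonincreasing_seqP => n; exact/subsetPset.
have mcap : measurable (\bigcap_n D n) by rewrite capD.
have := nonincreasing_cvg_mu D0 mD mcap ni; rewrite capD measure0.
move/fine_cvgP => [[n1 _ fin]] /cvgrPdist_lt/(_ e e0)[n2 _ h].
pose n := maxn n1 n2; exists n.
have := h n (leq_maxr _ _); have := fin n (leq_maxl _ _) => /= fn.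
rewrite sub0r normrN ger0_norm ?fine_ge0// => hn.
by rewrite -(fineK fn) lte_fin.
Qed.

(** Around a point at a large distance from [x0] there is a ball which is far from
[x0], but whose measure is comparable to that of [ball x0 1]; if the measure is
finite this cannot occur at arbitrary distances. *)
Lemma finite_measure_ball (mu : {measure set X -> \bar R}) (x0 : X) : doubling mu ->
  mu setT < +oo -> exists2 r, (0 < r)%R & ball x0 r = setT.
Proof.
move=> hmu fin; apply: contrapT => nob.
have [C C1 hC] := doubling_engulf hmu (ltr0Sn R 3).
have C0 : (0 < C)%R by exact: lt_le_trans C1.
have V0 := fine_ball_gt0 hmu x0 ltr01.
have e0 : (0 < fine (mu (ball x0 1)) / C)%R by rewrite divr_gt0.
have [||||n] := @vanishing_measure mu (fun n => ~` ball x0 n.+1%:R) _ _ _ _ _ e0.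
- by move=> n; exact: measurableC.
- by apply: le_lt_trans fin; apply: le_measure; rewrite ?inE//; exact: measurableC.
- by move=> n; apply: subsetC; apply: le_ball; rewrite ler_nat.
- rewrite -subset0 => y h; have := h (Num.trunc (mdist x0 y)) I; apply.
  by rewrite mballE truncnS_gt.
rewrite ltNge => /negP; apply.
have [z nz] : exists z, ~ ball x0 (2 * n.+1%:R) z.
  apply: contrapT => h; apply: nob; exists (2 * n.+1%:R)%R; first by rewrite mulr_gt0.
  by apply/seteqP; split => // z _; apply: contrapT => hz; apply: h; exists z.
move: nz; rewrite mballE => /negP; rewrite -leNgt => nz.
set D := mdist x0 z in nz.
have n1 : (1 <= n.+1%:R :> R)%R by rewrite ler1n.
have D20 : (0 < D / 2)%R by lra.
rewrite EFinM muleC lee_pdivrMl// fineK ?doubling_fin//.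
apply: (@le_trans _ _ (mu (ball x0 (4 * (D / 2))))).
  by apply: le_measure; rewrite ?inE//; apply: le_ball; lra.
apply: le_trans (hC z x0 _ D20 _) _; first by rewrite metric_sym -/D; lra.
apply: lee_wpmul2l; first by rewrite lee_fin ltW.
apply: le_measure; rewrite ?inE//; first exact: measurableC.
move=> y; rewrite mballE => zy; rewrite /= mballE => xy.
have := metric_triangle x0 y z; rewrite (metric_sym y z) -/D; lra.
Qed.

(** Approximation by closed sets from inside and open sets from outside: the
sets with this property form a sigma-algebra, which contains the open sets
because they are increasing unions of closed sets. *)
Lemma closed_open_approx (m : {measure set X -> \bar R}) (A : set X) (e : R) :
  m setT < +oo -> measurable A -> (0 < e)%R ->
  exists F U, [/\ closed F, open U, F `<=` A, A `<=` U & m (U `\` F) < e%:E].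
Proof.
move=> mfin; pose good := [set A : set X | forall e, (0 < e)%R ->
  exists F U, [/\ closed F, open U, F `<=` A, A `<=` U & m (U `\` F) < e%:E]].
suff : measurable `<=` good by move=> h mA e0; exact: (h A mA e e0).
have mFU F U : closed F -> open U -> measurable (U `\` F).
  move=> cF oU; apply: measurableD; first exact: measurable_open.
  rewrite -[F]setCK; apply: measurableC; apply: measurable_open.
  exact: closed_openC.
have fin B : measurable B -> m B < +oo.
  by move=> mB; apply: le_lt_trans mfin; apply: le_measure; rewrite ?inE.
rewrite measurable_borel; apply: smallest_sub; last first.
  move=> U oU e0 e00.
  pose F n := [set x | ball x n.+1%:R^-1 `<=` U].
  have FU n : F n `<=` U by move=> x; apply; apply: ball_ctr; rewrite invr_gt0.
  have cF n : closed (F n).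
    rewrite -[F n]setCK; apply: open_closedC; rewrite openE => x /= /existsNP[z /not_implyP[xz nUz]].
    move: xz; rewrite mballE => xz; rewrite /interior -nbhs_ballE.
    exists (n.+1%:R^-1 - mdist x z)%R; first by rewrite /= subr_gt0.
    move=> y; rewrite mballE => xy /= h; apply: nUz; apply: h; rewrite mballE.
    have := metric_triangle y x z; rewrite (metric_sym y x).
    by move: xy; set t := _^-1%R; lra.
  have [||||n hn] := @vanishing_measure m (fun n => U `\` F n) _ _ _ _ _ e00.
  - by move=> n; exact: mFU.
  - by apply: fin; exact: mFU.
  - move=> n; apply: setDS => x hx; apply: subset_trans hx; apply: le_ball.
    by rewrite lef_pV2 ?posrE// ler_nat.
  - rewrite -subset0 => x h; have [Ux _] := h 0%N I.
    have [r r0 hr] := openP_ball oU Ux.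
    have [_] := h (Num.trunc r^-1) I; apply; apply: subset_trans hr; apply: le_ball.
    by rewrite invf_ple ?posrE// ltW// truncnS_gt.
  - by exists (F n), U; split.
split.
- move=> e0 e00; exists set0, set0; split => //; [exact: closed0|exact: open0|].
  by rewrite setD0 measure0 lte_fin.
- move=> B gB e0 e00; have [F [U [cF oU FB BU h]]] := gB e0 e00.
  exists (~` U), (~` F); rewrite setTD; split.
  + exact: open_closedC.
  + exact: closed_openC.
  + exact: subsetC.
  + exact: subsetC.
  + by rewrite setDE setCK setIC -setDE.
move=> B gB e0 e00.
have chB n : exists FU : set X * set X, [/\ closed FU.1, open FU.2, FU.1 `<=` B n,
    B n `<=` FU.2 & m (FU.2 `\` FU.1) < (2^-1 ^+ n * (e0 / 8))%:E].
  have en : (0 < 2^-1 ^+ n * (e0 / 8))%R by rewrite mulr_gt0 ?exprn_gt0 ?divr_gt0.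
  by have [F [U h]] := gB n _ en; exists (F, U).
have [FU hFU] := choice chB.
pose F n := (FU n).1; pose U := \bigcup_n (FU n).2.
have cF n : closed (F n) by have [] := hFU n.
have oU : open U by apply: bigcup_open => n _; have [] := hFU n.
have mU := measurable_open oU.
pose G N := \big[setU/set0]_(n < N) F n.
have cG N : closed (G N).
  by rewrite /G; elim/big_ind: _ => [|S1 S2|n _]; [exact: closed0|exact: closedU|exact: cF].
have mF n : measurable (F n).
  rewrite -[F n]setCK; apply: measurableC; apply: measurable_open; exact: closed_openC.
have mUF : measurable (\bigcup_n F n) by exact: bigcup_measurable.
pose Z := U `\` \bigcup_n F n; have mZ : measurable Z by exact: measurableD.
have Zle : m Z <= (e0 / 4)%:E.
  apply: (@le_trans _ _ (\sum_(n <oo) m ((FU n).2 `\` F n))).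
    apply: measure_sigma_subadditive => //.
    + by move=> n; have [? ? _ _ _] := hFU n; exact: mFU.
    + move=> x [[n _ Ux] nF]; exists n => //; split => // Fx; apply: nF; by exists n.
  apply: (@le_trans _ _ (\sum_(n <oo) (2^-1 ^+ n)%:E * (e0 / 8)%:E)).
    apply: lee_nneseries => // n _; rewrite -EFinM; apply: ltW.
    by have [] := hFU n.
  have e80 : (0 <= e0 / 8)%R by rewrite divr_ge0// ltW.
  apply: le_trans (series_half_le (s := (e0 / 8)%:E) _ _) _ => //.
  by rewrite -EFinM lee_fin; lra.
have mG N : measurable (G N) by apply: bigsetU_measurable.
have e20 : (0 < e0 / 2)%R by rewrite divr_gt0.
have mUG N : measurable (U `\` G N) by exact: measurableD.
have [||||N hN] := @vanishing_measure m (fun N => (U `\` G N) `\` Z) _ _ _ _ _ e20.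
- by move=> N; exact: measurableD.
- by apply: fin; exact: measurableD.
- move=> N; apply: setSD; apply: setDS; rewrite /G big_ord_recr /=; exact: subsetUl.
- rewrite -subset0 => x h; have [[Ux _] nZ] := h 0%N I; apply: nZ; split => // -[n _ Fx].
  have [[_ nG] _] := h n.+1 I; apply: nG; rewrite /G big_ord_recr /=; by right.
exists (G N), U; split => //.
- move=> x; rewrite /G -bigcup_mkord => -[n _ Fx]; exists n => //.
  by have [_ _ h _ _] := hFU n; exact: h.
- move=> x [n _ Bx]; exists n => //; by have [_ _ _ h _] := hFU n; exact: h.
have ZN : U `\` G N `<=` Z `|` ((U `\` G N) `\` Z).
  by move=> x hx; have [Zx|nZ] := pselect (Z x); [left|right].
have mdz : measurable ((U `\` G N) `\` Z) by exact: measurableD.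
apply: (@le_lt_trans _ _ (m Z + m ((U `\` G N) `\` Z))).
  by apply: le_trans (measureU2 m mZ mdz); apply: le_measure; rewrite ?inE//; exact: measurableU.
apply: le_lt_trans (leeD Zle (ltW hN)) _.
by rewrite -EFinD lte_fin; lra.
Qed.

Variable mu : {measure set X -> \bar R}.
Hypothesis hmu : doubling mu.

Lemma outer_regular (A : set X) x r (e : R) : measurable A -> A `<=` ball x r ->
  (0 < e)%R -> exists U, [/\ open U, A `<=` U & mu (U `\` A) < e%:E].
Proof.
move=> mA Ar e0; have mB := measurable_mball x r.
have fin : mrestr mu mB setT < +oo by rewrite /mrestr setTI doubling_lty.
have [F [U [cF oU FA AU h]]] := closed_open_approx fin mA e0.
exists (U `&` ball x r); split; first by apply: openI => //; exact: open_mball.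
  by move=> y Ay; split; [exact: AU|exact: Ar].
have mF : measurable F by rewrite -[F]setCK; apply: measurableC; apply: measurable_open; exact: closed_openC.
have mU := measurable_open oU.
apply: le_lt_trans h; rewrite /= /mrestr; apply: le_measure; rewrite ?inE//.
- by apply: measurableD => //; exact: measurableI.
- by apply: measurableI => //; exact: measurableD.
- by move=> y [[Uy ry] nA]; split => //; split => // /FA.
Qed.

(** A weak form of Lebesgue's differentiation theorem, sufficient for norm
estimates. Where [h] exceeds twice its maximal function, at most half of every
ball lies in this exceptional set, and so the set is covered by balls that are
half outside of it; by regularity it is null. *)
Lemma le_2hlmax (h : X -> \bar R) : measurable_fun setT h -> (forall x, 0 <= h x) ->
  {ae mu, forall x, h x <= 2%:E * hlmax mu h x}.
Proof.
move=> mh h0.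
have mM : measurable_fun setT (fun x => 2%:E * hlmax mu h x).
  by apply: measurable_funeM; exact: measurable_hlmax.
have [[x0 _]|noX] := pselect (exists x : X, True); last first.
  by exists set0; split => // x _; exfalso; apply: noX; exists x.
pose E := [set x | 2%:E * hlmax mu h x < h x].
have mE : measurable E by rewrite -[E]setTI; exact: emeasurable_fun_lt.
have [C C1 hC] := doubling_engulf hmu (ltr0Sn R 2).
have C0 : (0 < C)%R by exact: lt_le_trans C1.
have half y r : (0 < r)%R -> E y -> mu (ball y r `&` E) <= 2^-1%:E * mu (ball y r).
  move=> r0 Ey; have V0 := fine_ball_gt0 hmu y r0; have Vfin := doubling_fin hmu y r.
  have mBE : measurable (ball y r `&` E) by exact: measurableI.
  set I := \int[mu]_(z in ball y r) h z.
  have I0 : 0 <= I by exact: integral_ge0.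
  have My : hlmax mu h y \is a fin_num.
    rewrite ge0_fin_numE ?hlmax_ge0// ltNge leye_eq; apply/negP => /eqP e.
    by move: Ey; rewrite /E /= e gt0_muley ?lte_fin// ltNge leey.
  have Ifin : I \is a fin_num.
    rewrite ge0_fin_numE//; apply: le_lt_trans (integral_ball_le hmu h r0 (ball_ctr y r0)) _.
    by rewrite -(fineK Vfin) -(fineK My) -EFinM ltry.
  have [Iz|Inz] := eqVneq I 0.
    suff -> : mu (ball y r `&` E) = 0 by rewrite mule_ge0.
    have : \int[mu]_(z in ball y r) `|h z| = 0.
      by rewrite -[RHS]Iz; apply: eq_integral => z _; rewrite gee0_abs.
    move/(ae_eq_integral_abs mu (measurable_mball _ _) (measurable_funT mh)) => [N [mN N0 hN]].
    apply/eqP; rewrite eq_le measure_ge0 andbT -N0; apply: le_measure; rewrite ?inE// => z [yz Ez].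
    apply: hN => /= hz; have hz0 := hz yz; move: Ez; rewrite /E /= hz0 ltNge => /negP; apply.
    by rewrite mule_ge0 ?hlmax_ge0.
  have {Inz}Ipos : 0 < I by rewrite lt_neqAle eq_sym Inz.
  have : (2 * (fine I / fine (mu (ball y r))))%:E * mu (ball y r `&` E) <= I.
    rewrite -integral_cst//; apply: (@le_trans _ _ (\int[mu]_(z in ball y r `&` E) h z)).
      apply: ge0_integral_mono => z [yz Ez].
        by rewrite lee_fin mulr_ge0// divr_ge0 ?fine_ge0.
      apply: le_trans (ltW Ez); rewrite EFinM; apply: lee_wpmul2l => //.
      apply: le_trans (mean_le_hlmax mu h r0 yz).
      by rewrite /mean -/I -[X in _ <= _ * X](fineK Ifin) -EFinM mulrC.
    by apply: ge0_subset_integral => //; exact: measurable_funT.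
  have Bf : mu (ball y r `&` E) \is a fin_num.
    by apply: (fin_measure_sub mBE (measurable_mball y r)) => //; exact: doubling_lty.
  move: Ipos; rewrite -(fineK Ifin) -(fineK Bf) -(fineK Vfin) -!EFinM lte_fin !lee_fin /=.
  set i := fine I; set b := fine (mu (_ `&` _)); set v := fine _ in V0 *.
  move=> i0; rewrite mulrA mulrAC ler_pdivrMr// => h1.
  rewrite -(ler_pM2l i0); lra.
have En n : mu (E `&` ball x0 n.+1%:R) = 0.
  set A := E `&` _; have mA : measurable A by exact: measurableI.
  apply/eqP; rewrite eq_le measure_ge0 andbT; apply/lee_addgt0Pr => e e0; rewrite add0e.
  have e'0 : (0 < e / (2 * C))%R by rewrite divr_gt0// mulr_gt0.
  have [U [oU AU hU]] := outer_regular mA (@subIsetr _ _ _) e'0.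
  have mU := measurable_open oU.
  apply: (@le_trans _ _ ((2 * C)%:E * mu (U `\` A))).
    apply: (covering_le hmu) => //; [by rewrite mulr_ge0// ltW|exact: measurableD|].
    move=> y Ay; have [r r0 hr] := openP_ball oU (AU _ Ay); exists r => //.
    rewrite setIDA setIidl//.
    have yy : (mdist y y <= 3 * r)%R by rewrite mdistxx mulr_ge0// ltW.
    apply: le_trans (hC y y r r0 yy) _; rewrite mulrC EFinM -muleA; apply: lee_wpmul2l.
      by rewrite lee_fin ltW.
    have hh := half y r r0 Ay.1; have Vfin := doubling_fin hmu y r.
    have mI : measurable (ball y r `&` A) by exact: measurableI.
    have mD : measurable (ball y r `\` A) by exact: measurableD.
    have e1 : mu (ball y r) = mu (ball y r `&` A) + mu (ball y r `\` A).
      by rewrite -measureU// ?setUIDK// -subset0 => u [[_ Au] [_ nA]].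
    have le1 : mu (ball y r `&` A) <= 2^-1%:E * mu (ball y r).
      apply: le_trans hh; apply: le_measure; rewrite ?inE//; first exact: measurableI.
      by apply: setIS; exact: subIsetl.
    have If : mu (ball y r `&` A) \is a fin_num.
      by apply: (fin_measure_sub mI (measurable_mball y r)) => //; exact: doubling_lty.
    have Df : mu (ball y r `\` A) \is a fin_num.
      by apply: (fin_measure_sub mD (measurable_mball y r)) => //; exact: doubling_lty.
    move: e1 le1; rewrite -(fineK Vfin) -(fineK If) -(fineK Df) -EFinD -!EFinM !lee_fin.
    by move=> -[->]; lra.
  apply: le_trans (lee_wpmul2l _ (ltW hU)) _; first by rewrite lee_fin mulr_ge0// ltW.
  by rewrite -EFinM lee_fin mulrC divfK// gt_eqF// mulr_gt0.
exists E; split => //; last by move=> x /= /negP; rewrite -ltNge.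
apply/measure_negligible => //.
have cov : E `<=` \bigcup_n (E `&` ball x0 n.+1%:R).
  move=> y Ey; exists (Num.trunc (mdist x0 y)) => //; split => //.
  by rewrite mballE truncnS_gt.
apply: negligibleS cov _; apply: negligible_bigcup => n.
by exists (E `&` ball x0 n.+1%:R); split => //; exact: measurableI.
Qed.

End Regularity.

(** * Integrals of complex functions *)

Section ComplexIntegrals.
Context d (T : measurableType d) (R : realType).
Variable mu : {measure set T -> \bar R}.
Implicit Types (f g : T -> R[i]).
Import ComplexField.Normc.

Lemma normc_ge0 (z : R[i]) : 0 <= normc z.
Proof. by case: z => x y; rewrite /normc sqrtr_ge0. Qed.

Lemma normc_sqrtE (z : R[i]) : normc z = Num.sqrt (complex.Re z ^+ 2 + complex.Im z ^+ 2).
Proof. by case: z. Qed.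

Lemma normRe_le (z : R[i]) : `|complex.Re z| <= normc z.
Proof.
by rewrite normc_sqrtE -sqrtr_sqr ler_wsqrtr// lerDl sqr_ge0.
Qed.

Lemma normIm_le (z : R[i]) : `|complex.Im z| <= normc z.
Proof.
by rewrite normc_sqrtE -sqrtr_sqr ler_wsqrtr// lerDr sqr_ge0.
Qed.

Lemma normc_leD (z : R[i]) : normc z <= `|complex.Re z| + `|complex.Im z|.
Proof.
rewrite normc_sqrtE -[leRHS]ger0_norm ?addr_ge0// -sqrtr_sqr ler_wsqrtr//.
by rewrite sqrrD !real_normK ?num_real// -addrA lerD2l lerDr mulrn_wge0// mulr_ge0.
Qed.

Lemma measurable_normc f : cmeasurable f -> measurable_fun setT (fun x => normc (f x)).
Proof.
move=> [mr mi]; rewrite (_ : (fun _ => _) = (fun x =>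
    (complex.Re (f x) ^+ 2 + complex.Im (f x) ^+ 2) `^ 2^-1)); last first.
  by apply/funext => x; rewrite normc_sqrtE powR12_sqrt// addr_ge0// sqr_ge0.
apply: (measurableT_comp (measurable_powR 2^-1)).
by apply: measurable_funD; exact: measurable_funX.
Qed.

Lemma cmeasurableM f g : cmeasurable f -> cmeasurable g -> cmeasurable (fun x => f x * g x).
Proof.
move=> [fr fi] [gr gi]; split.
  rewrite (_ : (fun _ => _) = (fun x => complex.Re (f x) * complex.Re (g x) -
     complex.Im (f x) * complex.Im (g x))).
    by apply: measurable_funB; exact: measurable_funM.
  by apply/funext => x; case: (f x) => ? ?; case: (g x).
rewrite (_ : (fun _ => _) = (fun x => complex.Re (f x) * complex.Im (g x) +
   complex.Im (f x) * complex.Re (g x))).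
  by apply: measurable_funD; exact: measurable_funM.
by apply/funext => x; case: (f x) => ? ?; case: (g x).
Qed.

Lemma cmeasurable_conj f : cmeasurable f -> cmeasurable (fun x => conjc (f x)).
Proof.
move=> [fr fi]; split.
  by rewrite (_ : (fun _ => _) = (fun x => complex.Re (f x)))//; apply/funext => x; case: (f x).
rewrite (_ : (fun _ => _) = (fun x => - complex.Im (f x))).
  exact: measurable_funN.
by apply/funext => x; case: (f x).
Qed.

Lemma normc_conj (z : R[i]) : normc (conjc z) = normc z.
Proof. by case: z => x y; rewrite /normc /= sqrrN. Qed.

Lemma normc_cintegral_le f : cmeasurable f ->
  ((normc (cintegral mu f))%:E <= 2%:E * \int[mu]_x (normc (f x))%:E)%E.
Proof.
move=> [fr fi].
have part (h : T -> R) : measurable_fun setT h -> (forall x, `|h x| <= normc (f x)) ->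
    ((`|\int[mu]_x (h x)|)%:E <= \int[mu]_x (normc (f x))%:E)%E.
  move=> mh hf; apply: (@le_trans _ _ (`|\int[mu]_x (h x)%:E|)%E).
    by rewrite /Rintegral; case: (\int[mu]_x (h x)%:E)%E => [r| |] //=; rewrite normr0 leey.
  apply: le_trans (le_abse_integral _ _ _) _ => //; first exact/measurable_EFinP.
  by apply: ge0_integral_mono => x _; rewrite ?lee_fin//= lee_fin.
apply: (@le_trans _ _ ((`|\int[mu]_x complex.Re (f x)|)%:E + (`|\int[mu]_x complex.Im (f x)|)%:E)%E).
  by rewrite -EFinD lee_fin; exact: normc_leD.
have I0 : (0 <= \int[mu]_x (normc (f x))%:E)%E.
  by apply: integral_ge0 => x _; rewrite lee_fin normc_ge0.
have -> : (2%:E * \int[mu]_x (normc (f x))%:E = \int[mu]_x (normc (f x))%:E +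
    \int[mu]_x (normc (f x))%:E)%E.
  by rewrite (_ : 2%:E = 1%:E + 1%:E)%E ?ge0_muleDl ?mul1e// -EFinD.
by apply: leeD; apply: part => // x; [exact: normRe_le|exact: normIm_le].
Qed.

End ComplexIntegrals.

(** * Operators with rapidly decaying kernels *)

Section Kernels.
Local Open Scope ereal_scope.
Context {R : realType} {d : measure_display} {X : borelMetricType R d}.
Variable mu : {measure set X -> \bar R}.
Hypothesis hmu : doubling mu.
Import ComplexField.Normc.

(** Decay of the kernel at scale [r] on dyadic annuli. Unlike the Gaussian
bound, it is insensitive to exchanging the two variables. *)
Definition dyadic_decay (D m : R) (a : R -> X -> X -> R[i]) : Prop :=
  forall r y z n, (0 < r)%R -> (mdist y z < 2 ^+ n * r)%R ->
    (n = 0%N \/ 2 ^+ n.-1 * r <= mdist y z)%R ->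
    (normc (a (r `^ m) y z) * fine (mu (ball y (2 ^+ n.+1 * r))) <= D * 2^-1 ^+ n)%R.

(** At the scale [r], the exponential decay in the dyadic radii exceeds the
growth of the measures of the balls, which is polynomial in the radius. *)
Lemma kernel_dyadic_decay (m : R) (a : R -> X -> X -> R[i]) : (2 <= m)%R ->
  kernel_family mu m a -> exists2 D, (0 < D)%R & dyadic_decay D m a.
Proof.
move=> m2 [_ [C [c [C0 c0 bound]]] _].
have [Cd Cd1 hCd] := doubling_pow hmu.
have Cd0 : (0 < Cd)%R by exact: lt_le_trans Cd1.
have [N hN] : exists N, (2 * Cd <= 2 ^+ N.+1)%R.
  have [N hN] := level_unbounded ltr01 (ltr1n R 2) (2 * Cd)%R.
  exists N; apply: (le_trans (ltW hN)); rewrite /level mul1r exprS ler_peMl// ?exprn_ge0// ler1n//.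
pose B := (2 ^+ N.+1 * N.+1`!%:R / c ^+ N.+1)%R.
have cN : (0 < c ^+ N.+1)%R by exact: exprn_gt0.
have B0 : (0 <= B)%R by rewrite divr_ge0// ?ltW// mulr_ge0// exprn_ge0.
have CC : (0 < C * Cd)%R by rewrite mulr_gt0.
exists (C * Cd * (1 + B))%R.
  by rewrite mulr_gt0//; lra.
move=> r y z n r0 yz hn.
have m0 : (0 < m)%R by lra.
have m10 : (0 < m - 1)%R by lra.
have tr : (0 < r `^ m)%R by exact: powR_gt0.
have V0 := fine_ball_gt0 hmu y r0; have Vfin := doubling_fin hmu y r.
have rm : ((r `^ m) `^ m^-1 = r)%R by rewrite -powRrM mulfV ?gt_eqF// powRr1// ltW.
have := bound _ y z tr; rewrite rm /vol; set V := fine _ in V0 *.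
set u := (mdist y z `^ _ / _)%R => hb.
have {}hb : (normc (a (r `^ m) y z) * fine (mu (ball y (2 ^+ n.+1 * r))) <=
    C * Cd * (Cd ^+ n * expR (- (c * u))))%R.
  have VV : (fine (mu (ball y (2 ^+ n.+1 * r))) <= Cd ^+ n.+1 * V)%R.
    by have := hCd n.+1 y r r0; rewrite -(fineK Vfin) -(fineK (doubling_fin hmu y (2 ^+ n.+1 * r)%R)) -EFinM lee_fin.
  apply: (@le_trans _ _ (C / V * expR (- (c * u)) * (Cd ^+ n.+1 * V))%R).
    by apply: ler_pM => //; exact: normc_ge0.
  rewrite le_eqVlt; apply/orP; left; apply/eqP; rewrite exprS; field; by rewrite gt_eqF.
apply: le_trans hb _; rewrite -!mulrA; apply: ler_wpM2l; first exact: ltW.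
apply: ler_wpM2l; first exact: ltW.
case: n hn yz => [|n] hn yz.
  rewrite !expr0 mul1r mulr1; apply: (@le_trans _ _ 1%R); last by lra.
  rewrite -expR0 ler_expR oppr_le0 mulr_ge0 ?(ltW c0)// divr_ge0 ?powR_ge0//.
case: hn => [//|/= hn]; set t := (2 ^+ n : R)%R in hn *.
have t0 : (0 < t)%R by exact: exprn_gt0.
have t1 : (1 <= t)%R by rewrite exprn_ege1// ler1n.
have tu : (t <= u)%R.
  have -> : (u = (mdist y z / r) `^ (m / (m - 1)))%R.
    rewrite /u -powRrM powRM ?mdist_ge0 ?invr_ge0 ?(ltW r0)//.
    by rewrite -(powR_inv1 (ltW r0)) -powRrM mulN1r powRN.
  have tq : (t <= mdist y z / r)%R by rewrite ler_pdivlMr.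
  apply: (le_trans tq); apply: le1r_powR; first exact: le_trans tq.
  by rewrite ler_pdivlMr// mul1r; lra.
apply: (@le_trans _ _ (Cd ^+ n.+1 * expR (- (c * t)))%R).
  apply: ler_wpM2l; first by rewrite exprn_ge0// ltW.
  by rewrite ler_expR lerN2 ler_wpM2l// ltW.
have key : ((2 * Cd) ^+ n.+1 * expR (- (c * t)) <= B)%R.
  rewrite expRN ler_pdivrMr ?expR_gt0//.
  apply: (@le_trans _ _ (2 ^+ N.+1 * t ^+ N.+1)%R).
    have -> : (2 ^+ N.+1 * t ^+ N.+1 = (2 ^+ N.+1) ^+ n.+1 :> R)%R.
      by rewrite -exprMn /t -exprS -!exprM mulnC.
    by rewrite lerXn2r// nnegrE ?mulr_ge0 ?exprn_ge0// ltW.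
  rewrite /B -!mulrA; apply: ler_wpM2l; first by rewrite exprn_ge0.
  rewrite mulrA mulrAC ler_pdivlMr// -exprMn [(t * c)%R]mulrC.
  have ct : (0 <= c * t)%R by rewrite mulr_ge0// ltW.
  have := expR_ge1Dxn N ct => h.
  have fp : (0 < N.+1`!%:R :> R)%R by rewrite ltr0n fact_gt0.
  rewrite -ler_pdivrMl// [leLHS]mulrC; lra.
have p2 : (0 < 2^-1 ^+ n.+1 :> R)%R by rewrite exprn_gt0// invr_gt0.
have -> : (Cd ^+ n.+1 = 2^-1 ^+ n.+1 * (2 * Cd) ^+ n.+1)%R.
  by rewrite -exprMn mulrA mulVf ?mul1r.
rewrite -mulrA mulrC; apply: ler_wpM2r; first exact: ltW.
by apply: (le_trans key); lra.
Qed.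

Lemma adjoint_dyadic_decay (m D : R) (a : R -> X -> X -> R[i]) : (0 < D)%R ->
  dyadic_decay D m a -> exists2 D', (0 < D')%R & dyadic_decay D' m (adjoint_kernels a).
Proof.
move=> D0 ha; have [C C1 hC] := doubling_engulf hmu ltr01.
have C0 : (0 < C)%R by exact: lt_le_trans C1.
exists (C * D)%R; first exact: mulr_gt0.
move=> r y z n r0 yz hn; rewrite /adjoint_kernels normc_conj.
have zy : mdist z y = mdist y z by exact: metric_sym.
have h := ha r z y n r0; rewrite zy in h; have {}h := h yz hn.
have rn : (0 < 2 ^+ n.+1 * r)%R by rewrite mulr_gt0// exprn_gt0.
have := hC z y (2 ^+ n.+1 * r)%R rn; rewrite !mul1r zy => /(_ _)/wrap[].
  apply: ltW (lt_trans yz _); rewrite ltr_pM2r// exprS.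
  by have : (0 < 2 ^+ n :> R)%R by [rewrite exprn_gt0|]; lra.
rewrite -(fineK (doubling_fin hmu y _)) -(fineK (doubling_fin hmu z _)) -EFinM lee_fin => hV.
apply: (@le_trans _ _ (normc (a (r `^ m) z y) * (C * fine (mu (ball z (2 ^+ n.+1 * r)))))%R).
  by apply: ler_wpM2l hV; exact: normc_ge0.
by rewrite mulrCA -mulrA; apply: ler_wpM2l h; exact: ltW.
Qed.

Lemma kernel_le_series (D m : R) (a : R -> X -> X -> R[i]) r y z :
  (0 <= D)%R -> dyadic_decay D m a -> (0 < r)%R ->
  (normc (a (r `^ m) y z))%:E <= \sum_(n <oo) (2^-1 ^+ n)%:E *
    ((D / fine (mu (ball y (2 ^+ n.+1 * r))))%:E * (\1_(ball y (2 ^+ n.+1 * r)) z)%:E).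
Proof.
move=> D0 ha r0.
have ex : exists n, (mdist y z < 2 ^+ n * r)%R.
  have [n hn] := level_unbounded r0 (ltr1n R 2) (mdist y z).
  by exists n; rewrite mulrC.
have [n yn minn] := ex_minnP ex.
have rk k : (0 < 2 ^+ k * r)%R by rewrite mulr_gt0// exprn_gt0.
have V0 := fine_ball_gt0 hmu y (rk n.+1).
have term0 k : 0 <= (2^-1 ^+ k)%:E *
    ((D / fine (mu (ball y (2 ^+ k.+1 * r))))%:E * (\1_(ball y (2 ^+ k.+1 * r)) z)%:E).
  rewrite mule_ge0// ?mule_ge0// lee_fin// ?exprn_ge0 ?invr_ge0//.
  by rewrite divr_ge0// fine_ge0.
apply: le_trans (le_term_nneseries n term0).
have -> : (\1_(ball y (2 ^+ n.+1 * r)) z)%:E = 1 :> \bar R.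
  rewrite indicE mem_set// mballE; apply: lt_trans yn _; rewrite ltr_pM2r// exprS.
  by have : (0 < 2 ^+ n :> R)%R by [rewrite exprn_gt0|]; lra.
rewrite mule1 -EFinM lee_fin mulrA ler_pdivlMr// mulrC [(_ * D)%R]mulrC mulrC.
apply: ha => //; case: n yn minn {V0} => [|n] yn minn; [by left|right => /=].
by rewrite leNgt; apply/negP => /minn; rewrite ltnn.
Qed.

(** The averaged operators are controlled by the maximal function, uniformly
on balls whose radius is the scale. *)
Lemma integral_op_le_hlmax (D m : R) (a : R -> X -> X -> R[i]) (f : X -> R[i]) x r y z :
  (0 < D)%R -> dyadic_decay D m a -> (0 < r)%R ->
  (forall u, cmeasurable (a (r `^ m)%R u)) -> cmeasurable f ->
  ball x r y -> ball x r z ->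
  (normc (integral_op mu (a (r `^ m)%R) f y))%:E <=
    (4 * D)%:E * hlmax mu (fun u => (normc (f u))%:E) z.
Proof.
move=> D0 ha r0 ma mf xy xz.
have rk k : (0 < 2 ^+ k * r)%R by rewrite mulr_gt0// exprn_gt0.
pose F u := (normc (f u))%:E.
have F0 u : 0 <= F u by rewrite lee_fin normc_ge0.
have mF : measurable_fun setT F by apply/measurable_EFinP; exact: measurable_normc.
pose M := hlmax mu F z.
pose g n u := (2^-1 ^+ n)%:E *
    (((D / fine (mu (ball y (2 ^+ n.+1 * r))))%:E * (\1_(ball y (2 ^+ n.+1 * r)) u)%:E) * F u).
have V0 n := fine_ball_gt0 hmu y (rk n).
have h0 n : (0 <= 2^-1 ^+ n :> R)%R by rewrite exprn_ge0// invr_ge0.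
have i0 n u : 0 <= (D / fine (mu (ball y (2 ^+ n.+1 * r))))%:E * (\1_(ball y (2 ^+ n.+1 * r)) u)%:E.
  by rewrite mule_ge0// lee_fin// divr_ge0 ?ltW.
have g0 n u : 0 <= g n u.
  by apply: mule_ge0; [rewrite lee_fin|apply: mule_ge0].
have mi n : measurable_fun setT (fun u => (\1_(ball y (2 ^+ n.+1 * r)) u)%:E : \bar R).
  by apply/measurable_EFinP; exact: measurable_indic.
have mg n : measurable_fun setT (g n).
  by apply: measurable_funeM; apply: emeasurable_funM => //; exact: measurable_funeM.
apply: le_trans (normc_cintegral_le mu (cmeasurableM (ma y) mf)) _.
apply: (@le_trans _ _ (2%:E * \int[mu]_u \sum_(n <oo) g n u)).
  apply: lee_wpmul2l => //; apply: ge0_integral_mono => u _; first by rewrite lee_fin normc_ge0.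
  rewrite normcM EFinM.
  apply: le_trans (lee_wpmul2r (F0 u) (kernel_le_series y u (ltW D0) ha r0)) _.
  rewrite muleC -nneseriesZl; last by move=> k _; rewrite mule_ge0// lee_fin.
  rewrite le_eqVlt; apply/orP; left; apply/eqP; apply: eq_eseriesr => k _.
  by rewrite /g muleCA; congr (_ * _); rewrite muleC.
rewrite integral_nneseries//.
apply: (@le_trans _ _ (2%:E * (2%:E * (D%:E * M)))); last first.
  by rewrite !muleA -!EFinM; apply: lee_wpmul2r; [exact: hlmax_ge0|rewrite lee_fin; lra].
apply: lee_wpmul2l => //.
pose b n := D%:E * mean mu y (2 ^+ n.+1 * r)%R F.
have b0 n : 0 <= b n by rewrite mule_ge0 ?mean_ge0// lee_fin ltW.
have bM n : b n <= D%:E * M.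
  apply: lee_wpmul2l; first by rewrite lee_fin ltW.
  apply: mean_le_hlmax => //; rewrite mballE; move: xy xz; rewrite !mballE => xy xz.
  have h2 : (2 * r <= 2 ^+ n.+1 * r)%R by rewrite ler_pM2r// exprS ler_peMr// exprn_ege1// ler1n.
  have := metric_triangle y x z; rewrite (metric_sym y x); lra.
apply: le_trans (series_half_le b0 bM).
apply: lee_nneseries => [n _ _|n _]; first exact: integral_ge0.
rewrite /g ge0_integralZl_EFin//; last 2 first.
- by move=> u _; rewrite mule_ge0.
- by apply: emeasurable_funM => //; exact: measurable_funeM.
apply: lee_wpmul2l; first by rewrite lee_fin.
under eq_integral do rewrite -muleA.
rewrite ge0_integralZl_EFin//; last 3 first.
- by move=> u _; rewrite mule_ge0// lee_fin.
- exact: emeasurable_funM.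
- by rewrite divr_ge0 ?ltW.
rewrite /b /mean EFinM -muleA; apply: lee_wpmul2l; first by rewrite lee_fin ltW.
apply: lee_wpmul2l; first by rewrite lee_fin invr_ge0 ltW.
rewrite [leRHS]integral_mkcond; apply: ge0_integral_mono => u _; first by rewrite mule_ge0// lee_fin.
by rewrite patchE indicE; case: ifPn => _; rewrite ?mul1e ?mul0e.
Qed.

Lemma sharp_dominatedP (D m : R) (a : R -> X -> X -> R[i]) (f : X -> R[i]) (V : X -> \bar R) :
  (0 < D)%R -> dyadic_decay D m a ->
  (forall t u, (0 < t)%R -> cmeasurable (a t u)) -> cmeasurable f ->
  (forall x r, (0 < r)%R ->
    \int[mu]_(y in ball x r) (normc (f y - integral_op mu (a (r `^ m)%R) f y))%:E <=
    \int[mu]_(y in ball x r) V y) ->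
  sharp_dominated mu (1 + 4 * D) (fun u => (normc (f u))%:E) V.
Proof.
move=> D0 ha ma mf osc x r z c r0 xz hc; apply: le_trans (osc x r r0).
have rm : (0 < r `^ m)%R by exact: powR_gt0.
apply: ge0_integral_mono => y xy; first by rewrite le_max lexx.
have c0 : (0 <= c)%R.
  rewrite -lee_fin; apply: le_trans hc; apply: hlmax_ge0 => u.
  by rewrite lee_fin normc_ge0.
rewrite ge_max lee_fin normc_ge0 -EFinB lee_fin lerBlDr.
have := le_trans (integral_op_le_hlmax D0 ha r0 (fun u => ma _ u rm) mf xy xz)
  (lee_wpmul2l _ hc) => /(_ _)/wrap[]; first by rewrite lee_fin mulr_ge0// ltW.
rewrite -EFinM lee_fin => hA.
have := le_normcD (f y - integral_op mu (a (r `^ m)%R) f y)%R (integral_op mu (a (r `^ m)%R) f y).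
rewrite subrK; lra.
Qed.

End Kernels.

(** * Majorants that satisfy the A_1 condition *)

Section Majorants.
Local Open Scope ereal_scope.
Context {R : realType} {d : measure_display} {X : borelMetricType R d}.
Variable mu : {measure set X -> \bar R}.
Hypothesis hmu : doubling mu.

(** A large ball around [x] contains a non-null part of the support of [H]. *)
Lemma hlmax_gt0 (H : X -> \bar R) x : measurable_fun setT H -> (forall x, 0 <= H x) ->
  0 < mu [set x | 0 < H x] -> 0 < hlmax mu H x.
Proof.
move=> mH H0; rewrite lt0e => /andP[Hn0 _]; rewrite ltNge; apply: contra Hn0 => hx.
have mA := measurable_gt 0 mH.
have neg n : mu.-negligible ([set x | 0 < H x] `&` ball x n.+1%:R).
  have n0 : (0 < n.+1%:R :> R)%R by rewrite ltr0n.
  have : \int[mu]_(y in ball x n.+1%:R) `|H y| = 0.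
    apply/eqP; rewrite eq_le integral_ge0// andbT.
    apply: (@le_trans _ _ (\int[mu]_(y in ball x n.+1%:R) H y)).
      by apply: ge0_integral_mono => // y _; rewrite gee0_abs.
    apply: le_trans (integral_ball_le hmu H n0 (ball_ctr x n0)) _.
    rewrite -[leRHS](mule0 (mu (ball x n.+1%:R))); exact: lee_wpmul2l.
  move/(ae_eq_integral_abs mu (measurable_mball _ _) (measurable_funT mH)).
  by apply: negligibleS => y [Hy xy] /= h; move: Hy; rewrite /= h// ltxx.
apply/eqP/measure_negligible => //; apply: negligibleS (negligible_bigcup neg).
move=> y Hy; exists (Num.trunc (mdist x y)) => //; split => //.
by rewrite mballE truncnS_gt.
Qed.

(** The Rubio de Francia majorant, made finite and positive everywhere. *)
Lemma A1_majorant (q K : R) (w : X -> R) (H : X -> \bar R) : (1 < q)%R -> (0 < K)%R ->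
    Aq_weight mu q K w -> measurable_fun setT H -> (forall x, 0 <= H x) ->
    0 < mu [set x | 0 < H x] -> \int[mu]_x (H x `^ q * (w x)%:E) < +oo ->
  exists u : X -> R, [/\ measurable_fun setT u, forall x, (0 < u x)%R,
    {ae mu, forall x, H x <= (u x)%:E},
    exists2 C, (0 < C)%R & {ae mu, forall x, hlmax mu (EFin \o u) x <= (C * u x)%:E} &
    \int[mu]_x (u x `^ q * w x)%:E < +oo].
Proof.
move=> q1 K0 hw mH H0 Hn Hfin; have [mw wp _] := hw.
have w0 x : (0 <= w x)%R by exact: ltW.
have q0 : (0 < q)%R by exact: lt_trans q1.
have msg := @measurable_powR_fun R d X _ (- (q - 1)^-1)%R mw.
have [N N0 hN] := muckenhoupt_maximal hmu q1 K0 hw mw w0 msg (fun x => powR_ge0 _ _).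
have mp (f : X -> \bar R) r : measurable_fun setT f -> measurable_fun setT (fun y => f y `^ r).
  exact: (measurableT_comp (measurable_poweR _)).
have Hfin' : \int[wmeasure mu mw w0]_x (H x `^ q) < +oo.
  by rewrite integral_wmeasure//; [exact: mp|move=> x; exact: poweR_ge0].
have [W [C C0 [mW HW MW]]] := rubio_de_francia q0 N0 hN mH H0 Hfin'.
rewrite integral_wmeasure//; [|exact: mp|by move=> x; exact: poweR_ge0].
move=> Wfin.
have W0 x : 0 < W x.
  have h : 0 < C%:E * W x.
    apply: lt_le_trans (MW x); apply: lt_le_trans (le_hlmax mu x H0 HW).
    exact: hlmax_gt0.
  have W0 : 0 <= W x by exact: le_trans (H0 x) (HW x).
  by rewrite lt_neqAle W0 andbT eq_sym; apply/eqP => e; move: h; rewrite e mule0 ltxx.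
have Wae : {ae mu, forall x, W x < +oo}.
  have mf : measurable_fun setT (fun x => W x `^ q * (w x)%:E).
    by apply: emeasurable_funM; [exact: mp|exact/measurable_EFinP].
  have : mu.-integrable setT (fun x => W x `^ q * (w x)%:E).
    apply/integrableP; split => //; apply: le_lt_trans Wfin.
    apply: ge0_integral_mono => x _; first exact: abse_ge0.
    by rewrite gee0_abs// mule_ge0 ?poweR_ge0// lee_fin.
  move/(integrable_ae measurableT); apply: filterS => x /(_ I) /= fx.
  rewrite ltNge leye_eq; apply/negP => /eqP e; move: fx.
  by rewrite e poweRyr ?gt_eqF// gt0_mulye// lte_fin.
pose u x := if W x == +oo then 1%R else fine (W x).
have uW x : (u x)%:E <= W x.
  rewrite /u; case: eqP => [->|/eqP h]; first exact: leey.
  by rewrite fineK// ge0_fin_numE ?(ltW (W0 x))// lt_neqAle h leey.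
have up x : (0 < u x)%R.
  rewrite /u; case: eqP => // /eqP h; rewrite fine_gt0// W0 lt_neqAle h leey//.
have uae : {ae mu, forall x, W x = (u x)%:E}.
  apply: filterS Wae => x h; rewrite /u lt_eqF// fineK// ge0_fin_numE ?(ltW (W0 x))//.
exists u; split => //.
- apply: measurable_fun_ifT => //; last exact: measurableT_comp.
  rewrite (_ : (fun x => _) = (fun x => ~~ (W x < +oo))); last first.
    by apply/funext => x; rewrite -leNgt leye_eq.
  by apply: measurable_neg; exact: measurable_fun_lte.
- by apply: filterS uae => x <-.
- exists C => //; apply: filterS uae => x e; rewrite EFinM -e; apply: le_trans (MW x).
  by apply: le_hlmax => // y; rewrite /= lee_fin ltW.
- apply: le_lt_trans Wfin; apply: ge0_integral_mono => x _.
    by rewrite lee_fin mulr_ge0 ?powR_ge0.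
  rewrite EFinM -poweR_EFin; apply: lee_wpmul2r; first by rewrite lee_fin.
  by apply: le_poweR => //; [exact: ltW|rewrite lee_fin ltW].
Qed.

Lemma Aq_weight1 (q : R) : (1 < q)%R -> Aq_weight mu q 1 (cst 1%R).
Proof.
move=> q1; split => // x r r0; have Vf := doubling_fin hmu x r.
have V0 := fine_ball_gt0 hmu x r0.
exists (fine (mu (ball x r))), (fine (mu (ball x r))); rewrite fineK//; split.
- by rewrite (eq_integral (cst 1)) ?integral_cst ?mul1e.
- by rewrite (eq_integral (cst 1)) ?integral_cst ?mul1e// => y _ /=; rewrite powR1.
- by rewrite mul1r mulr_powRB1 ?(ltW V0)//; exact: lt_trans ltr01 q1.
Qed.

End Majorants.

(** * The Fefferman-Stein inequality for Muckenhoupt weights *)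

Section WeightedFeffermanStein.
Local Open Scope ereal_scope.
Context {R : realType} {d : measure_display} {X : borelMetricType R d}.
Variable mu : {measure set X -> \bar R}.
Hypothesis hmu : doubling mu.

Let mp (f : X -> \bar R) r : measurable_fun setT f -> measurable_fun setT (fun y => f y `^ r).
Proof. exact: (measurableT_comp (measurable_poweR _)). Qed.

Lemma integral_le_2hlmax (p : R) (u : X -> R) (F : X -> \bar R) : (0 < p)%R ->
  measurable_fun setT u -> (forall x, (0 <= u x)%R) ->
  measurable_fun setT F -> (forall x, 0 <= F x) ->
  \int[mu]_x (F x `^ p * (u x)%:E) <=
  (2 `^ p)%:E * \int[mu]_x (hlmax mu F x `^ p * (u x)%:E).
Proof.
move=> p0 mu_ u0 mF F0.
have muE : measurable_fun setT (EFin \o u) by exact/measurable_EFinP.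
have g0 x : 0 <= hlmax mu F x `^ p * (u x)%:E by rewrite mule_ge0 ?poweR_ge0// lee_fin.
have mg : measurable_fun setT (fun x => hlmax mu F x `^ p * (u x)%:E).
  by apply: emeasurable_funM => //; apply: mp; exact: measurable_hlmax.
rewrite -ge0_integralZl_EFin ?powR_ge0//.
apply: ae_ge0_le_integral => //.
- by move=> x _; rewrite mule_ge0 ?poweR_ge0// lee_fin.
- by apply: emeasurable_funM => //; exact: mp.
- by move=> x _; rewrite mule_ge0// lee_fin powR_ge0.
- exact: measurable_funeM.
apply: filterS (le_2hlmax hmu mF F0) => x h _; rewrite muleA.
apply: lee_wpmul2r; first by rewrite lee_fin.
rewrite -poweR_EFin -poweRM ?hlmax_ge0//.
by apply: le_poweR => //; exact: ltW.
Qed.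

(** If the measure of the space is finite, there is an additional term, which
accounts for the functions with vanishing oscillations. *)
Lemma fs_finite (c : R -> R) (C0 p : R) (u : X -> R) (mu_ : measurable_fun setT u)
    (u0 : forall x, (0 <= u x)%R) : (1 <= C0)%R -> (0 < p)%R ->
    mu setT < +oo -> ainfty mu c (wmeasure mu mu_ u0) ->
  exists2 B, (0 < B)%R & exists2 C, (0 < C)%R & forall F V : X -> \bar R,
    measurable_fun setT F -> (forall x, 0 <= F x) ->
    measurable_fun setT V -> (forall x, 0 <= V x) ->
    sharp_dominated mu C0 F V -> forall del, (0 < del)%R ->
    B%:E * \int[mu]_x F x < del%:E * mu setT ->
    \int[mu]_x (F x `^ p * (u x)%:E) <= C%:E * ((del `^ p)%:E * \int[mu]_x (u x)%:E +
       \int[mu]_x (hlmax mu V x `^ p * (u x)%:E)).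
Proof.
move=> C01 p0 fin hnu; have [c0 _ _] := hnu.
have [B B1 hB] := weak_type hmu.
have [C C0' hC] := fefferman_stein hmu C01 p0 c0.
have B0 : (0 < B)%R by exact: lt_le_trans B1.
exists B => //; exists (2 `^ p * (1 + C))%R; first by rewrite mulr_gt0 ?powR_gt0// addr_gt0.
move=> F V mF F0 mV V0 sharp del del0 hdel.
have proper lam : (del <= lam)%R -> [set x | lam%:E < hlmax mu F x] != setT.
  move=> dl; apply/eqP => e; move: hdel; apply/negP; rewrite -leNgt.
  have lam0 : (0 < lam)%R by exact: lt_le_trans dl.
  apply: le_trans (hB F lam mF F0 lam0); rewrite e; apply: lee_wpmul2r => //.
have := hC _ hnu F V mF F0 V0 sharp del del0 proper.
set A := [set x | del%:E < hlmax mu F x] => h.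
have mA : measurable A by exact/measurable_open/open_hlmax.
apply: le_trans (integral_le_2hlmax p0 mu_ u0 mF F0) _.
rewrite EFinM -muleA; apply: lee_wpmul2l; first by rewrite lee_fin powR_ge0.
have mM := measurable_hlmax mu F.
have J0 : 0 <= \int[mu]_x (hlmax mu V x `^ p * (u x)%:E).
  by apply: integral_ge0 => x _; rewrite mule_ge0 ?poweR_ge0// lee_fin.
have U0 : 0 <= \int[mu]_x (u x)%:E by apply: integral_ge0 => x _; rewrite lee_fin.
rewrite -(integral_wmeasure mu mu_ u0 measurableT (mp p mM)); last by move=> x; exact: poweR_ge0.
rewrite -[X in \int[_]_(x in X) _](setvU A) setUC ge0_integral_setU//=; last 4 first.
- exact: measurableC.
- by apply: measurable_funT; exact: mp.
- by move=> x _; exact: poweR_ge0.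
- by rewrite disj_set2E setICr.
set J := \int[mu]_x (hlmax mu V x `^ p * (u x)%:E) in J0 *.
set U := \int[mu]_x (u x)%:E in U0 *.
have dU0 : 0 <= (del `^ p)%:E * U by rewrite mule_ge0// lee_fin powR_ge0.
apply: (@le_trans _ _ (C%:E * ((del `^ p)%:E * U + J) + (del `^ p)%:E * U)).
  apply: leeD.
    apply: le_trans h _; apply: lee_wpmul2l; first by rewrite lee_fin ltW.
    apply: leeD.
      apply: lee_wpmul2l; first by rewrite lee_fin powR_ge0.
      by rewrite /U -(wmeasureE mu mu_ u0); apply: le_measure; rewrite ?inE.
    by rewrite integral_wmeasure//; [exact: mp (measurable_hlmax _ _)|move=> x; exact: poweR_ge0].
  apply: (@le_trans _ _ (\int[wmeasure mu mu_ u0]_(x in ~` A) cst (del `^ p)%:E x)).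
    apply: ge0_integral_mono => x nA; first exact: poweR_ge0.
    rewrite -poweR_EFin; apply: le_poweR; [exact: ltW|exact: hlmax_ge0|].
    by rewrite leNgt; apply/negP.
  rewrite integral_cst//; last exact: measurableC.
  apply: lee_wpmul2l; first by rewrite lee_fin powR_ge0.
  rewrite /U -[leRHS](wmeasureE mu mu_ u0); apply: le_measure; rewrite ?inE//.
  exact: measurableC.
rewrite EFinD ge0_muleDl ?lee_fin ?(ltW C0')// mul1e addeC; apply: leeD => //.
by rewrite leeDl.
Qed.

(** If the measure of the space is infinite, there is no such term, since no level
set of the maximal function of an L^2 function is the whole space. But the level
sets may have infinite weight; so the weight is first truncated by the multiples
of an A_1 weight in L^2. *)
Lemma fs_infinite (q K C0 p : R) (w : X -> R) : (1 < q)%R -> (0 < K)%R ->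
    Aq_weight mu q K w -> (1 <= C0)%R -> (1 < p)%R -> mu setT = +oo ->
  exists2 C, (0 < C)%R & forall F V : X -> \bar R,
    measurable_fun setT F -> (forall x, 0 <= F x) ->
    measurable_fun setT V -> (forall x, 0 <= V x) ->
    \int[mu]_x (F x `^ 2) < +oo ->
    sharp_dominated mu C0 F V ->
    \int[mu]_x (F x `^ p * (w x)%:E) <= C%:E * \int[mu]_x (hlmax mu V x `^ p * (w x)%:E).
Proof.
move=> q1 K0 hw C01 p1 muy; have [mw wp _] := hw.
have p0 : (0 < p)%R by exact: lt_trans p1.
have w0 x : (0 <= w x)%R by exact: ltW.
have msg := @measurable_powR_fun R d X _ (- (q - 1)^-1)%R mw.
have ain := Aq_ainfty hmu q1 K0 hw mw w0 msg (fun x => powR_ge0 _ _).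
have [N2 N20 hN2] := strong_type hmu (ltr1n R 2).
have [x0 _] : exists x0 : X, True.
  apply: contrapT => h; have e : [set: X] = set0 by rewrite -subset0 => x _; apply: h; exists x.
  by move: muy; rewrite e measure0.
pose H := EFin \o (\1_(ball x0 1) : X -> R).
have mH : measurable_fun setT H by apply/measurable_EFinP; exact: measurable_indic.
have H0 x : 0 <= H x by rewrite lee_fin.
have HE : [set x | 0 < H x] = ball x0 1.
  apply/seteqP; split => x; rewrite /H /= indicE lte_fin.
    by have [//|h] := pselect (ball x0 1 x); rewrite memNset// ltxx.
  by move=> h; rewrite mem_set.
have [phi [mphi phip _ [Cp Cp0 Mphi] phi2]] :
  exists u : X -> R, [/\ measurable_fun setT u, forall x, (0 < u x)%R,
    {ae mu, forall x, H x <= (u x)%:E},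
    exists2 C, (0 < C)%R & {ae mu, forall x, hlmax mu (EFin \o u) x <= (C * u x)%:E} &
    \int[mu]_x (u x `^ 2 * cst 1 x)%:E < +oo].
  apply: (A1_majorant hmu (ltr1n R 2) ltr01 (Aq_weight1 hmu (ltr1n R 2)) mH H0).
    by rewrite HE doubling_gt0.
  rewrite (eq_integral H) ?integral_indic ?setIT ?doubling_lty// => x _.
  rewrite /H /= mule1 indicE; case: (_ \in _); rewrite ?powR1 ?powR0//.
have phi0 x : (0 <= phi x)%R by exact: ltW.
pose v n x := Num.min (w x) (n.+1%:R * phi x)%R.
have mnphi n : measurable_fun setT (fun x => n.+1%:R * phi x)%R by exact: measurable_funM.
have nphi0 n x : (0 <= n.+1%:R * phi x)%R by rewrite mulr_ge0.
have mv n : measurable_fun setT (v n) by exact: measurable_minr.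
have v0 n x : (0 <= v n x)%R by rewrite le_min w0 nphi0.
have ainphi n : ainfty mu (fun theta => theta / Cp)%R (wmeasure mu (mnphi n) (nphi0 n)).
  apply: ainfty_A1 => //; apply: filterS Mphi => x h.
  apply: le_trans (hlmaxZ mu x (ler0n R n.+1) (_ : measurable_fun setT (EFin \o phi)) _) _.
  - exact/measurable_EFinP.
  - by move=> y; rewrite lee_fin.
  - by rewrite mulrCA EFinM; apply: lee_wpmul2l => //; rewrite lee_fin.
have ainv n := ainfty_min hmu (mv n) (v0 n) ain (ainphi n).
have [c0 _ _] := ainv 0%N.
have [C C0' hC] := fefferman_stein hmu C01 p0 c0.
exists (2 `^ p * C)%R; first by rewrite mulr_gt0 ?powR_gt0.
move=> F V mF F0 mV V0 F2 sharp.
have mM := measurable_hlmax mu F.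
have M0 x : 0 <= hlmax mu F x by exact: hlmax_ge0.
have M2 : \int[mu]_x (hlmax mu F x `^ 2) < +oo.
  apply: le_lt_trans (hN2 F mF F0) _.
  have Ff : \int[mu]_x (F x `^ 2) \is a fin_num.
    by rewrite ge0_fin_numE// integral_ge0// => x _; exact: poweR_ge0.
  by rewrite -(fineK Ff) -EFinM ltry.
have proper lam : (0 < lam)%R -> [set x | lam%:E < hlmax mu F x] != setT.
  move=> lam0; apply/eqP => e; move: M2; rewrite ltNge => /negP; apply.
  apply: (@le_trans _ _ (\int[mu]_x (cst (lam `^ 2)%:E x))).
    by rewrite integral_cst// muy gt0_muley// lte_fin powR_gt0.
  apply: ge0_integral_mono => x _; first by rewrite lee_fin powR_ge0.
  rewrite -poweR_EFin; apply: le_poweR => //; first by rewrite lee_fin ltW.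
  by apply: ltW; have : setT x by []; rewrite -e.
set J := \int[mu]_x (hlmax mu V x `^ p * (w x)%:E).
have Jn n : \int[wmeasure mu (mv n) (v0 n)]_x (hlmax mu F x `^ p) <= C%:E * J.
  set nu := wmeasure mu (mv n) (v0 n).
  have A_fin : \int[nu]_x hlmax mu F x < +oo.
    rewrite integral_wmeasure//.
    apply: (@le_lt_trans _ _ (n.+1%:R%:E * (\int[mu]_x (hlmax mu F x `^ 2) +
        \int[mu]_x (phi x `^ 2 * cst 1%R x)%:E))); last first.
      have h1 : \int[mu]_x (hlmax mu F x `^ 2) \is a fin_num.
        by rewrite ge0_fin_numE// integral_ge0// => x _; exact: poweR_ge0.
      have h2 : \int[mu]_x (phi x `^ 2 * cst 1%R x)%:E \is a fin_num.
        by rewrite ge0_fin_numE// integral_ge0// => x _; rewrite lee_fin mulr_ge0 ?powR_ge0.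
      by rewrite -(fineK h1) -(fineK h2) -EFinD -EFinM ltry.
    have mphi2 : measurable_fun setT (fun x => (phi x `^ 2 * cst 1%R x)%:E).
      by apply/measurable_EFinP; apply: measurable_funM => //; exact: measurable_powR_fun.
    have phi20 x : 0 <= (phi x `^ 2 * cst 1%R x)%:E by rewrite lee_fin mulr_ge0 ?powR_ge0.
    rewrite -ge0_integralD//; last 2 first.
    - by move=> x _; exact: poweR_ge0.
    - exact: mp.
    rewrite -ge0_integralZl_EFin//; last 2 first.
    - by move=> x _; rewrite adde_ge0// poweR_ge0.
    - by apply: emeasurable_funD => //; exact: mp.
    apply: ge0_integral_mono => x _; first by rewrite mule_ge0// lee_fin.
    apply: (@le_trans _ _ (hlmax mu F x * (n.+1%:R * phi x)%:E)).
      by apply: lee_wpmul2l => //; rewrite lee_fin ge_min lexx orbT.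
    rewrite EFinM muleCA; apply: lee_wpmul2l; first by rewrite lee_fin.
    rewrite /= mulr1; case: (hlmax mu F x) (M0 x) => [y y0|_|//].
      rewrite poweR_EFin -EFinM -EFinD lee_fin !powR_mulrn//; nra.
    by rewrite gt0_mulye ?lte_fin// poweRyr// addye// leNye.
  pose A := fine (\int[nu]_x hlmax mu F x).
  have A0 : (0 <= A)%R by rewrite fine_ge0// integral_ge0.
  have cheb del : (0 < del)%R -> (del `^ p)%:E * nu [set x | del%:E < hlmax mu F x] <=
      (del `^ (p - 1) * A)%:E.
    move=> del0; rewrite -(mulr_powRB1 (ltW del0) p0) mulrC EFinM -muleA EFinM.
    apply: lee_wpmul2l; first by rewrite lee_fin powR_ge0.
    rewrite /A fineK; last by rewrite ge0_fin_numE// integral_ge0.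
    have mS := measurable_gt del%:E mM.
    rewrite -integral_cst//; apply: (@le_trans _ _ (\int[nu]_(x in [set x | del%:E < hlmax mu F x]) hlmax mu F x)).
      by apply: ge0_integral_mono => x /= h; [rewrite lee_fin ltW|exact: ltW].
    by apply: ge0_subset_integral.
  have Jle : \int[nu]_x (hlmax mu V x `^ p) <= J.
    rewrite integral_wmeasure//; [|exact: mp (measurable_hlmax _ _)|by move=> x; exact: poweR_ge0].
    apply: ge0_integral_mono => x _; first by rewrite mule_ge0 ?poweR_ge0// lee_fin.
    by apply: lee_wpmul2l; [exact: poweR_ge0|rewrite lee_fin ge_min lexx].
  have J0 : 0 <= J by apply: integral_ge0 => x _; rewrite mule_ge0 ?poweR_ge0// lee_fin.
  apply/lee_addgt0Pr => e e0; apply: (integral_le_cutoff p0) => // del del0.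
  have pm1 : (0 < p - 1)%R by rewrite subr_gt0.
  pose e1 := (e / (C * (A + 1)))%R.
  have A1 : (0 < A + 1)%R by lra.
  have e10 : (0 < e1)%R by rewrite divr_gt0// mulr_gt0.
  pose del' := Num.min del (e1 `^ (p - 1)^-1)%R.
  have del'0 : (0 < del')%R by rewrite lt_min del0 powR_gt0.
  have h := hC _ (ainv n) F V mF F0 V0 sharp del' del'0 (fun lam h => proper lam (lt_le_trans del'0 h)).
  apply: (@le_trans _ _ (\int[nu]_(x in [set x | del'%:E < hlmax mu F x]) (hlmax mu F x `^ p))).
    apply: ge0_subset_integral => //; [exact: measurable_gt|exact: measurable_gt| | |].
    - by apply: measurable_funT; exact: mp.
    - by move=> x _; exact: poweR_ge0.
    - by move=> x /=; apply: le_lt_trans; rewrite lee_fin ge_min lexx.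
  apply: le_trans h _; rewrite ge0_muleDr//; last 2 first.
  - by rewrite mule_ge0// lee_fin powR_ge0.
  - by apply: integral_ge0 => x _; exact: poweR_ge0.
  rewrite addeC; apply: leeD.
    by apply: lee_wpmul2l => //; rewrite lee_fin ltW.
  apply: le_trans (lee_wpmul2l _ (cheb _ del'0)) _; first by rewrite lee_fin ltW.
  rewrite -EFinM lee_fin.
  (* The lowest level contributes [del^p nu(hlmax F > del)], which is at most
[del^(p-1)] times the integral of [hlmax F]. *)
have hd : (del' `^ (p - 1) <= e1)%R.
    apply: (@le_trans _ _ ((e1 `^ (p - 1)^-1) `^ (p - 1))%R).
      by rewrite ge0_ler_powR ?nnegrE ?(ltW pm1) ?(ltW del'0) ?powR_ge0// ge_min lexx orbT.
    by rewrite -powRrM mulVf ?gt_eqF// powRr1// ltW.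
  apply: (@le_trans _ _ (C * (e1 * (A + 1)))%R).
    by rewrite ler_pM2l// ler_pM ?powR_ge0//; lra.
  by rewrite /e1 le_eqVlt; apply/orP; left; apply/eqP; field; rewrite !gt_eqF.
apply: le_trans (integral_le_2hlmax p0 mw w0 mF F0) _.
rewrite EFinM -muleA; apply: lee_wpmul2l; first by rewrite lee_fin powR_ge0.
apply: (@monotone_integral_le _ _ _ _ _ _ (fun n x => hlmax mu F x `^ p * (v n x)%:E)) => //.
- by apply: emeasurable_funM; [exact: mp|exact/measurable_EFinP].
- by move=> x _; rewrite mule_ge0 ?poweR_ge0// lee_fin.
- by move=> n; apply: emeasurable_funM; [exact: mp|exact/measurable_EFinP].
- by move=> n x _; rewrite mule_ge0 ?poweR_ge0// lee_fin.
- move=> x _ n1 n2 n12; apply: lee_wpmul2l; first exact: poweR_ge0.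
  rewrite lee_fin le_min !ge_min lexx/=; apply/orP; right.
  by rewrite ler_wpM2r// ler_nat ltnS.
- move=> x r _ h; exists (Num.trunc (w x / phi x)).
  rewrite /v min_l// -ler_pdivrMr//; exact: ltW (truncnS_gt _).
- move=> n; have := Jn n; rewrite integral_wmeasure//; [exact: mp|].
  by move=> x; exact: poweR_ge0.
Qed.

End WeightedFeffermanStein.

(** * Norms of complex functions *)

Section ComplexNorms.
Local Open Scope ereal_scope.
Context {R : realType} {d : measure_display} {Y : measurableType d}.
Variable mu : {measure set Y -> \bar R}.
Implicit Types f g : Y -> R[i].
Import ComplexField.Normc.

Lemma cLnorm_pow (p : R) f : p != 0%R ->
  cLnorm mu p%:E f `^ p = \int[mu]_x (normc (f x) `^ p)%:E.
Proof.
move=> p0; rewrite /cLnorm poweR_Lnorm//; apply: eq_integral => x _.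
by rewrite /= -poweR_EFin ger0_norm ?normc_ge0.
Qed.

Lemma in_cL2P f : in_cL mu 2%:E f <->
  cmeasurable f /\ \int[mu]_x (normc (f x) `^ 2)%:E < +oo.
Proof.
have n0 : 0 <= cLnorm mu 2%:E f by exact: Lnorm_ge0.
split=> -[mf h]; split => //.
  by rewrite -cLnorm_pow// poweR_lty.
have e : cLnorm mu 2%:E f = (cLnorm mu 2%:E f `^ 2) `^ 2^-1.
  by rewrite -poweRrM divff// poweRe1.
by rewrite e poweR_lty// cLnorm_pow.
Qed.

Lemma weighted_Lnorm_le (p t : R) (w : Y -> R) f : (0 < p)%R -> (0 <= t)%R ->
  (forall x, (0 <= w x)%R) ->
  (weighted_Lnorm mu p w f <= t%:E) =
  (\int[mu]_x (normc (f x) `^ p * w x)%:E <= (t `^ p)%:E).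
Proof.
move=> p0 t0 w0; rewrite /weighted_Lnorm; set I := \int[mu]_x _.
have I0 : 0 <= I by apply: integral_ge0 => x _; rewrite lee_fin mulr_ge0 ?powR_ge0.
apply/idP/idP => h.
  have := le_poweR (ltW p0) (poweR_ge0 _ _) h.
  by rewrite -poweRrM mulVf ?gt_eqF// poweRe1.
have := le_poweR (_ : 0 <= p^-1)%R I0 h => /(_ _)/wrap[]; first by rewrite invr_ge0 ltW.
by rewrite poweR_EFin -powRrM mulfV ?gt_eqF// powRr1.
Qed.

Lemma cmeasurable_real (g : Y -> R) : measurable_fun setT g ->
  cmeasurable (fun x => real_complex R (g x)).
Proof. by move=> mg; split => //=; exact: measurable_cst. Qed.

Lemma normc_real (x : R) : normc (real_complex R x) = `|x|%R.
Proof. by rewrite normc_sqrtE /= expr0n addr0 sqrtr_sqr. Qed.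

Lemma L2_bounded_integral (T : (Y -> R[i]) -> Y -> R[i]) : L2_bounded_linear mu T ->
  exists2 C, (0 < C)%R & forall f, in_cL mu 2%:E f -> in_cL mu 2%:E (T f) /\
   \int[mu]_x (normc (T f x) `^ 2)%:E <= C%:E * \int[mu]_x (normc (f x) `^ 2)%:E.
Proof.
move=> [T2 _ [C hC]]; exists ((1 + `|C|) `^ 2)%R.
  by rewrite powR_gt0// ltr_pwDl.
move=> f hf; split; first exact: T2.
rewrite -!cLnorm_pow// -poweR_EFin -poweRM ?lee_fin ?addr_ge0 ?Lnorm_ge0//.
apply: le_poweR => //; first exact: Lnorm_ge0.
apply: le_trans (hC f hf) _; apply: lee_wpmul2r; first exact: Lnorm_ge0.
by rewrite lee_fin (le_trans (ler_norm _))// lerDr.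
Qed.

End ComplexNorms.

(** * Roots of A_1 weights *)

Section A1Roots.
Local Open Scope ereal_scope.
Context {R : realType} {d : measure_display} {X : borelMetricType R d}.
Variable mu : {measure set X -> \bar R}.
Hypothesis hmu : doubling mu.

Lemma muckenhoupt1_hlmax (W : X -> R) (C : R) (x0 : X) : measurable_fun setT W ->
  (forall x, (0 < W x)%R) ->
  {ae mu, forall x, hlmax mu (EFin \o W) x <= (C * W x)%:E} ->
  muckenhoupt1 mu W.
Proof.
move=> mW Wp hW; split; last first.
  exists C => x r r0; apply: filterS hW => y hy xy.
  by rewrite avg_mean//; apply: le_trans hy; exact: mean_le_hlmax.
split => //.
- by move=> x; exact: ltW.
- move=> x r r0; apply/integrableP; split.
    by apply: measurable_funT; exact/measurable_EFinP.
  apply: le_lt_trans (A1_integral_lty hmu x r0 hW).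
  by apply: ge0_integral_mono => y _; rewrite ?abse_ge0//= ger0_norm// ltW.
- move=> /(ae_gt0_point hmu)/(_ x0 1%R ltr01)[z [_ e]].
  by have := Wp z; rewrite e ltxx.
Qed.

Lemma hlmax_root_le (v : X -> R) (C s : R) x : (1 <= s)%R -> (0 < C)%R ->
  measurable_fun setT v -> (forall x, (0 < v x)%R) ->
  hlmax mu (EFin \o v) x <= (C * v x)%:E ->
  hlmax mu (EFin \o (fun y => v y `^ s^-1)%R) x <= (2 * C `^ s^-1 * v x `^ s^-1)%:E.
Proof.
move=> s1 C0 mv vp hv.
have s0 : (0 < s)%R by lra.
have th : (0 <= s^-1 <= 1)%R by rewrite invr_ge0 (ltW s0) invf_le1.
have b0 : (0 < C * v x)%R by rewrite mulr_gt0.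
set b := (C * v x)%R in b0 hv.
have mvE : measurable_fun setT (EFin \o v) by exact/measurable_EFinP.
pose g y := cst (b `^ s^-1)%:E y + (b `^ (s^-1 - 1))%:E * (EFin \o v) y.
apply: (@le_trans _ _ (hlmax mu g x)).
  apply: le_hlmax => y; first by rewrite lee_fin powR_ge0.
  by rewrite /g /= -EFinM -EFinD lee_fin powR_le_affine// ltW.
apply: le_trans (hlmaxD mu x _ _ _ _) _ => //.
- exact: measurable_funeM.
- by move=> y; rewrite lee_fin powR_ge0.
- by move=> y; rewrite -EFinM lee_fin mulr_ge0 ?powR_ge0// ltW.
apply: (@le_trans _ _ ((b `^ s^-1)%:E + (b `^ (s^-1 - 1))%:E * b%:E)).
  apply: leeD; first by apply: hlmax_cst_le => //; exact: powR_ge0.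
  apply: le_trans (hlmaxZ mu x (powR_ge0 _ _) mvE _) _.
    by move=> y; rewrite lee_fin ltW.
  by apply: lee_wpmul2l => //; rewrite lee_fin powR_ge0.
rewrite -EFinM -EFinD lee_fin.
have -> : (b `^ (s^-1 - 1) * b = b `^ s^-1)%R.
  by rewrite mulrC mulr_powRB1// ?invr_gt0// ltW.
by rewrite -mulrA -powRM ?(ltW C0) ?(ltW (vp x))// -/b; lra.
Qed.

(** The mean of [v] over a ball is at most [C * v] almost everywhere on the ball;
the root of this inequality is integrated over the ball for the reverse Hoelder
inequality. *)
Lemma A1_root (v : X -> R) (C s : R) (x0 : X) : (1 <= s)%R -> (0 < C)%R ->
  measurable_fun setT v -> (forall x, (0 < v x)%R) ->
  {ae mu, forall x, hlmax mu (EFin \o v) x <= (C * v x)%:E} ->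
  muckenhoupt1 mu (fun x => v x `^ s^-1)%R /\
  reverse_holder mu s (fun x => v x `^ s^-1)%R.
Proof.
move=> s1 C0 mv vp hv; have s0 : (0 < s)%R by lra.
have mW : measurable_fun setT (fun x => v x `^ s^-1)%R by exact: measurable_powR_fun.
have Wp x : (0 < v x `^ s^-1)%R by exact: powR_gt0.
have A1 : muckenhoupt1 mu (fun x => v x `^ s^-1)%R.
  apply: (muckenhoupt1_hlmax x0 mW Wp (C := (2 * C `^ s^-1)%R)).
  by apply: filterS hv => x; exact: hlmax_root_le.
split => //; split; first by case: A1.
move=> _; exists (C `^ s^-1)%R => x r r0.
have vs y : ((v y `^ s^-1) `^ s = v y)%R by rewrite -powRrM mulVf ?gt_eqF// powRr1// ltW.
under [X in avg _ _ _ X]eq_fun do rewrite vs.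
rewrite !avg_mean//; set I := mean mu x r (fun y => (v y)%:E).
have I0 : 0 <= I by apply: mean_ge0 => y; rewrite lee_fin ltW.
have Iv : {ae mu, forall y, ball x r y -> I <= (C * v y)%:E}.
  by apply: filterS hv => y hy xy; apply: le_trans hy; exact: mean_le_hlmax.
have Ifin : I \is a fin_num.
  have [z [xz hz]] := ae_gt0_point hmu hv x r0.
  rewrite ge0_fin_numE//; apply: (@le_lt_trans _ _ (C * v z)%:E); last exact: ltry.
  by apply: le_trans hz; exact: mean_le_hlmax.
rewrite -(fineK Ifin) poweR_EFin.
have c0 : (0 <= fine I `^ s^-1)%R by exact: powR_ge0.
rewrite -{1}(mean_cst hmu x r0 c0) /mean muleCA; apply: lee_wpmul2l.
  by rewrite lee_fin invr_ge0 ltW// fine_ball_gt0.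
rewrite -[leRHS]ge0_integralZl_EFin ?powR_ge0//; last 2 first.
- by move=> y _; rewrite lee_fin powR_ge0.
- by apply: measurable_funT; exact/measurable_EFinP.
apply: ae_ge0_le_integral => //.
- by move=> y _; rewrite -EFinM lee_fin mulr_ge0 ?powR_ge0.
- by apply: measurable_funeM; apply: measurable_funT; exact/measurable_EFinP.
apply: filterS Iv => y h xy; have := h xy; rewrite -(fineK Ifin) lee_fin => {}h.
rewrite -EFinM lee_fin -powRM ?(ltW C0) ?(ltW (vp y))//.
have cv : (0 <= C * v y)%R by rewrite mulr_ge0// ltW.
by apply: ge0_ler_powR => //=; rewrite ?nnegrE ?fine_ge0 ?invr_ge0 ?(ltW s0).
Qed.

End A1Roots.

(** * Oscillations of the images of dominated functions *)

Section Oscillations.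
Local Open Scope ereal_scope.
Context {R : realType} {d : measure_display} {X : borelMetricType R d}.
Variable mu : {measure set X -> \bar R}.
Hypothesis hmu : doubling mu.
Import ComplexField.Normc.

Lemma kernel_cmeasurable (m : R) (a : R -> X -> X -> R[i]) t u : kernel_family mu m a ->
  (0 < t)%R -> cmeasurable (a t u) /\ cmeasurable (adjoint_kernels a t u).
Proof.
move=> [ma _ _] t0; have [mr mi] := ma t t0; split.
  by split; [exact: (measurableT_comp mr (measurable_pair1 u))|
             exact: (measurableT_comp mi (measurable_pair1 u))].
apply: cmeasurable_conj.
by split; [exact: (measurableT_comp mr (measurable_pair2 u))|
           exact: (measurableT_comp mi (measurable_pair2 u))].
Qed.

(** A function dominated by [t * W] is the product of [W] with a function bounded
by [t]. *)
Lemma bmo_oscillation (m : R) (a : R -> X -> X -> R[i]) (W : X -> R)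
    (S : (X -> R[i]) -> X -> R[i]) : weight mu W -> (forall x, (0 < W x)%R) ->
    bounded_wLinfty_bmo mu m a W S ->
  exists2 c, (0 < c)%R & forall f t, in_cL mu 2%:E f -> (0 < t)%R ->
    {ae mu, forall x, (normc (f x) <= t * W x)%R} ->
    forall x r, (0 < r)%R ->
    \int[mu]_(y in ball x r)
      (normc (S f y - integral_op mu (a (r `^ m)%R) (S f) y))%:E <=
    \int[mu]_(y in ball x r) (c * t * W y)%:E.
Proof.
move=> [mW W0 Wint _] Wp [c0 hc]; exists (1 + `|c0|)%R; first by rewrite ltr_pwDl.
move=> f t [mf f2] t0 ft x r r0; set c := (1 + `|c0|)%R.
have c_gt0 : (0 < c)%R by rewrite ltr_pwDl.
have mWb D : measurable_fun D (EFin \o W) by apply: measurable_funT; exact/measurable_EFinP.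
pose f0 x := (f x * real_complex R (W x `^ (-1)))%R.
have f0W : (fun x => f0 x * real_complex R (W x))%R = f.
  apply/funext => y; rewrite /f0 -mulrA -rmorphM /= powR_inv1// mulVf ?gt_eqF//.
  by rewrite rmorph1 mulr1.
have Nf0 : cLnorm mu +oo f0 <= t%:E.
  rewrite /cLnorm unlock; case: ifPn => _; last by rewrite lee_fin ltW.
  apply/ess_supP; apply: filterS ft => y /=; rewrite lee_fin ger0_norm ?normc_ge0//.
  rewrite normcM normc_real ger0_norm ?powR_ge0// powR_inv1//.
  by rewrite ler_pdivrMr.
have f0oo : in_cL mu +oo f0.
  split; last by apply: le_lt_trans Nf0 _; exact: ltry.
  by apply: cmeasurableM => //; apply: cmeasurable_real; exact: measurable_powR_fun.
have := hc _ f0oo; rewrite /= f0W => /(_ (conj mf f2)) [_].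
set I := \int[mu]_(y in _) _ => hb.
pose w := \int[mu]_(y in ball x r) (EFin \o W) y.
have wfin : w \is a fin_num by exact: integrable_fin_num (Wint x r r0).
have wpos : 0 < w.
  rewrite lt0e integral_ge0 ?andbT; last by move=> y _; rewrite lee_fin.
  apply/eqP => w0; have : \int[mu]_(y in ball x r) `|(EFin \o W) y| = 0.
    by rewrite -w0; apply: eq_integral => y _; rewrite /= ger0_norm.
  move/(ae_eq_integral_abs mu (measurable_mball _ _) (mWb _)).
  move=> /(ae_gt0_point hmu)/(_ x r r0)[z [xz /(_ xz) e]].
  by have := Wp z; rewrite -lte_fin; move: e => /= ->; rewrite ltxx.
have w0 : (0 < fine w)%R by rewrite fine_gt0// wpos/= -ge0_fin_numE// ltW.
have wI : ((fine w)^-1)%:E * I <= (c * t)%:E.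
  have -> : ((fine w)^-1)%:E = w^-1 by rewrite -[in RHS](fineK wfin) inver gt_eqF.
  apply: (@le_trans _ _ (c0%:E * cLnorm mu +oo f0)).
    by apply: le_trans hb; apply: ereal_sup_ubound; exists x, r.
  apply: (@le_trans _ _ (c%:E * cLnorm mu +oo f0)).
    apply: lee_wpmul2r; first exact: Lnorm_ge0.
    by rewrite lee_fin (le_trans (ler_norm _))// lerDr.
  by rewrite EFinM; apply: lee_wpmul2l => //; rewrite lee_fin ltW.
have ct0 : (0 <= c * t)%R by rewrite ltW// mulr_gt0.
under [leRHS]eq_integral do rewrite EFinM.
rewrite ge0_integralZl_EFin//; last by move=> y _; rewrite lee_fin.
rewrite -/w muleC -[X in X * _](fineK wfin).
by rewrite -lee_pdivrMl// in wI *.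
Qed.

(** The form of [bmo_oscillation] in which the Fefferman-Stein inequality uses it,
by the bound of the averaged operators by the maximal function. *)
Lemma bmo_sharp_dominated (m D : R) (a : R -> X -> X -> R[i]) (W : X -> R)
    (S : (X -> R[i]) -> X -> R[i]) : (0 < D)%R -> dyadic_decay mu D m a ->
    (forall t u, (0 < t)%R -> cmeasurable (a t u)) ->
    (forall f, in_cL mu 2%:E f -> in_cL mu 2%:E (S f)) ->
    weight mu W -> (forall x, (0 < W x)%R) -> bounded_wLinfty_bmo mu m a W S ->
  exists2 c, (0 < c)%R & forall f t, in_cL mu 2%:E f -> (0 < t)%R ->
    {ae mu, forall x, (normc (f x) <= t * W x)%R} ->
    sharp_dominated mu (1 + 4 * D) (fun u => (normc (S f u))%:E)
      (fun u => (c * t * W u)%:E).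
Proof.
move=> D0 ha ma hS wW Wp hb; have [c c0 hc] := bmo_oscillation wW Wp hb.
exists c => // f t f2 t0 ft; apply: (sharp_dominatedP hmu D0 ha ma).
  by have [] := hS f f2.
exact: hc.
Qed.

End Oscillations.

(** * Duality on spaces of finite measure *)

Section SignFunctions.
Local Open Scope ereal_scope.
Context {R : realType} {d : measure_display} {Y : measurableType d}.
Variable mu : {measure set Y -> \bar R}.
Implicit Types f g : Y -> R[i].
Import ComplexField.Normc.

Lemma mulc_conj (z : R[i]) : (z * conjc z)%R = real_complex R (normc z `^ 2)%R.
Proof.
case: z => x y; rewrite powR_mulrn ?normc_ge0// normc_sqrtE sqr_sqrtr ?addr_ge0 ?sqr_ge0//.
by apply/eqP; rewrite eq_complex /=; apply/andP; split; apply/eqP; ring.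
Qed.

Lemma cintegral_real (h : Y -> R) :
  normc (cintegral mu (fun x => real_complex R (h x))) = `|\int[mu]_x h x|%R.
Proof.
rewrite normc_sqrtE /cintegral /= Rintegral_cst ?Rintegral0//.
by rewrite -[RHS]sqrtr_sqr; congr (Num.sqrt _); rewrite mul0r expr0n addr0.
Qed.

(** The pairing of [g] with its sign [psi] is the L^1 norm of [g]. *)
Lemma complex_sign g : cmeasurable g -> exists psi, [/\ cmeasurable psi,
  forall x, (normc (psi x) <= 1)%R &
  forall x, (g x * conjc (psi x))%R = real_complex R (normc (g x))].
Proof.
move=> mg; exists (fun x => g x * real_complex R (normc (g x) `^ (-1)))%R; split.
- apply: cmeasurableM => //; apply: cmeasurable_real; apply: measurable_powR_fun.
  exact: measurable_normc.
- move=> x; rewrite normcM normc_real ger0_norm ?powR_ge0// powR_inv1 ?normc_ge0//.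
  have [->|n0] := eqVneq (normc (g x)) 0%R; first by rewrite mul0r.
  by rewrite mulfV.
- move=> x; have -> : conjc (g x * real_complex R (normc (g x) `^ (-1)))%R =
      (conjc (g x) * real_complex R (normc (g x) `^ (-1)))%R.
    by case: (g x) => a b; apply/eqP; rewrite eq_complex /=; apply/andP; split; apply/eqP; ring.
  rewrite mulrA mulc_conj -rmorphM /= powR_inv1 ?normc_ge0// powR_mulrn ?normc_ge0//.
  have [->|n0] := eqVneq (normc (g x)) 0%R; first by rewrite expr0n mul0r.
  by rewrite expr2 mulfK.
Qed.

(** The first term dominates if [b] is at most [a^(p-1) w], and the second one
otherwise. *)
Lemma young_weight (p a b w : R) : (1 < p)%R -> (0 <= a)%R -> (0 <= b)%R -> (0 < w)%R ->
  (a * b <= a `^ p * w + b `^ (p / (p - 1)) * w `^ (- (p - 1)^-1))%R.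
Proof.
move=> p1 a0 b0 w0; have p10 : (0 < p - 1)%R by lra.
have p0 : (0 < p)%R by lra.
have [h|h] := leP b (a `^ (p - 1) * w)%R.
  apply: (@le_trans _ _ (a `^ p * w)%R).
    by rewrite -(mulr_powRB1 a0 p0) -mulrA ler_wpM2l.
  by rewrite lerDl mulr_ge0 ?powR_ge0.
apply: (@le_trans _ _ (b `^ (p / (p - 1)) * w `^ (- (p - 1)^-1))%R); last first.
  by rewrite lerDr mulr_ge0 ?powR_ge0// ltW.
have bp : (0 < b)%R by apply: le_lt_trans h; rewrite mulr_ge0 ?powR_ge0// ltW.
have -> : (p / (p - 1) = 1 + (p - 1)^-1)%R by field; rewrite gt_eqF.
have i0 : (0 < (p - 1)^-1)%R by rewrite invr_gt0.
rewrite powRD ?powRr1//; last by rewrite (gt_eqF bp) implybT.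
rewrite -mulrA mulrC; apply: ler_wpM2l => //.
have -> : a = ((a `^ (p - 1)) `^ (p - 1)^-1)%R by rewrite -powRrM mulfV ?gt_eqF// powRr1.
have -> : (b `^ (p - 1)^-1 * w `^ (- (p - 1)^-1) = (b / w) `^ (p - 1)^-1)%R.
  rewrite powRM// ?invr_ge0 ?(ltW w0)//; congr (_ * _)%R.
  by rewrite -(powR_inv1 (ltW w0)) -powRrM mulN1r.
apply: ge0_ler_powR; rewrite ?nnegrE ?powR_ge0 ?divr_ge0 ?(ltW i0) ?(ltW w0)//.
by rewrite ler_pdivlMr// ltW.
Qed.

Hypothesis mufin : mu setT < +oo.

Lemma in_cL2_le1 psi : cmeasurable psi -> (forall x, (normc (psi x) <= 1)%R) ->
  in_cL mu 2%:E psi.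
Proof.
move=> mpsi psi1; apply/in_cL2P; split => //.
apply: (@le_lt_trans _ _ (\int[mu]_x (cst 1 x))).
  apply: ge0_integral_mono => x _; rewrite lee_fin ?powR_ge0//.
  rewrite powR_mulrn ?normc_ge0// expr_le1 ?normc_ge0//; exact: psi1.
by rewrite integral_cst// mul1e.
Qed.

Lemma integral_normc_le2 g e : cmeasurable g -> (0 < e)%R ->
  \int[mu]_x (normc (g x))%:E <=
  e%:E * \int[mu]_x (normc (g x) `^ 2)%:E + ((4 * e)^-1)%:E * mu setT.
Proof.
move=> mg e0; have mn := measurable_normc mg.
have i0 : (0 < (4 * e)^-1)%R by rewrite invr_gt0 mulr_gt0.
rewrite -ge0_integralZl_EFin ?(ltW e0)//; last 2 first.
- by move=> x _; rewrite lee_fin powR_ge0.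
- by apply/measurable_EFinP; exact: measurable_powR_fun.
rewrite -integral_cst// -ge0_integralD//; last 3 first.
- by move=> x _; rewrite mule_ge0// lee_fin ?powR_ge0// ltW.
- by apply: measurable_funeM; apply/measurable_EFinP; exact: measurable_powR_fun.
- by move=> x _; rewrite lee_fin ltW.
apply: ge0_integral_mono => x _; rewrite lee_fin ?normc_ge0//=.
rewrite powR_mulrn ?normc_ge0//; set n := normc _.
have : (0 <= e * (n - (2 * e)^-1) ^+ 2)%R by rewrite mulr_ge0 ?sqr_ge0// ltW.
have -> : (e * (n - (2 * e)^-1) ^+ 2 = e * n ^+ 2 - n + (4 * e)^-1)%R.
  by field; rewrite gt_eqF.
lra.
Qed.

Variables T Tstar : (Y -> R[i]) -> Y -> R[i].
Hypotheses (hT : L2_bounded_linear mu T) (hTstar : L2_adjoint mu T Tstar).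

Lemma integral_normc_fin f : in_cL mu 2%:E f -> \int[mu]_x (normc (f x))%:E < +oo.
Proof.
move=> /in_cL2P[mf f2]; apply: le_lt_trans (integral_normc_le2 mf ltr01) _.
rewrite mul1e mulr1; apply: lte_add_pinfty => //.
by rewrite -(fineK (_ : mu setT \is a fin_num)) ?ge0_fin_numE// -EFinM ltry.
Qed.

Lemma integral_sign_duality f : in_cL mu 2%:E f -> exists psi, [/\ cmeasurable psi,
  forall x, (normc (psi x) <= 1)%R &
  \int[mu]_x (normc (T f x))%:E <=
    2%:E * \int[mu]_x (normc (f x) * normc (Tstar psi x))%:E].
Proof.
move=> f2; have [T2 _ _] := hT; have [Ts2 adj] := hTstar.
have [mT _] := T2 f f2; have [psi [mpsi psi1 epsi]] := complex_sign mT.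
have psi2 := in_cL2_le1 mpsi psi1.
have [mf _] := f2; have [mTs _] := Ts2 _ psi2.
exists psi; split => //; have := adj f psi f2 psi2.
rewrite {1}/cinner; under [X in cintegral mu X]eq_fun do rewrite epsi.
move=> e.
have n0 : 0 <= \int[mu]_x (normc (T f x))%:E.
  by apply: integral_ge0 => x _; rewrite lee_fin normc_ge0.
have -> : \int[mu]_x (normc (T f x))%:E = (normc (cinner mu f (Tstar psi)))%:E.
  rewrite -e cintegral_real /Rintegral ger0_norm ?fine_ge0// fineK//.
  by rewrite ge0_fin_numE// integral_normc_fin//; exact: T2.
rewrite /cinner; apply: le_trans (normc_cintegral_le mu _) _.
  by apply: cmeasurableM => //; exact: cmeasurable_conj.
by rewrite le_eqVlt; under eq_integral do rewrite normcM normc_conj; rewrite eqxx.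
Qed.

(** The square of the L^2 norm of [Tstar psi] is the pairing of [T (Tstar psi)]
with [psi], and so it is bounded by means of the boundedness of [T]. *)
Lemma adjoint_le1_bound : exists2 C, (0 < C)%R & forall psi, cmeasurable psi ->
  (forall x, (normc (psi x) <= 1)%R) ->
  \int[mu]_x (normc (Tstar psi x))%:E <= C%:E * mu setT.
Proof.
have [C C0 hC] := L2_bounded_integral hT; have [Ts2 adj] := hTstar.
exists (4 * C + 4^-1)%R; first by rewrite addr_gt0// mulr_gt0.
move=> psi mpsi psi1; have psi2 := in_cL2_le1 mpsi psi1.
have h2 := Ts2 _ psi2; set h := Tstar psi in h2 *.
have [Th2 hTh] := hC h h2.
have /in_cL2P[mh hfin] := h2; have [mTh _] := Th2.
set A := \int[mu]_x (normc (h x) `^ 2)%:E in hTh hfin *.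
have A0 : 0 <= A by apply: integral_ge0 => x _; rewrite lee_fin powR_ge0.
have Afin : A \is a fin_num by rewrite ge0_fin_numE.
have mfin : mu setT \is a fin_num by rewrite ge0_fin_numE.
have Ale : A <= (4 * C)%:E * mu setT.
  have e : A = (normc (cinner mu (T h) psi))%:E.
    rewrite (adj h psi h2 psi2) /cinner -/h.
    under [X in cintegral mu X]eq_fun do rewrite mulc_conj.
    rewrite cintegral_real /Rintegral ger0_norm ?fine_ge0// fineK//.
  have : A <= 2%:E * \int[mu]_x (normc (T h x))%:E.
    rewrite e; apply: le_trans (normc_cintegral_le mu _) _.
      by apply: cmeasurableM => //; exact: cmeasurable_conj.
    apply: lee_wpmul2l => //; apply: ge0_integral_mono => x _; first by rewrite lee_fin normc_ge0.
    by rewrite lee_fin normcM normc_conj ler_piMr ?normc_ge0.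
  (* For this [e], half of [A] appears on the right-hand side. *)
  have e0 : (0 < (4 * C)^-1)%R by rewrite invr_gt0 mulr_gt0.
  move/le_trans => /(_ _ (lee_wpmul2l _ (integral_normc_le2 mTh e0)))/wrap[//|].
  have : ((4 * C)^-1)%:E * \int[mu]_x (normc (T h x) `^ 2)%:E <= (4^-1)%:E * A.
    apply: le_trans (lee_wpmul2l _ hTh) _; first by rewrite lee_fin ltW.
    by rewrite muleA -EFinM invfM mulfVK ?gt_eqF.
  move=> h1 h3.
  have n2 : 0 <= 2%:E :> \bar R by [].
  have {h1 h3} := le_trans h3 (lee_wpmul2l n2 (leeD h1 (lexx _))).
  rewrite -(fineK Afin) -(fineK mfin) -!EFinM !lee_fin.
  have -> : ((4 * (4 * C)^-1)^-1 = C)%R by field; rewrite gt_eqF.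
  lra.
apply: le_trans (integral_normc_le2 mh ltr01) _.
rewrite mul1e mulr1 EFinD muleDl ?fin_num_adde_defl//; exact: leeD.
Qed.

End SignFunctions.

Section BoundedSpaces.
Local Open Scope ereal_scope.
Context {R : realType} {d : measure_display} {X : borelMetricType R d}.
Variable mu : {measure set X -> \bar R}.
Hypotheses (hmu : doubling mu) (mufin : mu setT < +oo).
Variables T Tstar : (X -> R[i]) -> X -> R[i].
Hypotheses (hT : L2_bounded_linear mu T) (hTstar : L2_adjoint mu T Tstar).
Import ComplexField.Normc.

(** The integral of [|T f|] is the pairing of [f] with the image under [Tstar] of a
function bounded by 1. These images are bounded in the space dual to [L^p_w], by
the Fefferman-Stein inequality for [Tstar] and the dual weight. *)
Lemma integral_le_weighted (m D p K : R) (b : R -> X -> X -> R[i]) (w : X -> R) (x0 : X) :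
    (0 < D)%R -> dyadic_decay mu D m b ->
    (forall t u, (0 < t)%R -> cmeasurable (b t u)) ->
    bounded_wLinfty_bmo mu m b (cst 1%R) Tstar ->
    (1 < p)%R -> (0 < K)%R -> Aq_weight mu p K w ->
  exists2 C, (0 < C)%R & forall f t, in_cL mu 2%:E f -> (0 < t)%R ->
    \int[mu]_x (normc (f x) `^ p * w x)%:E <= (t `^ p)%:E ->
    \int[mu]_x (normc (T f x))%:E <= (C * t)%:E.
Proof.
move=> D0 hb mb hbmo p1 K0 hw; have [mw wp hwb] := hw.
have p10 : (0 < p - 1)%R by lra.
have w0 x : (0 <= w x)%R by exact: ltW.
have msg := measurable_powR_fun (- (p - 1)^-1)%R mw.
have sg0 x : (0 <= w x `^ (- (p - 1)^-1))%R by exact: powR_ge0.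
have ain := Aq_ainfty_dual hmu p1 K0 hw mw w0 msg sg0.
set p' := (p / (p - 1))%R; have p'0 : (0 < p')%R by rewrite divr_gt0//; lra.
have D1 : (1 <= 1 + 4 * D)%R by lra.
have [B B0 [C C0 fs]] := fs_finite hmu D1 p'0 mufin ain.
have [M M0 hM] := adjoint_le1_bound mufin hT hTstar.
have [Ts2 _] := hTstar.
have w1 : weight mu (cst 1%R).
  suff [] : muckenhoupt1 mu (cst 1%R : X -> R) by [].
  apply: (muckenhoupt1_hlmax hmu x0 (C := 1%R)) => //.
  by apply: nearW => x; rewrite mulr1; exact: hlmax_cst_le.
have [c c0 hc] := bmo_sharp_dominated hmu D0 hb mb Ts2 w1 (fun=> ltr01) hbmo.
have [r r0 Xr] := finite_measure_ball x0 hmu mufin.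
have [_ [S [_ eS _]]] := hwb x0 r r0; rewrite Xr in eS.
have S0 : (0 <= S)%R by rewrite -lee_fin -eS; apply: integral_ge0 => x _; rewrite lee_fin.
pose del := (B * M + 1)%R; have del0 : (0 < del)%R by rewrite addr_gt0// mulr_gt0.
pose Q := (C * (del `^ p' * S + (c * 1 * 1) `^ p' * S))%R.
have Q0 : (0 <= Q)%R.
  by rewrite mulr_ge0 ?(ltW C0)// addr_ge0// mulr_ge0// powR_ge0.
have hQ psi : cmeasurable psi -> (forall x, (normc (psi x) <= 1)%R) ->
    \int[mu]_x (normc (Tstar psi x) `^ p' * w x `^ (- (p - 1)^-1))%:E <= Q%:E.
  move=> mpsi psi1; have psi2 := in_cL2_le1 mufin mpsi psi1.
  have [mh _] := Ts2 _ psi2.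
  have hs := hc psi 1%R psi2 ltr01 (nearW _ (fun x => _)).
  have {}hs : sharp_dominated mu (1 + 4 * D) (fun u => (normc (Tstar psi u))%:E)
      (cst (c * 1 * 1)%:E).
    by apply: hs => x; rewrite mulr1.
  have mF : measurable_fun setT (fun u => (normc (Tstar psi u))%:E).
    by apply/measurable_EFinP; exact: measurable_normc.
  have F0 x : 0 <= (normc (Tstar psi x))%:E by rewrite lee_fin normc_ge0.
  have V0 (x : X) : 0 <= cst (c * 1 * 1)%:E x by rewrite lee_fin !mulr1 ltW.
  have hdel : B%:E * \int[mu]_x (normc (Tstar psi x))%:E < del%:E * mu setT.
    apply: (@le_lt_trans _ _ (B%:E * (M%:E * mu setT))).
      by apply: lee_wpmul2l; [rewrite lee_fin ltW|exact: hM].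
    rewrite muleA -EFinM -(fineK (_ : mu setT \is a fin_num)) ?ge0_fin_numE//.
    rewrite -!EFinM lte_fin ltr_pM2r ?ltrDl// fine_gt0// mufin andbT.
    by rewrite -Xr doubling_gt0.
  have := fs _ _ mF F0 (measurable_cst _) V0 hs del del0 hdel.
  rewrite eS => h; apply: (le_trans h); rewrite /Q [leRHS]EFinM; apply: lee_wpmul2l.
    by rewrite lee_fin ltW.
  rewrite [leRHS]EFinD ![in leRHS]EFinM; apply: leeD => //.
  rewrite -[X in _ * X]eS -ge0_integralZl_EFin ?powR_ge0//; last 2 first.
  - by move=> x _; rewrite lee_fin.
  - exact/measurable_EFinP.
  apply: ge0_integral_mono => x _.
    by rewrite mule_ge0 ?lee_fin ?poweR_ge0.
  apply: lee_wpmul2r; first by rewrite lee_fin.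
  rewrite -poweR_EFin; apply: le_poweR; first exact: ltW.
    by apply: hlmax_ge0 => y; rewrite lee_fin !mulr1 ltW.
  by apply: hlmax_cst_le => //; rewrite !mulr1 ltW.
exists (2 * (1 + Q))%R; first by rewrite mulr_gt0// ltr_pwDl.
move=> f t f2 t0 ft; have [mf _] := f2.
have [psi [mpsi psi1 hpsi]] := integral_sign_duality mufin hT hTstar f2.
apply: (le_trans hpsi); rewrite -mulrA EFinM; apply: lee_wpmul2l => //.
have [mh _] := Ts2 _ (in_cL2_le1 mufin mpsi psi1).
have mnf := measurable_normc mf; have mnh := measurable_normc mh.
have t10 : (0 <= t^-1)%R by rewrite invr_ge0 ltW.
pose F x := ((normc (f x) * t^-1) `^ p * w x)%R.
pose G x := (normc (Tstar psi x) `^ p' * w x `^ (- (p - 1)^-1))%R.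
have F0 x : (0 <= F x)%R by rewrite mulr_ge0// powR_ge0.
have G0 x : (0 <= G x)%R by rewrite mulr_ge0// powR_ge0.
have mF : measurable_fun setT F.
  by apply: measurable_funM => //; apply: measurable_powR_fun; exact: measurable_funM.
have mG : measurable_fun setT G.
  by apply: measurable_funM => //; exact: measurable_powR_fun.
have IF : \int[mu]_x (F x)%:E <= 1%:E.
  have e x : (F x)%:E = (t^-1 `^ p)%:E * (normc (f x) `^ p * w x)%:E.
    by rewrite /F powRM ?normc_ge0// -EFinM mulrA [(t^-1 `^ p * _)%R]mulrC.
  under eq_integral do rewrite e.
  rewrite ge0_integralZl_EFin ?powR_ge0//; last 2 first.
  - by move=> x _; rewrite lee_fin mulr_ge0// powR_ge0.
  - by apply/measurable_EFinP; apply: measurable_funM => //; exact: measurable_powR_fun.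
  apply: le_trans (lee_wpmul2l _ ft) _; first by rewrite lee_fin powR_ge0.
  by rewrite -EFinM -powRM ?(ltW t0)// mulVf ?gt_eqF// powR1.
apply: (@le_trans _ _ (\int[mu]_x (t%:E * ((F x)%:E + (G x)%:E)))).
  apply: ge0_integral_mono => x _; first by rewrite lee_fin mulr_ge0 ?normc_ge0.
  rewrite -EFinD -EFinM lee_fin.
  have := young_weight p1 (_ : 0 <= normc (f x) * t^-1)%R (normc_ge0 (Tstar psi x)) (wp x).
  move=> /(_ _)/wrap[]; first by rewrite mulr_ge0 ?normc_ge0.
  by rewrite -(ler_pM2l t0 (_ / _ * _)%R) [(t * _)%R]mulrC mulrAC mulfVK ?gt_eqF//.
rewrite ge0_integralZl_EFin ?(ltW t0)//; last 2 first.
- by move=> x _; rewrite adde_ge0// lee_fin.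
- by apply: emeasurable_funD; exact/measurable_EFinP.
rewrite [X in _ <= X%:E]mulrC EFinM; apply: lee_wpmul2l; first by rewrite lee_fin ltW.
rewrite ge0_integralD//; last 4 first.
- by move=> x _; rewrite lee_fin.
- exact/measurable_EFinP.
- by move=> x _; rewrite lee_fin.
- exact/measurable_EFinP.
by rewrite EFinD; apply: leeD => //; exact: hQ.
Qed.

End BoundedSpaces.

(** * Extrapolation *)

Section Extrapolation.
Local Open Scope ereal_scope.
Context {R : realType} {d : measure_display} {X : borelMetricType R d}.
Variable mu : {measure set X -> \bar R}.
Hypothesis hmu : doubling mu.
Variables (m s : R) (a : R -> X -> X -> R[i]).
Hypotheses (hm : (2 <= m)%R) (ha : kernel_family mu m a) (hs : (1 <= s)%R).
Variables T Tstar : (X -> R[i]) -> X -> R[i].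
Hypotheses (hT : L2_bounded_linear mu T) (hTstar : L2_adjoint mu T Tstar).
Hypothesis hTbmo : forall w : X -> R, muckenhoupt1 mu w -> reverse_holder mu s w ->
  bounded_wLinfty_bmo mu m a w T.
Hypothesis hTstarbmo : forall w : X -> R, muckenhoupt1 mu w -> reverse_holder mu s w ->
  bounded_wLinfty_bmo mu m (adjoint_kernels a) w Tstar.
Variables (p K : R) (w : X -> R).
Hypotheses (sp : (s < p)%R) (K0 : (0 < K)%R) (hw : Aq_weight mu (p / s) K w).
Import ComplexField.Normc.

Let s0 : (0 < s)%R. Proof. exact: lt_le_trans hs. Qed.
Let p1 : (1 < p)%R. Proof. exact: le_lt_trans sp. Qed.
Let p0 : (0 < p)%R. Proof. exact: lt_trans p1. Qed.
Let q1 : (1 < p / s)%R. Proof. by rewrite ltr_pdivlMr// mul1r. Qed.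
Let w0 x : (0 <= w x)%R. Proof. by case: hw => _ h _; exact: ltW. Qed.
Let mw : measurable_fun setT w. Proof. by case: hw. Qed.

(** The oscillations of [T f] are bounded by the multiple [c * t * W] of the root [W]
of [v], whose maximal function is at most a multiple of itself. *)
Lemma dominated_bound (x0 : X) (v : X -> R) (C : R) : (0 < C)%R ->
    measurable_fun setT v -> (forall x, (0 < v x)%R) ->
    {ae mu, forall x, hlmax mu (EFin \o v) x <= (C * v x)%:E} ->
    \int[mu]_x (v x `^ (p / s) * w x)%:E < +oo ->
  exists2 E, (0 <= E)%R & forall f t, in_cL mu 2%:E f -> (0 < t)%R ->
    {ae mu, forall x, (normc (f x) <= t * v x `^ s^-1)%R} ->
    \int[mu]_x (normc (f x) `^ p * w x)%:E <= (t `^ p)%:E ->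
    \int[mu]_x (normc (T f x) `^ p * w x)%:E <= (E * t `^ p)%:E.
Proof.
move=> C0 mv vp hv Jfin; have [T2 _ _] := hT.
have [hA hR] := A1_root hmu x0 hs C0 mv vp hv.
pose W x := (v x `^ s^-1)%R; have Wp x : (0 < W x)%R by exact: powR_gt0.
have mW : measurable_fun setT W by exact: measurable_powR_fun.
have [D D0 hD] := kernel_dyadic_decay hmu hm ha.
have D1 : (1 <= 1 + 4 * D)%R by lra.
have ma t u (t0 : (0 < t)%R) := kernel_cmeasurable u ha t0.
have [c c0 hc] := bmo_sharp_dominated hmu D0 hD (fun t u t0 => proj1 (ma t u t0)) T2
  (proj1 hA) Wp (hTbmo hA hR).
pose C2 := (2 * C `^ s^-1)%R; have C20 : (0 < C2)%R by rewrite mulr_gt0// powR_gt0.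
have hW : {ae mu, forall x, hlmax mu (EFin \o W) x <= (C2 * W x)%:E}.
  by apply: filterS hv => x h; exact: hlmax_root_le.
clearbody C2; set J := \int[mu]_x _ in Jfin; have J0 : 0 <= J.
  by apply: integral_ge0 => x _; rewrite lee_fin mulr_ge0// powR_ge0.
have [j j0 Jj] : exists2 j, (0 <= j)%R & J = j%:E.
  by exists (fine J); rewrite ?fine_ge0// fineK// ge0_fin_numE.
have hV t : (0 < t)%R ->
    \int[mu]_x (hlmax mu (fun u => (c * t * W u)%:E) x `^ p * (w x)%:E) <=
    (t `^ p * ((c * C2) `^ p * j))%:E.
  move=> t0; have ct0 : (0 <= c * t)%R by rewrite mulr_ge0// ltW.
  apply: (@le_trans _ _ (\int[mu]_x ((t `^ p * (c * C2) `^ p)%:E * (v x `^ (p / s) * w x)%:E))).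
    apply: ae_ge0_le_integral => //.
    - by move=> x _; rewrite mule_ge0 ?poweR_ge0// lee_fin.
    - apply: emeasurable_funM; last exact/measurable_EFinP.
      by apply: (measurableT_comp (measurable_poweR _)); exact: measurable_hlmax.
    - by move=> x _; rewrite -EFinM lee_fin !mulr_ge0// powR_ge0.
    - apply: measurable_funeM; apply/measurable_EFinP; apply: measurable_funM => //.
      exact: measurable_powR_fun.
    apply: filterS hW => x h _; rewrite [X in _ <= _ * X]EFinM [leRHS]muleA.
    apply: lee_wpmul2r; first by rewrite lee_fin.
    rewrite -EFinM [(p / s)%R]mulrC powRrM -powRM ?(ltW t0) ?mulr_ge0 ?(ltW c0) ?(ltW C20)//.
    rewrite -powRM ?mulr_ge0 ?(ltW t0) ?(ltW c0) ?(ltW C20) ?powR_ge0// -poweR_EFin.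
    apply: le_poweR; [exact: ltW|by apply: hlmax_ge0 => y; rewrite lee_fin mulr_ge0// ltW|].
    apply: le_trans (hlmaxZ mu x ct0 (_ : measurable_fun setT (EFin \o W)) _) _.
    - exact/measurable_EFinP.
    - by move=> y; rewrite lee_fin ltW.
    apply: le_trans (lee_wpmul2l _ h) _; first by rewrite lee_fin.
    by rewrite -EFinM lee_fin -/(W x) !mulrA [(c * t)%R]mulrC.
  rewrite ge0_integralZl_EFin//; last 3 first.
  - by move=> x _; rewrite lee_fin mulr_ge0// powR_ge0.
  - by apply/measurable_EFinP; apply: measurable_funM => //; exact: measurable_powR_fun.
  - by rewrite mulr_ge0// powR_ge0.
  by rewrite -/J Jj -EFinM mulrA.
have Fm f : in_cL mu 2%:E f -> measurable_fun setT (fun x => (normc (f x))%:E).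
  by case=> mf _; apply/measurable_EFinP; exact: measurable_normc.
have F0 f (x : X) : 0 <= (normc (f x : R[i]))%:E by rewrite lee_fin normc_ge0.
have V0 t (x : X) : (0 < t)%R -> 0 <= (c * t * W x)%:E.
  by move=> t0; rewrite lee_fin !mulr_ge0// ltW.
have mV t : measurable_fun setT (fun x => (c * t * W x)%:E).
  by apply/measurable_EFinP; exact: measurable_funM.
have [muy|mufin] := eqVneq (mu setT) +oo.
  have [E E0 hE] := fs_infinite hmu q1 K0 hw D1 p1 muy.
  exists (E * ((c * C2) `^ p * j))%R; first by rewrite !mulr_ge0 ?powR_ge0// ltW.
  move=> f t f2 t0 ft _; have Tf2 := T2 _ f2.
  have := hE _ _ (Fm _ Tf2) (F0 (T f)) (mV t) (fun x => V0 t x t0) _ (hc f t f2 t0 ft).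
  move=> /(_ _)/wrap[]; first by have /in_cL2P[] := Tf2.
  move=> h; apply: (le_trans h); apply: le_trans (lee_wpmul2l _ (hV t t0)) _.
    by rewrite lee_fin ltW.
  by rewrite -EFinM lee_fin mulrCA [leRHS]mulrC.
have {}mufin : mu setT < +oo by rewrite ltey.
have [D' D'0 hD'] := adjoint_dyadic_decay hmu D0 hD.
have [h1A h1R] : muckenhoupt1 mu (cst 1%R : X -> R) /\ reverse_holder mu s (cst 1%R : X -> R).
  have h1 : {ae mu, forall x, hlmax mu (EFin \o cst 1%R) x <= (1 * cst 1%R x)%:E}.
    by apply: nearW => x; rewrite mulr1; exact: hlmax_cst_le.
  have := A1_root hmu x0 hs ltr01 (measurable_cst _) (fun=> ltr01) h1.
  by under eq_fun do rewrite powR1.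
have pq : (p / s <= p)%R by rewrite ler_pdivrMr// ler_peMr// ltW.
have hwp := Aq_weight_mono hmu q1 pq K0 hw.
have Kp : (0 < 2 `^ (p - 1) * K)%R by rewrite mulr_gt0// powR_gt0.
have [L L0 hL] := integral_le_weighted hmu mufin hT hTstar x0 D'0 hD'
  (fun t u t0 => proj2 (ma t u t0)) (hTstarbmo h1A h1R) p1 Kp hwp.
have msg := measurable_powR_fun (- (p / s - 1)^-1)%R mw.
have ain := Aq_ainfty hmu q1 K0 hw mw w0 msg (fun x => powR_ge0 _ _).
have [B B0 [E E0 hE]] := fs_finite hmu D1 p0 mufin ain.
have [r r0 Xr] := finite_measure_ball x0 hmu mufin.
have [_ _ hwb] := hw; have [U [_ [eU _ _]]] := hwb x0 r r0; rewrite Xr in eU.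
have U0 : (0 <= U)%R by rewrite -lee_fin -eU; apply: integral_ge0 => x _; rewrite lee_fin.
have m0 : (0 < fine (mu setT))%R by rewrite fine_gt0// mufin andbT -Xr doubling_gt0.
(* The lowest level [k * t] is chosen above the weak type bound for the mean. *)
pose k := (B * L / fine (mu setT) + 1)%R.
have k0 : (0 < k)%R by rewrite addr_gt0// divr_gt0// mulr_gt0.
exists (E * (k `^ p * U + (c * C2) `^ p * j))%R.
  by rewrite mulr_ge0 ?(ltW E0)// addr_ge0// mulr_ge0// powR_ge0.
move=> f t f2 t0 ft fw; have Tf2 := T2 _ f2.
have := hE _ _ (Fm _ Tf2) (F0 (T f)) (mV t) (fun x => V0 t x t0) (hc f t f2 t0 ft) (k * t)%R.
move=> /(_ (mulr_gt0 k0 t0))/(_ _)/wrap[].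
  apply: (@le_lt_trans _ _ (B%:E * (L * t)%:E)).
    by apply: lee_wpmul2l; [rewrite lee_fin ltW|exact: hL].
  rewrite -(fineK (_ : mu setT \is a fin_num)) ?ge0_fin_numE// -!EFinM lte_fin.
  rewrite /k mulrDl mulrDl mul1r mulrAC mulfVK ?gt_eqF//.
  by rewrite mulrA ltrDl mulr_gt0.
rewrite eU => h; apply: (le_trans h).
apply: (@le_trans _ _ (E%:E * (((k * t) `^ p)%:E * U%:E + (t `^ p * ((c * C2) `^ p * j))%:E))).
  apply: lee_wpmul2l; first by rewrite lee_fin ltW.
  by apply: leeD => //; exact: hV.
rewrite -!EFinM lee_fin powRM ?(ltW k0) ?(ltW t0)//.
by rewrite le_eqVlt; apply/orP; left; apply/eqP; ring.
Qed.

(** A normalised series of the [s]-th powers is in [L^(p/s)_w], so it has an A_1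
majorant. By the maximum with the indicator of a ball, the series does not vanish
almost everywhere even if all the functions do. *)
Lemma sequence_majorant (x0 : X) (h : nat -> X -> R) (t : nat -> R) :
    (forall k, measurable_fun setT (h k)) -> (forall k x, (0 <= h k x)%R) ->
    (forall k, (0 < t k)%R) ->
    (forall k, \int[mu]_x (h k x `^ p * w x)%:E <= (t k `^ p)%:E) ->
  exists v : X -> R, [/\ measurable_fun setT v, forall x, (0 < v x)%R,
    exists2 C, (0 < C)%R & {ae mu, forall x, hlmax mu (EFin \o v) x <= (C * v x)%:E},
    \int[mu]_x (v x `^ (p / s) * w x)%:E < +oo &
    forall k, {ae mu, forall x, (h k x <= 4 ^+ k * t k * v x `^ s^-1)%R}].
Proof.
move=> mh h0 t0 hw'.
pose g k x := ((h k x * (t k)^-1) `^ s)%R.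
pose b k x := (2^-1 ^+ k * Num.max (\1_(ball x0 1) x) (g k x))%R.
have e0 k : (0 < 2^-1 ^+ k :> R)%R by rewrite exprn_gt0// invr_gt0.
have g0 k x : (0 <= g k x)%R by exact: powR_ge0.
have M0 k x : (0 <= Num.max (\1_(ball x0 1) x) (g k x))%R by rewrite le_max g0 orbT.
have b0 k x : 0 <= (b k x)%:E by rewrite lee_fin mulr_ge0// ltW.
have mi : measurable_fun setT (\1_(ball x0 1) : X -> R) by exact: measurable_indic.
have mb k : measurable_fun setT (fun x => (b k x)%:E).
  apply/measurable_EFinP; apply: measurable_funM => //; apply: measurable_maxr => //.
  by apply: measurable_powR_fun; exact: measurable_funM.
pose H x := \sum_(k <oo) (2^-1 ^+ k)%:E * (b k x)%:E.
have term0 x k : 0 <= (2^-1 ^+ k)%:E * (b k x)%:E by rewrite mule_ge0// lee_fin ltW.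
have mH : measurable_fun setT H.
  by apply: (measurable_nneseries (h := fun k x => _)) => // k; exact: measurable_funeM.
have H0 x : 0 <= H x by apply: nneseries_ge0.
have bH k x : (2^-1 ^+ k * b k x)%:E <= H x.
  by rewrite EFinM; exact: (le_term_nneseries k (term0 x)).
have Hpos : 0 < mu [set x | 0 < H x].
  apply: lt_le_trans (doubling_gt0 hmu x0 ltr01) _; apply: le_measure; rewrite ?inE.
  - exact: measurable_mball.
  - exact: measurable_gt.
  move=> x xB; apply: lt_le_trans (bH 0%N x).
  by rewrite /b !expr0 !mul1r lte_fin lt_max indicE mem_set// ltr01.
have q0 : (0 < p / s)%R by exact: lt_trans q1.
have [_ _ hwb] := hw; have [U [_ [eU _ _]]] := hwb x0 1%R ltr01.
have mpow (r : R) (G : X -> \bar R) : measurable_fun setT G -> measurable_fun setT (fun x => G x `^ r).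
  exact: (measurableT_comp (measurable_poweR _)).
have mhw k : measurable_fun setT (fun x => (h k x `^ p * w x)%:E).
  by apply/measurable_EFinP; apply: measurable_funM => //; exact: measurable_powR_fun.
have bk k : \int[wmeasure mu mw w0]_x ((b k x)%:E `^ (p / s)) <=
    (2^-1 ^+ k)%:E * (U + 1)%:E.
  rewrite integral_wmeasure//; [|exact: mpow|by move=> x; exact: poweR_ge0].
  apply: (@le_trans _ _ (\int[mu]_x ((2^-1 ^+ k)%:E *
      ((\1_(ball x0 1) x * w x)%:E + (t k `^ (- p))%:E * (h k x `^ p * w x)%:E)))).
    apply: ge0_integral_mono => x _; first by rewrite mule_ge0 ?poweR_ge0// lee_fin.
    rewrite poweR_EFin -!EFinM lee_fin [(t k `^ _ * _)%R]mulrA -mulrDl mulrA.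
    apply: ler_wpM2r => //; apply: le_trans (ge1r_powRZ _ (M0 k x) (ltW q1)) _.
      by rewrite e0 exprn_ile1// ?invr_ge0// invf_le1// ler1n.
    apply: ler_wpM2l; first exact: ltW.
    have gq : (g k x `^ (p / s) = t k `^ (- p) * h k x `^ p)%R.
      rewrite /g -powRrM mulrCA mulfV ?gt_eqF// mulr1 powRM ?invr_ge0 ?(ltW (t0 k))//.
      by rewrite mulrC -(powR_inv1 (ltW (t0 k))) -powRrM mulN1r.
    rewrite -gq maxEle; case: ifPn => _; first by rewrite lerDr.
    by rewrite indicE; case: (_ \in _); rewrite ?powR1 ?powR0 ?gt_eqF//= ?lerDl ?powR_ge0//.
  rewrite ge0_integralZl_EFin ?(ltW (e0 k))//; last 2 first.
  - by move=> x _; rewrite adde_ge0// -?EFinM lee_fin !mulr_ge0 ?powR_ge0.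
  - apply: emeasurable_funD; last exact: measurable_funeM.
    by apply/measurable_EFinP; exact: measurable_funM.
  apply: lee_wpmul2l; first by rewrite lee_fin ltW.
  rewrite ge0_integralD//; last 4 first.
  - by move=> x _; rewrite lee_fin mulr_ge0.
  - by apply/measurable_EFinP; exact: measurable_funM.
  - by move=> x _; rewrite -EFinM lee_fin !mulr_ge0 ?powR_ge0.
  - exact: measurable_funeM.
  rewrite EFinD; apply: leeD.
    rewrite -eU [leRHS]integral_mkcond; apply: ge0_integral_mono => x _.
      by rewrite lee_fin mulr_ge0.
    by rewrite patchE indicE; case: ifPn => _; rewrite ?mul1r ?mul0r.
  rewrite ge0_integralZl_EFin ?powR_ge0//; last first.
    by move=> x _; rewrite lee_fin mulr_ge0 ?powR_ge0.
  apply: le_trans (lee_wpmul2l _ (hw' k)) _; first by rewrite lee_fin powR_ge0.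
  by rewrite -EFinM powRN mulVf ?gt_eqF// powR_gt0.
have Hfin : \int[mu]_x (H x `^ (p / s) * (w x)%:E) < +oo.
  rewrite -(integral_wmeasure mu mw w0 measurableT); last 2 first.
  - exact: mpow.
  - by move=> x; exact: poweR_ge0.
  apply: le_lt_trans (integral_series_half_pow _ q0 mb b0) _.
  apply: (@le_lt_trans _ _ ((2 `^ (p / s))%:E * (2%:E * (U + 1)%:E))); last first.
    by rewrite -!EFinM ltry.
  apply: lee_wpmul2l; first by rewrite lee_fin powR_ge0.
  have U1 : 0 <= (U + 1)%:E.
    rewrite lee_fin addr_ge0// -lee_fin -eU; apply: integral_ge0 => x _; by rewrite lee_fin.
  apply: le_trans (series_half_le (fun=> U1) (fun=> lexx _)).
  by apply: lee_nneseries => [k _ _|k _ //]; apply: integral_ge0 => x _; exact: poweR_ge0.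
have [v [mv vp Hv hC vfin]] := A1_majorant hmu q1 K0 hw mH H0 Hpos Hfin.
exists v; split => // k; apply: filterS Hv => x hx.
have := le_trans (bH k x) hx; rewrite lee_fin /b mulrA -exprMn => hb.
have {hb} hg : (g k x <= 4 ^+ k * v x)%R.
  have : ((2^-1 * 2^-1) ^+ k * g k x <= v x)%R.
    apply: le_trans hb; apply: ler_wpM2l; first by rewrite exprn_ge0// mulr_ge0// invr_ge0.
    by rewrite le_max lexx orbT.
  have -> : (2^-1 * 2^-1 = 4^-1 :> R)%R by field.
  by rewrite exprVn ler_pdivrMl// exprn_gt0.
have hs1 : (h k x * (t k)^-1 <= (4 ^+ k * v x) `^ s^-1)%R.
  have -> : (h k x * (t k)^-1 = g k x `^ s^-1)%R.
    by rewrite /g -powRrM mulfV ?gt_eqF// powRr1// mulr_ge0// invr_ge0 ltW.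
  by apply: ge0_ler_powR => //; rewrite ?nnegrE ?invr_ge0 ?(ltW s0)// mulr_ge0 ?exprn_ge0// ltW.
have k1 : ((4 ^+ k) `^ s^-1 <= 4 ^+ k :> R)%R.
  by apply: ler1_powR; [rewrite exprn_ege1// ler1n|rewrite invf_le1].
rewrite mulrAC -ler_pdivrMr//; apply: (le_trans hs1).
by rewrite powRM ?exprn_ge0// ?(ltW (vp x))//; apply: ler_wpM2r => //; exact: powR_ge0.
Qed.

(** If the bounds failed, then one majorant would dominate a sequence of
functions for which they fail arbitrarily badly. *)
Lemma weighted_bound (x0 : X) : weighted_L_bounded mu p w T.
Proof.
apply: contrapT => unb.
have bad k : exists ft : (X -> R[i]) * R, [/\ in_cL mu 2%:E ft.1, (0 < ft.2)%R,
    weighted_Lnorm mu p w ft.1 <= ft.2%:E &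
    (16 ^+ k * ft.2)%:E < weighted_Lnorm mu p w (T ft.1)].
  apply: contrapT => nex; apply: unb; exists (16 ^+ k)%R => f f2 [_ fw].
  rewrite leNgt; apply/negP => lt; apply: nex.
  have n0 : 0 <= weighted_Lnorm mu p w f by exact: poweR_ge0.
  have nfin : weighted_Lnorm mu p w f \is a fin_num by rewrite ge0_fin_numE.
  have N0 : (0 <= fine (weighted_Lnorm mu p w f))%R by rewrite fine_ge0.
  have NE := fineK nfin; set N := fine _ in N0 NE.
  have e0 : (0 < 16 ^+ k :> R)%R by rewrite exprn_gt0.
  move: lt; rewrite -NE -EFinM.
  case E : (weighted_Lnorm mu p w (T f)) (poweR_ge0 _ _ : 0 <= weighted_Lnorm mu p w (T f)) => [y| |] // _ lt.
    have Ny : (N < y / 16 ^+ k)%R by rewrite ltr_pdivlMr// mulrC -lte_fin.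
    exists (f, (N + y / 16 ^+ k) / 2)%R; split => //=; rewrite ?E -?NE ?lee_fin ?lte_fin.
    - by lra.
    - by lra.
    - have -> : (16 ^+ k * ((N + y / 16 ^+ k) / 2) = (16 ^+ k * N + y) / 2)%R.
        by field; rewrite gt_eqF.
      by move: lt; rewrite lte_fin; lra.
  by exists (f, N + 1)%R; split => //=; rewrite ?E -?NE ?lee_fin ?ltry//; lra.
have /choice[F hF] := bad.
pose f k := (F k).1; pose t k := (F k).2.
have f2 k : in_cL mu 2%:E (f k) by case: (hF k).
have t0 k : (0 < t k)%R by case: (hF k).
have fw k : \int[mu]_x (normc (f k x) `^ p * w x)%:E <= (t k `^ p)%:E.
  by rewrite -weighted_Lnorm_le ?(ltW (t0 k))//; case: (hF k).
have mf k : measurable_fun setT (fun x => normc (f k x)).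
  by apply: measurable_normc; case: (f2 k).
have [v [mv vp [C C0 hC] vfin fv]] := sequence_majorant x0 mf (fun k x => normc_ge0 _) t0 fw.
have [E E0 hE] := dominated_bound x0 C0 mv vp hC vfin.
(* For this [k], the constant of [dominated_bound] is less than [4 ^+ k]. *)
pose k := (Num.trunc ((1 + E) `^ p^-1)).+1.
have k4 : (1 <= 4 ^+ k :> R)%R by rewrite exprn_ege1// ler1n.
have kt0 : (0 < 4 ^+ k * t k)%R by rewrite mulr_gt0// (lt_le_trans ltr01).
have fk : \int[mu]_x (normc (f k x) `^ p * w x)%:E <= ((4 ^+ k * t k) `^ p)%:E.
  apply: le_trans (fw k) _; rewrite lee_fin ge0_ler_powR ?nnegrE ?(ltW p0) ?(ltW (t0 k)) ?(ltW kt0)//.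
  by rewrite ler_peMl// ltW.
have := hE _ _ (f2 k) kt0 (fv k) fk.
have [_ _ _] := hF k; rewrite -/(f k) -/(t k) ltNge => /negP nle le; apply: nle.
rewrite weighted_Lnorm_le//; last by rewrite mulr_ge0 ?exprn_ge0// ltW.
apply: (le_trans le); rewrite lee_fin.
have -> : (16 ^+ k * t k = 4 ^+ k * (4 ^+ k * t k))%R.
  by rewrite mulrA -exprMn; congr (_ ^+ _ * _)%R; ring.
rewrite [leRHS]powRM ?exprn_ge0// ?(ltW kt0)//; apply: ler_wpM2r; first exact: powR_ge0.
apply: (@le_trans _ _ (1 + E)%R); first by rewrite lerDr.
have -> : (1 + E = ((1 + E) `^ p^-1) `^ p)%R by rewrite -powRrM mulVf ?gt_eqF// powRr1// addr_ge0.
apply: ge0_ler_powR; rewrite ?nnegrE ?powR_ge0 ?exprn_ge0 ?(ltW p0)//.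
apply: ltW; apply: (lt_trans (truncnS_gt _)); rewrite -/k -natrX ltr_nat.
exact: ltn_expl.
Qed.

End Extrapolation.

Unset Implicit Arguments.

Theorem theorem4p3 (R : realType) (d : measure_display)
    (X : borelMetricType R d) (mu : {measure set X -> \bar R})
    (hmu : doubling mu)
    (m : R) (hm : 2 <= m)
    (a : R -> X -> X -> R[i]) (ha : kernel_family mu m a)
    (s : R) (hs : 1 <= s)
    (T Tstar : (X -> R[i]) -> X -> R[i])
    (hT : L2_bounded_linear mu T) (hTstar : L2_adjoint mu T Tstar)
    (hTbmo : forall w : X -> R, muckenhoupt1 mu w -> reverse_holder mu s w ->
       bounded_wLinfty_bmo mu m a w T)
    (hTstarbmo : forall w : X -> R,
       muckenhoupt1 mu w -> reverse_holder mu s w ->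
       bounded_wLinfty_bmo mu m (adjoint_kernels a) w Tstar) :
  forall p : R, s < p -> forall w : X -> R, muckenhoupt mu (p / s) w ->
    weighted_L_bounded mu p w T.
Proof.
move=> p sp w hw.
have s0 : 0 < s by exact: lt_le_trans hs.
have q1 : 1 < p / s by rewrite ltr_pdivlMr// mul1r.
have [[mw w0 _ wn0] _] := hw.
have [x0 _] : exists x0 : X, True.
  apply: contrapT => h; apply: wn0.
  by apply: nearW => x; exfalso; apply: h; exists x.
have [w' ww' [K K0 hw']] := muckenhoupt_Aq_weight hmu q1 hw.
have [C hC] := weighted_bound hmu hm ha hs hT hTstar hTbmo hTstarbmo sp K0 hw' x0.
have [mw' w'p _] := hw'.
have eqN f : cmeasurable f -> weighted_Lnorm mu p w f = weighted_Lnorm mu p w' f.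
  move=> /measurable_normc mf; congr (_ `^ _)%E.
  have mpow := measurable_powR_fun p mf.
  apply: ae_eq_integral => //; try by apply/measurable_EFinP; exact: measurable_funM.
  by apply: filterS ww' => x e _; rewrite e.
have [T2 _ _] := hT.
exists C => f f2 [mf fw]; have [mTf _] := T2 f f2.
by rewrite !eqN//; apply: hC => //; split=> //; rewrite -eqN.
Qed.
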